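(* Let $n\ge1$, let $V\subset\mathbb P^{n+1}(\mathbb C)$ be a reduced algebraic hypersurface of degree $d$, and for $0\le q\le n$ let $\omega^q(V)$ be the complex vector space of abelian $q$-forms on $V$. Then $\omega^q(V)$ is finite dimensional and $$\dim\omega^q(V)\le\pi_q(d,2,n):=\binom{n}{q}\binom{d+n-q-1}{n+1}.$$ Moreover, for $q=n$ the bound is attained: $$\dim\omega^n(V)=\binom{d-1}{n+1}.$$
   Context: A $q$-form on $V$ is here a meromorphic (rational) form of type $(q,0)$ on $V$, i.e. (locally) the restriction to $V$ of a meromorphic $q$-form of the ambient space whose polar locus contains no component of $V$. Its trace ${\rm Tr}_V(\Phi)$ is the meromorphic $q$-form on the Grassmannian of projective lines of $\mathbb P^{n+1}(\mathbb C)$ given near a generic line $t$ by $\sum_{j=1}^d\xi_j^*\Phi$, where $\xi_1(t),\dots,\xi_d(t)$ are the points of intersection of $V$ with the line $L_t$ (locally holomorphic functions of $t$). The form $\Phi$ is called abelian if its trace on $V$ is zero: ${\rm Tr}_V(\Phi)=0$. Binomial coefficients $\binom{m}{k}$ with $0\le m<k$ are $0$. *)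

(* Defs.v *)
From HB Require Import structures.
From mathcomp Require Import all_boot all_order all_algebra.
From mathcomp Require Import all_classical all_reals all_analysis.
From mathcomp Require Import complex.
(* The notations of mpoly clash with those of mathcomp-analysis. *)
From mathcomp Require Import -(notations) mpoly.

Set Implicit Arguments.
Unset Strict Implicit.
Unset Printing Implicit Defensive.
Import Order.TTheory GRing.Theory Num.Theory numFieldNormedType.Exports.
Local Open Scope classical_set_scope.
Local Open Scope ring_scope.

(* Everything is written in homogeneous coordinates: a point of P^{n+1} is
   given by a nonzero row vector of length n+2, a line by a 2 x (n+2) matrix
   of rank 2 (the points of the line are those of its row space), and a form
   on P^{n+1} by its pullback to the affine cone. *)

Section Polynomials.
Variables (C : numClosedFieldType) (n : nat).

Definition hpoly := mpoly n.+2 C.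

Definition peval (p : hpoly) (x : 'rV[C]_(n.+2)) : C := meval (x ord0) p.

Definition homogeneous (k : nat) (p : hpoly) : Prop :=
  p \is @ishomog1 n.+2 C k mdeg.

(* [dpoly F x v] is the value at v of the differential of F at x. *)
Definition dpoly (F : hpoly) (x v : 'rV[C]_(n.+2)) : C :=
  \sum_(i < n.+2) peval (mderiv i F) x * v ord0 i.

End Polynomials.

Section Hypersurface.
Variables (C : numClosedFieldType) (n : nat).
Implicit Types (F g : hpoly C n) (Z : set 'rV[C]_(n.+2)).

Definition reduced_equation (d : nat) F : Prop :=
  [/\ F != 0, homogeneous d F &
      forall p h : hpoly C n, F = h * p ^+ 2 -> p \is a GRing.unit].

Definition hypersurface F : set 'rV[C]_(n.+2) :=
  [set x | x != 0 /\ peval F x = 0].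

Definition vanishes_on g Z : Prop := forall x, Z x -> peval g x = 0.

(* Irreducibility for the Zariski topology, tested on basic open sets. *)
Definition zariski_irreducible Z : Prop :=
  Z !=set0 /\ forall a b : hpoly C n,
    vanishes_on (a * b) Z -> vanishes_on a Z \/ vanishes_on b Z.

Definition component F Z : Prop :=
  [/\ Z `<=` hypersurface F, zariski_irreducible Z &
      forall Z', zariski_irreducible Z' ->
        Z `<=` Z' -> Z' `<=` hypersurface F -> Z' = Z].

Definition contains_no_component F g : Prop :=
  forall Z, component F Z -> ~ vanishes_on g Z.

Definition smooth_point F (x : 'rV[C]_(n.+2)) : Prop :=
  hypersurface F x /\ exists i, peval (mderiv i F) x != 0.

End Hypersurface.

(* The field of rational functions of n+2 variables, as a C-vector space. *)
Definition ratfun (C : numClosedFieldType) (n : nat) : Type :=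
  {fraction hpoly C n}.

HB.instance Definition _ (C : numClosedFieldType) (n : nat) :=
  GRing.Field.on (ratfun C n).

Section RatfunLmodule.
Variables (C : numClosedFieldType) (n : nat).

Definition ratfun_scale (c : C) (f : ratfun C n) : ratfun C n :=
  tofrac (mpolyC n.+2 c) * f.

Fact ratfun_scaleA a b f :
  ratfun_scale a (ratfun_scale b f) = ratfun_scale (a * b) f.
Proof. by rewrite /ratfun_scale mpolyCM tofracM mulrA. Qed.

Fact ratfun_scale1 : left_id 1 ratfun_scale.
Proof. by move=> f; rewrite /ratfun_scale mpolyC1 tofrac1 mul1r. Qed.

Fact ratfun_scaleDr : right_distributive ratfun_scale +%R.
Proof. by move=> a f g; rewrite /ratfun_scale mulrDr. Qed.

Fact ratfun_scaleDl f : {morph ratfun_scale^~ f : a b / a + b}.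
Proof. by move=> a b; rewrite /ratfun_scale mpolyCD tofracD mulrDl. Qed.

HB.instance Definition _ := GRing.Zmodule_isLmodule.Build C (ratfun C n)
  ratfun_scaleA ratfun_scale1 ratfun_scaleDr ratfun_scaleDl.

End RatfunLmodule.

Definition multi_index (n q : nat) :=
  {I : {ffun 'I_q -> 'I_n.+2} |
    [forall i : 'I_q, [forall j : 'I_q, (i < j)%N ==> (I i < I j)%N]]}.

(* Rational q-forms \sum_I Phi_I dX_{I 0} /\ ... /\ dX_{I (q-1)} on the affine
   space of dimension n+2; those coming from P^{n+1} are singled out below. *)
Definition qform (C : numClosedFieldType) (n q : nat) :=
  {ffun multi_index n q -> ratfun C n}.

Section Forms.
Variables (C : numClosedFieldType) (n q : nat).
Implicit Types (F g : hpoly C n) (Phi : qform C n q).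
Implicit Types (P : {ffun multi_index n q -> hpoly C n}).

(* The value at x, on the vectors given by the rows of v, of the form
   \sum_I P_I dX_I, and of that form divided by g. *)
Definition polyform_at P (x : 'rV[C]_(n.+2)) (v : 'M[C]_(q, n.+2)) : C :=
  \sum_I peval (P I) x * \det (colsub (val I) v).

Definition form_at P g (x : 'rV[C]_(n.+2)) (v : 'M[C]_(q, n.+2)) : C :=
  polyform_at P x v / peval g x.

(* Phi = (\sum_I P_I dX_I) / g is the pullback of a rational q-form on P^{n+1}
   with polar locus inside {g = 0}: Phi is homogeneous of degree 0 (dX_I has
   degree q) and its contraction with the Euler field vanishes. *)
Definition projective_form Phi P g : Prop :=
  [/\ g != 0,
      exists e, homogeneous (e + q) g /\ forall I, homogeneous e (P I),
      forall I, Phi I = tofrac (P I) / tofrac g &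
      forall x v k, row k v = x -> polyform_at P x v = 0].

Definition form_on F Phi P g : Prop :=
  projective_form Phi P g /\ contains_no_component F g.

(* The restriction of Phi to V = {F = 0} is zero: Phi vanishes on tangent
   vectors at the smooth points of V off the polar locus. *)
Definition null_form_on F : set (qform C n q) :=
  [set Phi | exists P g, form_on F Phi P g /\
    forall x v, smooth_point F x -> peval g x != 0 ->
      (forall k, dpoly F x (row k v) = 0) -> form_at P g x v = 0].

(* xi_1(t), ..., xi_d(t) are holomorphic in t near t0, pairwise distinct as
   points of P^{n+1}, and are all the points of intersection of V with the line
   spanned by the rows of t. *)
Definition intersection_points F (d : nat) (t0 : 'M[C]_(2, n.+2))
    (xi : 'I_d -> 'M[C]_(2, n.+2) -> 'rV[C]_(n.+2)) : Prop :=
  \forall t \near t0,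
    [/\ forall j, differentiable (xi j) t,
        forall j, xi j t != 0,
        forall j k, j != k -> ~~ (xi j t <= xi k t)%MS &
        forall x : 'rV[C]_(n.+2), x != 0 ->
          (peval F x = 0 /\ (x <= t)%MS) <-> exists j, (x <= xi j t)%MS].

(* The value at t0, on the tangent vectors tau_1, ..., tau_q, of the form
   \sum_j xi_j^* Phi. *)
Definition trace_at P g (d : nat)
    (xi : 'I_d -> 'M[C]_(2, n.+2) -> 'rV[C]_(n.+2))
    (t0 : 'M[C]_(2, n.+2)) (tau : 'I_q -> 'M[C]_(2, n.+2)) : C :=
  \sum_(j < d) form_at P g (xi j t0) (\matrix_(k < q) 'd (xi j) t0 (tau k)).

(* Forms on V = {F = 0}, F of degree d, whose trace vanishes at every generic
   line: one meeting V in d distinct points, off the polar locus.  By the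
   implicit function theorem every line meeting V in d distinct points has
   local sections xi, unique up to renumbering and rescaling, and the trace
   depends on neither; so quantifying over all xi is not vacuous.  The trace is
   computed on rank 2 matrices, i.e. after pullback by the submersion from these
   onto the Grassmannian, under which a form is zero iff its pullback is. *)
Definition abelian_form_on F (d : nat) : set (qform C n q) :=
  [set Phi | exists P g, form_on F Phi P g /\
    forall t0 xi, \rank t0 = 2%N -> intersection_points F t0 xi ->
      (forall j : 'I_d, peval g (xi j t0) != 0) ->
      forall tau, trace_at P g xi t0 tau = 0].

End Forms.

(* For subspaces N and U of W, the quotient U / (U `&` N) has finite dimension
   m: some m elements of U induce a basis of it. *)
Definition quotient_dim (C : numClosedFieldType) (W : lmodType C)
    (U N : set W) (m : nat) : Prop :=
  exists e : 'I_m -> W, (forall i, U (e i)) /\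
    forall w, U w ->
      exists! c : 'rV[C]_m, N (w - \sum_(i < m) c ord0 i *: e i).

(* omega^q(V) is the space of abelian forms modulo those restricting to 0 on V. *)
Definition omega_dim (C : numClosedFieldType) (n q d : nat) (F : hpoly C n)
    (m : nat) : Prop :=
  quotient_dim (@abelian_form_on C n q F d) (@null_form_on C n q F) m.

(* Main.v *)
Require Import Defs.
From HB Require Import structures.
From mathcomp Require Import all_boot all_order all_algebra.
From mathcomp Require Import all_classical all_reals all_analysis.
From mathcomp Require Import fingroup perm complex separable.
From mathcomp Require Import -(notations) mpoly.
From mathcomp Require Import ring lra zify.

Set Implicit Arguments.
Unset Strict Implicit.
Unset Printing Implicit Defensive.
Import Order.TTheory GRing.Theory Num.Theory numFieldNormedType.Exports.
Local Open Scope classical_set_scope.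
Local Open Scope ring_scope.

(** The trace of a form along a family of lines is a sum over the [d] points of
intersection of each line with the hypersurface V, and it involves the form only
through its values on vectors tangent to V. Both halves of the theorem read the
vanishing of the trace as moment conditions on these [d] values.

Upper bound. Let [p] be a point off V, with [F p = 1], and let a generic line through
[p] meet V at the distinct points [x0 + y j *: p]. In the chart [x0 + b *m B + Y *: p],
where [b] ranges over C^n, the equation is monic of degree [d] in [Y]
([chart_homogeneous]). The fields [dF(p) b_k - dF(b_k) p] ([tangent_fields]) are
tangent to V and polynomial. The numerator of a [q]-form, evaluated on [q] of them, is
a polynomial; its remainder modulo the equation has degree less than [d] in [Y], and
the form is zero on V as soon as these remainders, for all choices of the [q] fields,
are zero ([vanishing_fields_null]). Expand the remainders in powers of [b]. If all
their coefficients of order less than [h] are zero, consider the lines through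
[x0 + e *: b] and [p + (s * e) *: b]: the trace there, divided by [e ^+ h], tends to
  [\sum_j w_j (1 + s y_j) ^+ (q + h) r_J(b, y_j)]
as [e] tends to zero, where [r_J] is the part of order [h] of a remainder and the
weights [w_j] are not zero ([leading_terms]). If the trace is zero then, [s] being
arbitrary, for each monomial in [b] the weighted values at the [d] points have
vanishing moments of orders [0, ..., q + h]. Such values are all zero as soon as those
at [d - q - h - 1] of the points are ([vanishing_moments]), and then the coefficient,
of degree less than [d] in [Y], is zero. By induction on [h] ([remainders_vanish]) an
abelian form is zero on V when the coefficient of each monomial [mu] in each remainder
vanishes at the first [d - q - 1 - |mu|] points. There are
['C(n, q) * 'C(d + n - q - 1, n + 1)] such conditions ([card_increasing],
[conditions_count]), so that any longer family of abelian forms is dependent modulo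
the forms that are zero on V ([abelian_forms_dependent]).

Lower bound for [q = n]. For [R] homogeneous of degree [d - n - 2], consider the form
[R det(p, X, dX, ..., dX) / dF(p)]. Its restriction to V does not depend on [p]
([bracket_linear_form]); taking [p] on a given line, the trace at this line becomes a
sum [\sum_j h(y_j) / f'(y_j)] over the roots of the restriction [f] of [F], with [h]
of degree at most [d - 2] ([line_trace]). This is a sum of residues and vanishes
([sum_residues]). If the form is zero on V, so is [R], whose degree is less than [d];
hence [R = 0] ([low_degree_vanishing]). The dimension of the space of these [R] is the
bound for [q = n].

Two preliminaries carry this. That a polynomial [g] is zero on no component of V, a
topological condition, means that [F] and [g] have no common factor over the field of
fractions of the coefficients in a chart ([contains_no_component_coprime],
[coprime_contains_no_component]), by Gauss's lemma ([gauss_monic]); a Bezout relation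
then gives the generic lines ([generic_line_sections]). And every line meeting V in
[d] distinct points has holomorphic local sections ([sections_exist]), whose tangent
vectors are tangent to V and known up to the plane of the line ([section_tangent],
[section_dpoly]). *)

(** * Polynomials in several variables *)
Section MpolyGeneral.

Lemma mpoly_ring_ind (R : comNzRingType) m (P : mpoly m R -> Prop) :
  (forall c, P (mpolyC m c)) -> (forall i, P (mpolyX R (mnm1 i))) ->
  (forall a b, P a -> P b -> P (a + b)) -> (forall a b, P a -> P b -> P (a * b)) ->
  forall G, P G.
Proof.
move=> PC PX PD PM; have PXm : forall u, P (mpolyX R u).
  move=> u; rewrite mpolyXE_id; apply: (big_ind P) => //.
    by rewrite -mpolyC1.
  move=> i _; elim: (fun_of_multinom u i) => [|k IHk].
    by rewrite expr0 -mpolyC1.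
  by rewrite exprS; apply: PM.
elim/mpolyind => [|c u G _ _ PG]; first by rewrite -mpolyC0.
by apply: PD => //; rewrite -mul_mpolyC; apply: PM.
Qed.

Lemma mmap_rmorph (R : comNzRingType) (S T : comNzRingType) m
    (f : {rmorphism R -> S}) (h : 'I_m -> S) (g : {rmorphism S -> T}) G :
  g (mmap f h G) = mmap (g \o f) (g \o h) G.
Proof.
elim/mpoly_ring_ind: G => [c|i|a b IHa IHb|a b IHa IHb].
- by rewrite !mmapC.
- by rewrite !mmapX !mmap1U.
- by rewrite !rmorphD /= IHa IHb.
- by rewrite !rmorphM /= IHa IHb.
Qed.

Lemma eq_mmap (R S : comNzRingType) m (f f' : R -> S) (h h' : 'I_m -> S) G :
  f =1 f' -> h =1 h' -> mmap f h G = mmap f' h' G.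
Proof.
move=> ff' hh'; rewrite /mmap; apply: eq_bigr => u _; rewrite ff'.
by congr (_ * _); rewrite /mmap1; apply: eq_bigr => i _; rewrite hh'.
Qed.

Lemma lift_ord_max m (j : 'I_m) : lift ord_max j = widen_ord (leqnSn m) j.
Proof. by apply: val_inj; rewrite /= /bump leqNgt ltn_ord. Qed.

Lemma muni_eq0 (R : comNzRingType) m (G : mpoly m.+1 R) : muni G = 0 -> G = 0.
Proof.
move=> G0; apply/mpolyP => u; rewrite mcoeff0.
have := congr1 (fun p : {poly mpoly m R} =>
  mcoeff (Multinom [tuple u (widen_ord (leqnSn m) i) | i < m]) p`_(u ord_max)) G0.
rewrite coef0 mcoeff0 muniE coef_sum raddf_sum /=.
have [uG|/memN_msupp_eq0 //] := boolP (u \in msupp G).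
rewrite (bigD1_seq u) ?msupp_uniq //= coefZ coefXn eqxx mulr1 mcoeffZ mcoeffX.
rewrite eqxx mulr1 big1 ?addr0 // => v vu.
rewrite coefZ coefXn; have [E|_] := eqVneq (u ord_max) _; last by rewrite mulr0 mcoeff0.
rewrite mulr1 mcoeffZ mcoeffX; case: eqP => [/mnmP E'|]; last by rewrite mulr0.
case/eqP: vu; apply/mnmP => i.
case: (unliftP ord_max i) => [j ->|-> //].
have := E' j; rewrite !mnmE.
by rewrite lift_ord_max.
Qed.

Lemma meval_muni (R : comNzRingType) m (G : mpoly m.+1 R) (x : 'I_m.+1 -> R) :
  meval x G = (map_poly (meval (x \o widen_ord (leqnSn m))) (muni G)).[x ord_max].
Proof.
elim/mpoly_ring_ind: G => [c|i|a b IHa IHb|a b IHa IHb].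
- by rewrite mevalC muniC map_polyC /= hornerC mevalC.
- rewrite mevalXU muniE msuppX big_seq1 mcoeffX eqxx scale1r.
  case: (unliftP ord_max i) => [j ->|->].
    rewrite lift_ord_max mnm1E.
    have -> : (widen_ord (leqnSn m) j == ord_max) = false.
      by apply/negbTE; rewrite -val_eqE /= neq_ltn ltn_ord.
    rewrite expr0 -mul_polyC mulr1 map_polyC hornerC /=.
    rewrite mevalX (bigD1 j) //= mnmE mnm1E eqxx big1 ?mulr1 //.
    move=> k kj; rewrite mnmE mnm1E.
    by rewrite (negbTE (_ : widen_ord _ j != widen_ord _ k)) // -val_eqE /= eq_sym.
  rewrite mnm1E eqxx -mul_polyC rmorphM /= map_polyC /= map_polyX hornerCM hornerX.
  rewrite mevalX big1 ?mul1r // => k _; rewrite mnmE mnm1E.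
  by rewrite (negbTE (_ : ord_max != widen_ord _ k)) // -val_eqE /= neq_ltn ltn_ord orbT.
- by rewrite !rmorphD /= hornerD IHa IHb.
- by rewrite !rmorphM /= hornerM IHa IHb.
Qed.

Lemma poly_eval0 (C : numDomainType) (p : {poly C}) : (forall y, p.[y] = 0) -> p = 0.
Proof.
move=> p0; apply/eqP; apply: contraT => pn0.
have := @max_poly_roots _ p [seq i%:R | i <- iota 0 (size p)] pn0.
rewrite size_map size_iota ltnn => -> //.
- by apply/allP => y _; apply/rootP.
- by rewrite map_inj_uniq ?iota_uniq //; apply: mulrIn; rewrite oner_eq0.
Qed.

Lemma poly_too_many_roots (K : idomainType) d (p : {poly K}) (y : 'I_d -> K) : injective y ->
  (forall j, p.[y j] = 0) -> (size p <= d)%N -> p = 0.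
Proof.
move=> yinj py sp; apply/eqP; apply: contraT => p0.
have rt : all (root p) [tuple y j | j < d].
  by apply/allP => z /mapP[j _ ->]; apply/rootP.
by have := max_poly_roots p0 rt; rewrite map_inj_uniq ?enum_uniq // size_tuple ltnNge sp => /(_ isT).
Qed.

Lemma mpoly_eval0 (C : numDomainType) m (G : mpoly m C) :
  (forall x, meval x G = 0) -> G = 0.
Proof.
elim: m G => [|m IHm] G G0.
  by have := G0 (fun=> 0); rewrite [G]nvar0_mpolyC mevalC => ->; rewrite mpolyC0.
apply: muni_eq0; apply/polyP => k; rewrite coef0; apply: IHm => x.
rewrite -[LHS](coef_map (meval x)).
suff -> : map_poly (meval x) (muni G) = 0 by rewrite coef0.
apply: poly_eval0 => y.
pose z (i : 'I_m.+1) := if unlift ord_max i is Some j then x j else y.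
rewrite -[RHS](G0 z) meval_muni /z unlift_none; congr (_.[_]).
apply: eq_map_poly => q; apply: meval_eq => j /=.
by rewrite -lift_ord_max liftK.
Qed.

Lemma mpoly_nonzero_point (C : numDomainType) m (G : mpoly m C) :
  G != 0 -> exists x, meval x G != 0.
Proof.
move=> G0; apply: contrapT => H; case/eqP: G0; apply: mpoly_eval0 => x.
by apply/eqP; apply: contrapT => /negP xG; apply: H; exists x.
Qed.

End MpolyGeneral.

(** * Restriction of polynomials to lines *)
Section Substitution.
Variables (C S : comNzRingType) (iota : {rmorphism C -> S}) (m : nat).
Implicit Types (a p : 'I_m -> S) (G : mpoly m C).

(** The polynomial [G] at the point [a + p * 'X] of a line; the coefficients live
in [S], so that the line may itself depend on parameters. *)
Definition line_subst a p : mpoly m C -> {poly S} :=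
  mmap (polyC \o iota) (fun i => (a i)%:P + (p i)%:P * 'X).

HB.instance Definition _ a p := GRing.RMorphism.copy (line_subst a p)
  (mmap (polyC \o iota) (fun i => (a i)%:P + (p i)%:P * 'X)).

Lemma line_substC a p c : line_subst a p (mpolyC m c) = (iota c)%:P.
Proof. by rewrite /line_subst mmapC. Qed.

Lemma line_substX a p i : line_subst a p (mpolyX C (mnm1 i)) = (a i)%:P + (p i)%:P * 'X.
Proof. by rewrite /line_subst mmapX mmap1U. Qed.

Lemma horner_line_subst a p G y :
  (line_subst a p G).[y] = mmap iota (fun i => a i + p i * y) G.
Proof.
elim/mpoly_ring_ind: G => [c|i|A B IHa IHb|A B IHa IHb].
- by rewrite line_substC hornerC mmapC.
- by rewrite line_substX mmapX mmap1U !hornerE.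
- by rewrite !rmorphD /= hornerD IHa IHb.
- by rewrite !rmorphM /= hornerM IHa IHb.
Qed.

Lemma prod_size_coef (I : Type) (r : seq I) (F : I -> {poly S}) (k : I -> nat) :
  (forall i, size (F i) <= (k i).+1)%N ->
  (size (\prod_(i <- r) F i)%R <= (\sum_(i <- r) k i).+1)%N /\
  (\prod_(i <- r) F i)`_(\sum_(i <- r) k i) = \prod_(i <- r) (F i)`_(k i).
Proof.
move=> Fk; elim: r => [|i r [IH1 IH2]]; first by rewrite !big_nil size_poly1 coef1.
rewrite !big_cons; split.
  apply: leq_trans (size_polyMleq _ _) _.
  by have := leq_add (Fk i) IH1; lia.
rewrite coefM -IH2.
have hk : (k i < (k i + \sum_(j <- r) k j).+1)%N by lia.
rewrite (bigD1 (Ordinal hk)) //= addKn [X in _ + X]big1 ?addr0 // => j jk.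
have [jl|jl|E] := ltngtP j (k i).
- rewrite [X in _ * X]nth_default ?mulr0 //; apply: leq_trans IH1 _; lia.
- rewrite [X in X * _]nth_default ?mul0r //; apply: leq_trans (Fk i) _; lia.
- by case/eqP: jk; apply: val_inj.
Qed.

Let monomial_size_coef a p u :
  (size (line_subst a p (mpolyX C u)) <= (mdeg u).+1)%N /\
  (line_subst a p (mpolyX C u))`_(mdeg u) = mmap1 p u.
Proof.
rewrite /line_subst mmapX /mmap1 mdegE.
set F := fun i => ((a i)%:P + (p i)%:P * 'X) ^+ u i.
suff Fu i : (size (F i) <= (u i).+1)%N /\ (F i)`_(u i) = p i ^+ u i.
  have [-> ->] := prod_size_coef (index_enum 'I_m) (fun i => proj1 (Fu i)).
  by split=> //; apply: eq_bigr => i _; case: (Fu i).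
rewrite /F; set f := _ + _.
have sf : (size f <= 2)%N.
  apply: leq_trans (size_polyD _ _) _; rewrite geq_max; apply/andP; split.
    by apply: leq_trans (size_polyC_leq1 _) _.
  apply: leq_trans (size_polyMleq _ _) _; rewrite size_polyX.
  by have := size_polyC_leq1 (p i); lia.
have cf : f`_1 = p i by rewrite coefD coefC coefCM coefX add0r mulr1.
have := prod_size_coef (nseq (u i) tt) (F := fun=> f) (k := fun=> 1%N) (fun=> sf).
by rewrite !big_const_seq !count_predT !size_nseq cf !iter_mulr_1 iter_addn_0 mul1n.
Qed.

(** A monomial of degree [j] contributes to ['X^j] the product of its directions, and
only smaller powers otherwise. *)
Lemma line_subst_top a p G k : (msize G <= k.+1)%N ->
  (size (line_subst a p G) <= k.+1)%N /\
  (line_subst a p G)`_k = mmap iota p (pihomog mdeg k G).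
Proof.
move=> Gk.
have {}Gk : all (fun u => mdeg u <= k)%N (msupp G).
  by apply/allP => u uG; rewrite -ltnS; apply: leq_trans (msize_mdeg_lt uG) Gk.
have E : line_subst a p G =
  \sum_(u <- msupp G) (iota (mcoeff u G))%:P * line_subst a p (mpolyX C u).
  rewrite {1}[G]mpolyE rmorph_sum /=; apply: eq_bigr => u _.
  by rewrite -mul_mpolyC rmorphM /= line_substC.
rewrite pihomogE rmorph_sum /= E; split.
  rewrite big_seq; apply: (big_ind (fun q : {poly S} => size q <= k.+1)%N).
  - by rewrite size_poly0.
  - move=> q r qk rk; apply: leq_trans (size_polyD _ _) _.
    by rewrite geq_max qk.
  - move=> u uG; apply: leq_trans (size_polyMleq _ _) _.
    have := size_polyC_leq1 (iota (mcoeff u G)).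
    have [] := monomial_size_coef a p u; have /allP/(_ u uG) := Gk; lia.
rewrite coef_sum [RHS]big_mkcond /= !big_seq; apply: eq_bigr => u uG.
rewrite coefCM; have /allP/(_ u uG) := Gk; rewrite leq_eqVlt.
case/orP=> [/eqP uk|uk]; last first.
  rewrite ltn_eqF // nth_default ?mulr0 //.
  by apply: leq_trans (proj1 (monomial_size_coef a p u)) uk.
rewrite uk eqxx -{1}uk (proj2 (monomial_size_coef a p u)).
by rewrite -mul_mpolyC rmorphM /= mmapC mmapX.
Qed.

Lemma deriv_line_subst a p G :
  (line_subst a p G)^`() =
  \sum_(i < m) (p i)%:P * line_subst a p (mderiv i G).
Proof.
elim/mpoly_ring_ind: G => [c|i|A B IHa IHb|A B IHa IHb].
- rewrite line_substC derivC big1 // => i _.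
  by rewrite mderivC rmorph0 mulr0.
- rewrite line_substX derivD derivC add0r mul_polyC derivZ derivX alg_polyC.
  rewrite (bigD1 i) //= big1 ?addr0 => [|j ji].
    rewrite mderivX mnm1E eqxx scale1r.
    have -> : mnm_sub (mnm1 i) (mnm1 i) = mnm0 by apply/mnmP => j; rewrite !mnmE subnn.
    by rewrite mpolyX0 rmorph1 mulr1.
  by rewrite mderivX mnm1E eq_sym (negbTE ji) scale0r rmorph0 mulr0.
- rewrite rmorphD /= derivD IHa IHb -big_split /=; apply: eq_bigr => i _.
  by rewrite mderivD rmorphD mulrDr.
- rewrite rmorphM /= derivM IHa IHb mulr_suml mulr_sumr -big_split /=.
  apply: eq_bigr => i _; rewrite mderivM rmorphD !rmorphM /=; ring.
Qed.

End Substitution.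

(** * Fractions and Gauss's lemma *)
Section Fractions.
Variable A : idomainType.
Local Notation K := {fraction A}.
Local Notation toK := (@FracField.tofrac A).

Lemma fraction_numden (x : K) : exists u v, v != 0 /\ toK v * x = toK u.
Proof.
elim/generic_quotient.quotW: x => r; have r0 := denom_ratioP r.
exists (frac r).1, (frac r).2; split=> //; rewrite !generic_quotient.piE.
apply/generic_quotient.eqmodP; rewrite /= FracField.equivfE /FracField.mulf.
by rewrite !numden_Ratio ?mul1r ?oner_eq0 ?mulf_neq0 ?oner_eq0 // mulr1 mulrC.
Qed.

Lemma fraction_poly_clear (p : {poly K}) :
  exists q v, v != 0 /\ (toK v) *: p = map_poly toK q.
Proof.
elim/poly_ind: p => [|p c [q [v [v0 E]]]].
  by exists 0, 1; rewrite oner_eq0 scaler0 rmorph0.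
have [u [w [w0 E']]] := fraction_numden c.
exists (w *: q * 'X + (v * u)%:P), (v * w); split; first by rewrite mulf_neq0.
rewrite rmorphD /= [map_poly _ (_ * 'X)]rmorphM /= map_polyX map_polyZ /= map_polyC /= -E !tofracM -E'.
by rewrite -!mul_polyC !polyCM; ring.
Qed.

Lemma map_tofrac_inj : injective (map_poly toK).
Proof. by apply: map_inj_poly; [move=> a b /eqP; rewrite tofrac_eq => /eqP|exact: tofrac0]. Qed.

Lemma map_tofrac_eq0 p : (map_poly toK p == 0) = (p == 0).
Proof. by rewrite -(inj_eq map_tofrac_inj) rmorph0. Qed.

Lemma size_map_tofrac p : size (map_poly toK p) = size p.
Proof. by rewrite size_map_inj_poly ?tofrac0 //; move=> a b /eqP; rewrite tofrac_eq => /eqP. Qed.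

Lemma lead_coef_map_tofrac p : lead_coef (map_poly toK p) = toK (lead_coef p).
Proof. by rewrite lead_coef_map_inj ?tofrac0 //; move=> a b /eqP; rewrite tofrac_eq => /eqP. Qed.

Lemma monic_clear (a : {poly K}) : a \is monic ->
  exists2 q, lead_coef q != 0 & toK (lead_coef q) *: a = map_poly toK q.
Proof.
move=> am; have [q [v [v0 E]]] := fraction_poly_clear a; exists q.
  by rewrite lead_coef_eq0 -map_tofrac_eq0 -E scaler_eq0 tofrac_eq0 negb_or v0 monic_neq0.
suff -> : lead_coef q = v by [].
apply/eqP; rewrite -tofrac_eq -lead_coef_map_tofrac -E lead_coefZ.
by rewrite (monicP am) mulr1.
Qed.

Lemma clear_product (f a' b' : {poly A}) (a b : {poly K}) : map_poly toK f = a * b ->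
  toK (lead_coef a') *: a = map_poly toK a' -> toK (lead_coef b') *: b = map_poly toK b' ->
  a' * b' = (lead_coef a' * lead_coef b')%:P * f.
Proof.
move=> E Ea Eb; apply: map_tofrac_inj; rewrite !rmorphM /= -Ea -Eb E !map_polyC /=.
by rewrite -!mul_polyC; ring.
Qed.

Lemma clear_leading (a' c : {poly A}) (a : {poly K}) : lead_coef a' != 0 ->
  toK (lead_coef a') *: a = map_poly toK a' -> a' = lead_coef a' *: c ->
  map_poly toK c = a.
Proof.
move=> v0 Ea Ec; have : toK (lead_coef a') *: a = toK (lead_coef a') *: map_poly toK c.
  by rewrite Ea {1}Ec map_polyZ.
by move/(scalerI _); rewrite tofrac_eq0 => /(_ v0).
Qed.

Lemma map_tofrac_monic c : (map_poly toK c \is monic) = (c \is monic).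
Proof. by rewrite !monicE lead_coef_map_tofrac -tofrac1 tofrac_eq. Qed.

(** Euclidean division by [f] is possible over [A] itself, and its remainder is the
one over the field of fractions. *)
Lemma unit_lead_divides (f g : {poly A}) : lead_coef f \is a GRing.unit ->
  (map_poly toK f %| map_poly toK g)%R -> exists h, g = h * f.
Proof.
move=> uf fg; have E := Pdiv.IdomainUnit.divp_eq uf g.
exists (g %/ f); suff r0 : g %% f = 0 by rewrite {1}E r0 addr0.
have f0 : f != 0 by apply: contraTneq uf => ->; rewrite lead_coef0 unitr0.
apply: map_tofrac_inj; rewrite rmorph0; apply/eqP.
have : (map_poly toK f %| map_poly toK (g %% f)).
  have -> : g %% f = g - g %/ f * f by rewrite {2}E addrAC subrr add0r.
  by rewrite rmorphB rmorphM /= dvdp_sub // dvdp_mulIr.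
apply: contraTT => r0; apply/negP => /(dvdp_leq r0).
by rewrite !size_map_tofrac leqNgt ltn_modp f0.
Qed.

(** A Bezout relation with its denominators cleared. *)
Lemma coprime_clear (f g : {poly A}) : coprimep (map_poly toK f) (map_poly toK g) ->
  exists u v c, c != 0 /\ u * f + v * g = c%:P.
Proof.
case/Bezout_eq1_coprimepP => -[p q] /= E.
have [p' [a [a0 Ea]]] := fraction_poly_clear p.
have [q' [b [b0 Eb]]] := fraction_poly_clear q.
exists (b *: p'), (a *: q'), (a * b); split; first by rewrite mulf_neq0.
apply: map_tofrac_inj; rewrite rmorphD !rmorphM /= !map_polyZ -Ea -Eb !map_polyC /=.
by rewrite -[RHS]mulr1 -E -!mul_polyC; ring.
Qed.

Lemma coprime_common_divisor (f g p : {poly A}) :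
  coprimep (map_poly toK f) (map_poly toK g) ->
  (exists h, f = h * p) -> (exists h, g = h * p) -> size p = 1%N.
Proof.
move=> fg [h Ef] [h' Eg].
have pf : map_poly toK p %| map_poly toK f by rewrite Ef rmorphM /= dvdp_mulIr.
have pg : map_poly toK p %| map_poly toK g by rewrite Eg rmorphM /= dvdp_mulIr.
have := coprimep_dvdl pg (coprimep_dvdr pf fg).
by rewrite coprimepp size_map_tofrac => /eqP.
Qed.

Lemma size_dvd_leq (p q h : {poly A}) : q != 0 -> q = h * p -> (size p <= size q)%N.
Proof.
move=> q0 E; have : map_poly toK p %| map_poly toK q by rewrite E rmorphM /= dvdp_mulIr.
by move/dvdp_leq; rewrite map_tofrac_eq0 !size_map_tofrac => /(_ q0).
Qed.

End Fractions.

Section GaussOneVariable.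
Variable C : closedFieldType.
Implicit Types (a b f : {poly {poly C}}).

Lemma map_horner_eq0 a (z : C) : map_poly (horner_eval z) a = 0 ->
  exists a', a = ('X - z%:P)%:P * a'.
Proof.
move=> a0; exists (map_poly (fun c => c %/ ('X - z%:P)) a).
apply/polyP => i; rewrite coefCM coef_map_id0 ?div0p //.
rewrite mulrC divpK // dvdp_XsubCl; apply/rootP.
by have := congr1 (fun p : {poly C} => p`_i) a0; rewrite coef_map coef0.
Qed.

(** At a root of the leading coefficient of [a] the product vanishes, so that [a] or
[b] does; dividing the root out lowers the degrees of the leading coefficients. *)
Lemma gauss_one_variable a b f : a != 0 -> b != 0 ->
  a * b = (lead_coef a * lead_coef b)%:P * f -> exists a', a = (lead_coef a)%:P * a'.
Proof.
have [k] := ubnP (size (lead_coef a) + size (lead_coef b))%N.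
elim: k a b => // k IHk a b Hk a0 b0 E.
have [sa|sa] := leqP (size (lead_coef a)) 1.
  have := size1_polyC sa; set c := _`_0 => Ec.
  have c0 : c != 0 by rewrite -polyC_eq0 -Ec lead_coef_eq0.
  exists ((c^-1)%:P%:P * a).
  by rewrite Ec mulrA -!polyCM mulfV // mul1r.
have [z z_root] : exists z, root (lead_coef a) z.
  by apply: closed_rootP; rewrite neq_ltn sa orbT.
have : map_poly (horner_eval z) a * map_poly (horner_eval z) b = 0.
  rewrite -rmorphM /= E rmorphM /= map_polyC /= rmorphM /= {1}/horner_eval.
  by rewrite (rootP z_root) mul0r polyC0 mul0r.
have lcX (c : {poly {poly C}}) : lead_coef (('X - z%:P)%:P * c) = ('X - z%:P) * lead_coef c.
  by rewrite lead_coefM lead_coefC.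
have Xz0 : 'X - z%:P != 0 by rewrite polyXsubC_eq0.
have PXz0 : ('X - z%:P)%:P != 0 :> {poly {poly C}} by rewrite polyC_eq0.
have szX (c : {poly C}) : c != 0 -> size (('X - z%:P) * c) = (size c).+1.
  by move=> c0; rewrite size_monicM ?monicXsubC // size_XsubC.
move/eqP; rewrite mulf_eq0 => /orP[] /eqP /map_horner_eq0[a' Ea'].
  have a'0 : a' != 0 by apply: contraNneq a0 => a'0; rewrite Ea' a'0 mulr0.
  have [||a'' E''] := IHk a' b _ a'0 b0.
  - by move: Hk; rewrite Ea' lcX szX ?lead_coef_eq0 // addSn ltnS.
  - apply: (mulfI PXz0); rewrite mulrA -Ea' E Ea' lcX !polyCM; ring.
  exists a''; rewrite Ea' lcX polyCM -mulrA; congr (_ * _); exact: E''.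
have b'0 : a' != 0 by apply: contraNneq b0 => a'0; rewrite Ea' a'0 mulr0.
apply: (IHk a a' _ a0 b'0).
- by move: Hk; rewrite Ea' lcX szX ?lead_coef_eq0 // addnS ltnS.
- apply: (mulfI PXz0); rewrite mulrCA -Ea' E Ea' lcX !polyCM; ring.
Qed.

End GaussOneVariable.

Section LineSubstMap.
Variables (C S T : comNzRingType) (iota : {rmorphism C -> S}) (g : {rmorphism S -> T}).

Lemma map_line_subst (kappa : {rmorphism C -> T}) m (a p : 'I_m -> S) (a' p' : 'I_m -> T) G :
  g \o iota =1 kappa -> g \o a =1 a' -> g \o p =1 p' ->
  map_poly g (line_subst iota a p G) = line_subst kappa a' p' G.
Proof.
move=> Ek Ea Ep; rewrite /line_subst mmap_rmorph; apply: eq_mmap => [c|i] /=.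
  by rewrite map_polyC /= -Ek.
by rewrite rmorphD rmorphM /= !map_polyC map_polyX /= -Ea -Ep.
Qed.

End LineSubstMap.

Section FiberwiseDivision.
Variables (C : numClosedFieldType) (m : nat).
Local Notation A := (mpoly m C).
Implicit Types (u v w G : A) (x p : 'I_m -> C).

Definition top_form G : A := pihomog mdeg (msize G).-1 G.

Definition on_line x p G : {poly C} := line_subst idfun x p G.

HB.instance Definition _ x p := GRing.RMorphism.copy (on_line x p)
  (@line_subst C C idfun m x p).

Lemma msizeSpred G : G != 0 -> (msize G).-1.+1 = msize G.
Proof. by move=> G0; rewrite prednK // lt0n msize_poly_eq0. Qed.

Lemma top_form_neq0 G : G != 0 -> top_form G != 0.
Proof.
move=> G0; apply/eqP => /mpolyP/(_ (mlead G)); rewrite mcoeff0 /top_form.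
rewrite (pihomogwE _ _ (leqnn _)) raddf_sum /=.
have lG : (mdeg (mlead G) < msize G)%N by rewrite -mlead_deg.
rewrite (bigD1 (BMultinom lG)) /=; last by rewrite -mlead_deg.
rewrite mcoeffZ mcoeffX eqxx mulr1 big1 ?addr0 => [/eqP|u /andP[_ uG]].
  by rewrite mleadc_eq0 (negbTE G0).
rewrite mcoeffZ mcoeffX [_ == _ :> multinom _](_ : _ = false) ?mulr0 //.
by apply/negbTE; move: uG; rewrite -val_eqE.
Qed.

Lemma mmap_idfun x G : mmap idfun x G = meval x G.
Proof. by []. Qed.

Lemma horner_on_line x p G y : (on_line x p G).[y] = meval (fun i => x i + p i * y) G.
Proof. by rewrite /on_line horner_line_subst. Qed.

Lemma on_line_top G x p : G != 0 -> meval p (top_form G) != 0 ->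
  size (on_line x p G) = msize G /\ lead_coef (on_line x p G) = meval p (top_form G).
Proof.
move=> G0 pG.
have [] := line_subst_top idfun x p (G := G) (k := (msize G).-1).
  by rewrite msizeSpred.
rewrite mmap_idfun -/(top_form G) -/(on_line x p G) msizeSpred // => s1 s2.
have s3 : size (on_line x p G) = msize G.
  apply/eqP; rewrite eqn_leq s1 /= -(msizeSpred G0) ltnNge; apply: contra pG => s3.
  by rewrite -s2 nth_default.
by split=> //; rewrite lead_coefE s3 s2.
Qed.

(** The line of direction [p] through the generic point of the affine space. *)
Definition generic_line G p : {poly A} :=
  line_subst (@mpolyC m C) (fun i => mpolyX C (mnm1 i)) (fun i => mpolyC m (p i)) G.

Lemma map_generic_line G p x : map_poly (meval x) (generic_line G p) = on_line x p G.
Proof.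
apply: map_line_subst => i /=; first exact: mevalC.
  exact: mevalXU.
exact: mevalC.
Qed.

Lemma generic_line_at0 G p : (generic_line G p).[0] = G.
Proof.
apply/eqP; rewrite -subr_eq0; apply/eqP/mpoly_eval0 => x.
rewrite mevalB -[X in X - _](horner_map (meval x)) map_generic_line /= meval0.
by rewrite horner_on_line (meval_eq (v2 := x)) ?subrr // => i; rewrite mulr0 addr0.
Qed.

Lemma map_meval_eq0 (R : {poly A}) : (forall x, map_poly (meval x) R = 0) -> R = 0.
Proof.
move=> R0; apply/polyP => i; rewrite coef0; apply: mpoly_eval0 => x.
by rewrite -[LHS](coef_map (meval x)) R0 coef0.
Qed.

(** Division by [v] leaves a remainder of degree less than that of [v] on every
line of direction [p]; divisibility on each of these lines makes it vanish. *)
Lemma dvd_fiberwise u v p : v != 0 -> meval p (top_form v) != 0 ->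
  (forall x, exists s, on_line x p u = s * on_line x p v) -> exists w, u = w * v.
Proof.
move=> v0 pv Huv.
set V := generic_line v p; set U := generic_line u p.
have [sV lV] : size V = msize v /\ lead_coef V = mpolyC m (meval p (top_form v)).
  have [] := @line_subst_top C A (@mpolyC m C) m (fun i => mpolyX C (mnm1 i)) (fun i => mpolyC m (p i)) v (msize v).-1.
    by rewrite msizeSpred.
  rewrite -/(generic_line v p) -/V msizeSpred // => s1.
  have -> : mmap (@mpolyC m C) (fun i => mpolyC m (p i)) (pihomog mdeg (msize v).-1 v) =
            mpolyC m (meval p (top_form v)).
    by rewrite -mmap_idfun (mmap_rmorph idfun p (@mpolyC m C)).
  move=> s2; have s3 : size V = msize v.
    apply/eqP; rewrite eqn_leq s1 /= -(msizeSpred v0) ltnNge.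
    apply: contra pv => s3; move: s2; rewrite nth_default // => /esym /eqP.
    by rewrite mpolyC_eq0.
  by split=> //; rewrite lead_coefE s3 s2.
have uV : lead_coef V \is a GRing.unit.
  by rewrite lV rmorph_unit // unitfE.
have E := Pdiv.IdomainUnit.divp_eq uV U.
have HU x : map_poly (meval x) U = on_line x p u := map_generic_line u p x.
have HV x : map_poly (meval x) V = on_line x p v := map_generic_line v p x.
have HU0 : U.[0] = u := generic_line_at0 u p.
have HV0 : V.[0] = v := generic_line_at0 v p.
clearbody U V.
have V0 : V != 0 by rewrite -size_poly_eq0 sV msize_poly_eq0.
have R0 : U %% V = 0.
  apply: map_meval_eq0 => x.
  have [s Es] := Huv x.
  have := congr1 (map_poly (meval x)) E.
  rewrite rmorphD /= [map_poly _ (_ * V)]rmorphM /= HU HV Es => Ex.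
  have {Ex} Ex : map_poly (meval x) (U %% V) = (s - map_poly (meval x) (U %/ V)) * on_line x p v.
    by rewrite mulrBl Ex addrC addKr.
  apply/eqP; apply: contraT => R0.
  have : (on_line x p v %| map_poly (meval x) (U %% V)) by rewrite Ex dvdp_mulIr.
  move=> /(dvdp_leq R0); rewrite (proj1 (on_line_top x v0 pv)) leqNgt.
  by rewrite (leq_ltn_trans (size_poly _ _)) // -sV ltn_modp.
by exists ((U %/ V).[0]); rewrite -[LHS]HU0 {1}E R0 addr0 hornerM HV0.
Qed.

Local Notation toK := (@FracField.tofrac A).

(** Gauss's lemma: after clearing denominators, divisibility by the leading
coefficient holds on every line of a generic direction, where the coefficients
are polynomials in one variable. *)
Lemma gauss_monic (f : {poly A}) (a b : {poly {fraction A}}) :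
  f \is monic -> a \is monic -> map_poly toK f = a * b ->
  exists2 c : {poly A}, c \is monic & map_poly toK c = a.
Proof.
move=> fm am E.
have bm : b \is monic by rewrite -(monicMl _ am) -E map_tofrac_monic.
have [a' v0 Ea] := monic_clear am.
have [b' w0 Eb] := monic_clear bm.
have Eab := clear_product E Ea Eb.
set v := lead_coef a' in v0 Ea Eab; set w := lead_coef b' in w0 Eb Eab.
have [la lb] : lead_coef a' = v /\ lead_coef b' = w by [].
have [p] : exists p, meval p (top_form v * top_form w) != 0.
  by apply: mpoly_nonzero_point; rewrite mulf_neq0 ?top_form_neq0.
rewrite mevalM mulf_eq0 negb_or => /andP[pv pw].
have Hi i : exists s, a'`_i = s * v.
  apply: (dvd_fiberwise v0 pv) => x.
  (* On the line through [x], where Gauss's lemma holds over [C['X]]. *)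
  pose L := [the {rmorphism A -> {poly C}} of (@line_subst C C idfun m x p)].
  have lcL (q : {poly A}) (c : A) : lead_coef q = c -> c != 0 -> meval p (top_form c) != 0 ->
      map_poly L q != 0 /\ lead_coef (map_poly L q) = L c.
    move=> qc c0 pc; have Lc0 : L c != 0.
      by rewrite -size_poly_eq0 (proj1 (on_line_top x c0 pc)) msize_poly_eq0.
    rewrite lead_coef_map_eq qc //; split=> //.
    by rewrite -lead_coef_eq0 lead_coef_map_eq qc.
  have [a0 la'] := lcL _ _ la v0 pv.
  have [b0 lb'] := lcL _ _ lb w0 pw.
  have [|s Es] := @gauss_one_variable C _ _ (map_poly L f) a0 b0.
    by rewrite -rmorphM /= Eab rmorphM /= map_polyC /= rmorphM la' lb'.
  exists s`_i; rewrite -[LHS](coef_map L) Es la' coefCM mulrC //.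
have [s Hs] := choice Hi.
pose c := \poly_(i < size a') s i.
have Ec : a' = v *: c.
  apply/polyP => i; rewrite coefZ coef_poly; case: ltnP => ia; first by rewrite mulrC.
  by rewrite nth_default ?mulr0.
have Ec' : map_poly toK c = a by apply: clear_leading v0 Ea Ec.
by exists c => //; rewrite -map_tofrac_monic Ec'.
Qed.

End FiberwiseDivision.

(** * Irreducible factors of monic polynomials *)
Section IrreducibleFactors.
Variables (C : numClosedFieldType) (m : nat).
Local Notation A := (mpoly m C).
Local Notation toK := (@FracField.tofrac A).
Implicit Types (a b f g h pi : {poly A}).

(** Monic, so that by Gauss's lemma divisibility over the fractions is divisibility
over [A]. *)
Definition irreducible_over_fractions pi :=
  pi \is monic /\ irreducible_poly (map_poly toK pi).

Lemma monic_lead_unit f : f \is monic -> lead_coef f \is a GRing.unit.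
Proof. by move/monicP->; rewrite unitr1. Qed.

Lemma monic_factor f (q : {poly {fraction A}}) : f \is monic -> q %| map_poly toK f ->
  exists c h, [/\ c \is monic, f = h * c & map_poly toK c %= q].
Proof.
move=> fm qf; have f0 : map_poly toK f != 0 by rewrite map_tofrac_eq0 monic_neq0.
have q0 : q != 0 by apply: contraNneq f0 => q0; move: qf; rewrite q0 dvd0p.
set a := (lead_coef q)^-1 *: q.
have lq0 : lead_coef q != 0 by rewrite lead_coef_eq0.
have am : a \is monic by rewrite monicE lead_coefZ mulVf.
have aq : a %= q by apply: eqp_scale; rewrite invr_eq0.
have /dvdpP[b Eb] : a %| map_poly toK f by rewrite (eqp_dvdl _ aq).
have [c cm Ec] := gauss_monic fm am (etrans Eb (mulrC _ _)).
have [|h Eh] := unit_lead_divides (f := c) (g := f) (monic_lead_unit cm).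
  by rewrite Ec Eb dvdp_mulIr.
by exists c, h; rewrite Ec.
Qed.

(** A property that passes from a product to one of the factors, such as vanishing on
an irreducible set, is inherited by an irreducible factor. *)
Lemma irreducible_factor (I : {poly A} -> Prop) :
  (forall a b, I (a * b) -> I a \/ I b) -> ~ I 1 -> forall f, f \is monic -> I f ->
  exists pi h, [/\ irreducible_over_fractions pi, f = h * pi & I pi].
Proof.
move=> IM I1 f; have [k] := ubnP (size f); elim: k f => // k IHk f fk fm If.
have [irr|/not_andP nirr] := pselect (irreducible_poly (map_poly toK f)).
  by exists f, 1; rewrite mul1r.
have f1 : (1 < size f)%N.
  rewrite ltnNge; apply/negP => f1; apply: I1.
  have /size1_polyC Ef := f1.
  suff <- : f = 1 by [].
  by move/monicP: fm; rewrite Ef lead_coefC => ->.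
case: nirr => [|/existsNP[q /not_implyP[q1 /not_implyP[qf nq]]]].
  by rewrite size_map_tofrac f1.
have [c [h [cm Ef cq]]] := monic_factor fm qf.
have hm : h \is monic by rewrite -(monicMr _ cm) -Ef.
have sq : size q = size c by rewrite -(eqp_size cq) size_map_tofrac.
have c1 : (1 < size c)%N.
  move: q1; rewrite sq; have := monic_neq0 cm; rewrite -size_poly_gt0.
  by case: (size c) => [|[]].
have h1 : (1 < size h)%N.
  rewrite ltnNge; apply/negP => h1; apply: nq; rewrite -dvdp_size_eqp //.
  rewrite sq size_map_tofrac Ef size_monicM ?monic_neq0 //.
  have := monic_neq0 hm; rewrite -size_poly_gt0.
  by case: (size h) h1 => [|[]].
have sf : size f = (size h + size c).-1 by rewrite Ef size_monicM ?monic_neq0.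
have := If; rewrite {1}Ef => /IM[Ih|Ic].
  have [|pi [h' [pirr Eh' Ipi]]] := IHk h _ hm Ih; first by lia.
  by exists pi, (h' * c); rewrite Ef Eh'; split=> //; ring.
have [|pi [h' [pirr Eh' Ipi]]] := IHk c _ cm Ic; first by lia.
by exists pi, (h * h'); rewrite Ef Eh'; split=> //; ring.
Qed.

Lemma irreducible_size pi : irreducible_over_fractions pi -> (1 < size pi)%N.
Proof. by case=> _ []; rewrite size_map_tofrac. Qed.

Lemma irreducible_coprime pi a : irreducible_over_fractions pi ->
  ~ (exists h, a = h * pi) -> coprimep (map_poly toK pi) (map_poly toK a).
Proof.
move=> [pm irr] na; rewrite coprimep_def; apply: contrapT => /negP g1.
apply: na; apply: unit_lead_divides (monic_lead_unit pm) _.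
by rewrite -(eqp_dvdl _ (irr _ g1 (dvdp_gcdl _ _))) dvdp_gcdr.
Qed.

Lemma irreducible_prime pi a b : irreducible_over_fractions pi ->
  (exists h, a * b = h * pi) -> (exists h, a = h * pi) \/ (exists h, b = h * pi).
Proof.
move=> pirr [h E]; have [|na] := pselect (exists h, a = h * pi); [by left|right].
apply: unit_lead_divides (monic_lead_unit (proj1 pirr)) _.
rewrite -(Gauss_dvdpr _ (irreducible_coprime pirr na)) -rmorphM /= E rmorphM /=.
exact: dvdp_mulIr.
Qed.

Lemma common_irreducible_factor f g : f \is monic ->
  ~~ coprimep (map_poly toK f) (map_poly toK g) ->
  exists pi, [/\ irreducible_over_fractions pi, exists h, f = h * pi & exists h, g = h * pi].
Proof.
move=> fm; rewrite coprimep_def => g1.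
have [c [h [cm Ef cg]]] := monic_factor fm (dvdp_gcdl _ (map_poly toK g)).
have [h' Eg] : exists h', g = h' * c.
  apply: unit_lead_divides (monic_lead_unit cm) _.
  by rewrite (eqp_dvdl _ cg) dvdp_gcdr.
have c1 : (1 < size c)%N.
  move: g1; rewrite -(eqp_size cg) size_map_tofrac.
  by have := monic_neq0 cm; rewrite -size_poly_gt0; case: (size c) => [|[]].
have [||pi [e [pirr Ec _]]] := @irreducible_factor (fun q => (1 < size q)%N) _ _ c cm c1.
- move=> a b; have [->|a0] := eqVneq a 0; first by rewrite mul0r size_poly0.
  have [->|b0] := eqVneq b 0; first by rewrite mulr0 size_poly0.
  rewrite size_mul //; have [a1|a1] := ltnP 1 (size a); first by left.
  by move=> ab; right; move: a1 ab; move: (size a) (size b) => i j; lia.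
- by rewrite size_poly1.
by exists pi; split=> //; [exists (h * e)|exists (h' * e)]; rewrite ?Ef ?Eg Ec mulrA.
Qed.

(** Off the zeros of the constant of a Bezout relation, the relation survives
evaluation. *)
Lemma coprime_specialize f g : coprimep (map_poly toK f) (map_poly toK g) ->
  exists2 delta : A, delta != 0 & forall x, meval x delta != 0 ->
    coprimep (map_poly (meval x) f) (map_poly (meval x) g).
Proof.
case/coprime_clear => u [v [c [c0 E]]]; exists c => // x xc.
apply/Bezout_coprimepP; exists (map_poly (meval x) u, map_poly (meval x) v).
have := congr1 (map_poly (meval x)) E.
by rewrite rmorphD /= !rmorphM /= map_polyC /= => ->; rewrite polyC_eqp1.
Qed.

End IrreducibleFactors.

(** * Homogeneous polynomials and affine charts *)
Section HomogeneousPolynomials.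
Variables (C : numClosedFieldType) (n : nat).
Local Notation vec := 'rV[C]_(n.+2).
Implicit Types (F G : hpoly C n) (x v p : vec).

Lemma pevalD F G x : peval (F + G) x = peval F x + peval G x.
Proof. exact: rmorphD. Qed.
Lemma pevalM F G x : peval (F * G) x = peval F x * peval G x.
Proof. exact: rmorphM. Qed.
Lemma pevalC c x : peval (mpolyC _ c) x = c.
Proof. exact: mevalC. Qed.
Lemma pevalX i x : peval (mpolyX C (mnm1 i)) x = x ord0 i.
Proof. exact: mevalXU. Qed.
Lemma peval_sum (I : Type) (r : seq I) (P : pred I) (H : I -> hpoly C n) x :
  peval (\sum_(i <- r | P i) H i) x = \sum_(i <- r | P i) peval (H i) x.
Proof. exact: (rmorph_sum (meval (x ord0))). Qed.
Lemma pevalZ c F x : peval (c *: F) x = c * peval F x.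
Proof. exact: mevalZ. Qed.

Lemma peval_ext F G : (forall x, peval F x = peval G x) -> F = G.
Proof.
move=> E; apply/eqP; rewrite -subr_eq0; apply/eqP/mpoly_eval0 => x.
rewrite mevalB; apply/eqP; rewrite subr_eq0; apply/eqP.
have := E (\row_i x i); rewrite /peval.
by rewrite (meval_eq (v2 := x)) ?(meval_eq _ (v2 := x)) // => i; rewrite mxE.
Qed.

Lemma peval_scale k G c x : homogeneous k G -> peval G (c *: x) = c ^+ k * peval G x.
Proof.
move=> /dhomogP hG; rewrite /peval !mevalE mulr_sumr; rewrite !big_seq.
apply: eq_bigr => u uG; rewrite mulrCA; congr (_ * _).
have <- : mdeg u = k := hG u uG.
rewrite mdegE -prodrXr -big_split /=; apply: eq_bigr => i _.
by rewrite mxE exprMn.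
Qed.

Lemma homogeneous_size k G : homogeneous k G -> (msize G <= k.+1)%N.
Proof.
move=> /dhomogP hG; rewrite msizeE; apply/bigmax_leqP_seq => u uG _.
by rewrite ltnS hG.
Qed.

Lemma homogeneousM j k F G : homogeneous j F -> homogeneous k G -> homogeneous (j + k) (F * G).
Proof. by move=> hF hG; apply: dhomogM. Qed.

Lemma homogeneousX i : homogeneous 1 (mpolyX C (mnm1 i) : hpoly C n).
Proof. by apply/dhomogP => u; rewrite msuppX inE => /eqP ->; exact: mdeg1. Qed.

Lemma homogeneousC c : homogeneous 0 (mpolyC _ c : hpoly C n).
Proof.
apply/dhomogP => u; rewrite msuppC; case: ifP => // _.
by rewrite inE => /eqP ->; exact: mdeg0.
Qed.

Lemma homogeneousZ k c F : homogeneous k F -> homogeneous k (c *: F).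
Proof. by move=> hF; apply: rpredZ. Qed.

Lemma homogeneous_sum k (I : Type) (r : seq I) (P : pred I) (H : I -> hpoly C n) :
  (forall i, P i -> homogeneous k (H i)) -> homogeneous k (\sum_(i <- r | P i) H i).
Proof. by move=> hH; apply: rpred_sum. Qed.

Lemma homogeneous_mderiv k F i : homogeneous k F -> homogeneous k.-1 (mderiv i F).
Proof.
move=> /dhomogP hF; apply/dhomogP => u; rewrite mcoeff_msupp mcoeff_deriv => uF.
have uF' : mnm_add u (mnm1 i) \in msupp F.
  by rewrite mcoeff_msupp; apply: contraNneq uF => ->; rewrite mul0rn.
have <- : mdeg (mnm_add u (mnm1 i)) = k := hF _ uF'.
by rewrite mdegD mdeg1 addn1.
Qed.

Definition dirderiv p F : hpoly C n := \sum_i p ord0 i *: mderiv i F.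

Lemma peval_dirderiv p F x : peval (dirderiv p F) x = dpoly F x p.
Proof.
by rewrite peval_sum; apply: eq_bigr => i _; rewrite pevalZ mulrC.
Qed.

Lemma homogeneous_dirderiv k p F : homogeneous k F -> homogeneous k.-1 (dirderiv p F).
Proof.
by move=> hF; apply: homogeneous_sum => i _; apply/homogeneousZ/homogeneous_mderiv.
Qed.

Lemma dpoly_scale k F c x v : homogeneous k F -> dpoly F (c *: x) v = c ^+ k.-1 * dpoly F x v.
Proof.
by move=> hF; rewrite -!peval_dirderiv; apply/peval_scale/homogeneous_dirderiv.
Qed.

Lemma dpolyD F x v w : dpoly F x (v + w) = dpoly F x v + dpoly F x w.
Proof. by rewrite -big_split; apply: eq_bigr => i _; rewrite mxE mulrDr. Qed.

Lemma dpolyZ F x c v : dpoly F x (c *: v) = c * dpoly F x v.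
Proof. by rewrite mulr_sumr; apply: eq_bigr => i _; rewrite mxE mulrCA. Qed.

Lemma dpoly_mul F x k (u : 'rV[C]_k) (M : 'M[C]_(k, n.+2)) :
  dpoly F x (u *m M) = \sum_i u ord0 i * dpoly F x (row i M).
Proof.
rewrite /dpoly (eq_bigr (fun i => \sum_j u ord0 i * (peval (mderiv j F) x * row i M ord0 j))).
  rewrite exchange_big /=; apply: eq_bigr => j _; rewrite mxE mulr_sumr.
  by apply: eq_bigr => i _; rewrite mxE mulrCA.
by move=> i _; rewrite mulr_sumr.
Qed.

Lemma peval_on_line G x p y : (on_line (x ord0) (p ord0) G).[y] = peval G (x + y *: p).
Proof.
by rewrite horner_on_line; apply: meval_eq => i; rewrite !mxE mulrC.
Qed.

Lemma deriv_on_line G x p : (on_line (x ord0) (p ord0) G)^`() = on_line (x ord0) (p ord0) (dirderiv p G).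
Proof.
rewrite /on_line deriv_line_subst rmorph_sum /=; apply: eq_bigr => i _.
by rewrite -mul_mpolyC rmorphM /= line_substC.
Qed.

Lemma horner_deriv_on_line G x p y :
  ((on_line (x ord0) (p ord0) G)^`()).[y] = dpoly G (x + y *: p) p.
Proof. by rewrite deriv_on_line peval_on_line peval_dirderiv. Qed.

(** Euler's relation: a homogeneous polynomial that vanishes at [x] vanishes on the
line through [x] and the origin. *)
Lemma euler_on_hypersurface k F x : homogeneous k F -> peval F x = 0 -> dpoly F x x = 0.
Proof.
move=> hF Fx; have := horner_deriv_on_line F x x 0; rewrite scale0r addr0 => <-.
suff -> : on_line (x ord0) (x ord0) F = 0 by rewrite deriv0 horner0.
apply: poly_eval0 => y; rewrite peval_on_line -[X in X + _]scale1r -scalerDl.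
by rewrite (peval_scale _ _ hF) Fx mulr0.
Qed.

Lemma on_line_homogeneous k F x p : homogeneous k F ->
  (size (on_line (x ord0) (p ord0) F) <= k.+1)%N /\
  (on_line (x ord0) (p ord0) F)`_k = peval F p.
Proof.
move=> hF.
have := @line_subst_top C C idfun n.+2 (x ord0) (p ord0) F k (homogeneous_size hF).
by rewrite pihomog_dE.
Qed.

End HomogeneousPolynomials.

Section Charts.
Variables (C : numClosedFieldType) (n k : nat) (o : 'rV[C]_(n.+2))
  (B : 'M[C]_(k, n.+2)) (p : 'rV[C]_(n.+2)).
Implicit Types (G F : hpoly C n).

(** [G] at the points [o + x *m B + y *: p], as a polynomial in [y] over the polynomials
in [x]: along [p] an equation can be monic, and divided by. *)
Definition chart G : {poly mpoly k C} :=
  line_subst (@mpolyC k C)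
    (fun i => mpolyC k (o ord0 i) + \sum_j mpolyC k (B j i) * mpolyX C (mnm1 j))
    (fun i => mpolyC k (p ord0 i)) G.

HB.instance Definition _ := GRing.RMorphism.copy chart
  (line_subst (@mpolyC k C)
    (fun i => mpolyC k (o ord0 i) + \sum_j mpolyC k (B j i) * mpolyX C (mnm1 j))
    (fun i => mpolyC k (p ord0 i))).

Lemma map_chart G (x : 'rV[C]_k) :
  map_poly (meval (x ord0)) (chart G) = on_line ((o + x *m B) ord0) (p ord0) G.
Proof.
apply: map_line_subst => i /=; rewrite ?mevalC //.
rewrite mevalD mevalC raddf_sum /= !mxE; congr (_ + _); apply: eq_bigr => j _.
by rewrite mevalM mevalC mevalXU mulrC.
Qed.

Lemma horner_chart G (x : 'rV[C]_k) y :
  (map_poly (meval (x ord0)) (chart G)).[y] = peval G (o + x *m B + y *: p).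
Proof. by rewrite map_chart peval_on_line. Qed.

Lemma deriv_chart G : (chart G)^`() = chart (dirderiv p G).
Proof.
rewrite /chart deriv_line_subst rmorph_sum /=; apply: eq_bigr => i _.
by rewrite -mul_mpolyC rmorphM /= line_substC.
Qed.

Lemma chart_homogeneous d F : homogeneous d F -> peval F p = 1 ->
  chart F \is monic /\ size (chart F) = d.+1.
Proof.
move=> hF Fp.
have [|s1 s2] := @line_subst_top C (mpoly k C) (@mpolyC k C) n.+2
  (fun i => mpolyC k (o ord0 i) + \sum_j mpolyC k (B j i) * mpolyX C (mnm1 j))
  (fun i => mpolyC k (p ord0 i)) F d; first exact: homogeneous_size.
have {}s2 : (chart F)`_d = 1.
  rewrite /chart s2 pihomog_dE //.
  by rewrite -(mmap_rmorph idfun (p ord0) (@mpolyC k C)) mmap_idfun -/(peval F p) Fp rmorph1.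
have s3 : size (chart F) = d.+1.
  apply/eqP; rewrite eqn_leq s1 ltnNge; apply/negP => s3.
  by move: s2; rewrite nth_default // => /eqP; rewrite eq_sym oner_eq0.
by split=> //; rewrite monicE lead_coefE s3 s2.
Qed.

End Charts.

(** Gaussian elimination: the rows that complete [T] are the last ones of the extended
row base. *)
Lemma frame_completion (C : fieldType) (m k : nat) (T : 'M[C]_(m, m + k)) :
  row_free T -> exists B : 'M[C]_(k, m + k), col_mx T B \in unitmx.
Proof.
move=> fT; exists (dsubmx (row_ebase T)).
have E : T = col_ebase T *m usubmx (row_ebase T).
  rewrite -{1}[T]mulmx_ebase (eqP fT) -mulmxA; congr (_ *m _).
  rewrite -{1}[row_ebase T]vsubmxK pid_mx_row.
  by rewrite mul_row_col mul1mx mul0mx addr0.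
have -> : col_mx T (dsubmx (row_ebase T)) = block_mx (col_ebase T) 0 0 1%:M *m row_ebase T.
  by rewrite -{2}[row_ebase T]vsubmxK mul_block_col !mul0mx mul1mx addr0 add0r -E.
rewrite unitmx_mul row_ebase_unit andbT unitmxE det_ublock det1 mulr1 -unitmxE.
exact: col_ebase_unit.
Qed.

Lemma eval_combination (S T : comNzRingType) (phi : {rmorphism S -> T})
    (u f v g : {poly S}) c y : u * f + v * g = c%:P ->
  (map_poly phi f).[y] = 0 -> (map_poly phi g).[y] = 0 -> phi c = 0.
Proof.
move=> E fy gy; have := congr1 (fun q => (map_poly phi q).[y]) E.
by rewrite /= rmorphD /= !rmorphM /= hornerD !hornerM fy gy !mulr0 addr0 map_polyC hornerC => <-.
Qed.

(** * Components of the hypersurface *)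
Section Components.
Variables (C : numClosedFieldType) (n d : nat) (F : hpoly C n) (p : 'rV[C]_(n.+2))
  (B : 'M[C]_(n.+1, n.+2)).
Hypothesis (redF : reduced_equation d F) (Fp : peval F p = 1).
Hypothesis (frame : (col_mx p B : 'M[C]_(1 + n.+1)) \in unitmx).
Local Notation A := (mpoly n.+1 C).
Local Notation toK := (@FracField.tofrac A).
Local Notation Psi := (chart 0 B p).
Implicit Types (G P a b g : hpoly C n) (x : 'rV[C]_(n.+1)) (X : 'rV[C]_(n.+2)).

Let homF : homogeneous d F. Proof. by case: redF. Qed.
Let monF : Psi F \is monic. Proof. by case: (chart_homogeneous 0 B homF Fp). Qed.
Let sizF : size (Psi F) = d.+1. Proof. by case: (chart_homogeneous 0 B homF Fp). Qed.

Lemma frame_point X : exists x y, X = x *m B + y *: p.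
Proof.
pose T : 'M[C]_(1 + n.+1) := col_mx p B; pose z := (X : 'rV[C]_(1 + n.+1)) *m invmx T.
exists (rsubmx z), (z ord0 (lshift _ ord0)).
have := mulmxKV frame (X : 'rV[C]_(1 + n.+1)); rewrite -/T -/z => <-.
rewrite -{1}[z]hsubmxK /T mul_row_col addrC; congr (_ + _).
by rewrite [lsubmx z]mx11_scalar mul_scalar_mx mxE.
Qed.

Lemma frame_point_neq0 x y : x != 0 -> x *m B + y *: p != 0.
Proof.
move=> x0; apply: contraNneq x0 => E.
have : row_mx y%:M x *m col_mx p B = 0.
  by rewrite mul_row_col mul_scalar_mx addrC.
move/(congr1 (mulmx^~ (invmx (col_mx p B : 'M[C]_(1 + n.+1))))).
rewrite (mulmxK frame) mul0mx => /(congr1 (@rsubmx _ _ _ _)).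
by rewrite row_mxKr linear0 => ->.
Qed.

Lemma horner_Psi G x y : (map_poly (meval (x ord0)) (Psi G)).[y] = peval G (x *m B + y *: p).
Proof. by rewrite horner_chart add0r. Qed.

Lemma Psi_inj : injective Psi.
Proof.
move=> G G' E; apply: peval_ext => X; have [x [y ->]] := frame_point X.
by rewrite -!horner_Psi E.
Qed.

Lemma Psi_linear_form (c : 'cV[C]_(n.+2)) :
  Psi (\sum_i c i ord0 *: mpolyX C (mnm1 i)) =
  (\sum_j mpolyC _ ((B *m c) j ord0) * mpolyX C (mnm1 j))%:P + (mpolyC _ ((p *m c) ord0 ord0))%:P * 'X.
Proof.
rewrite rmorph_sum /= (eq_bigr (fun i => (mpolyC n.+1 (c i ord0) *
  (\sum_j mpolyC _ (B j i) * mpolyX C (mnm1 j)))%:P + (mpolyC n.+1 (c i ord0 * p ord0 i))%:P * 'X)).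
  rewrite big_split /= -mulr_suml; congr (_ + _ * _).
    rewrite -rmorph_sum /=; congr (_%:P).
    rewrite (eq_bigr (fun i => \sum_j mpolyC _ (B j i * c i ord0) * mpolyX C (mnm1 j))); last first.
      move=> i _; rewrite mulr_sumr; apply: eq_bigr => j _.
      by rewrite mulrA -mpolyCM [B j i * _]mulrC.
    rewrite exchange_big /=; apply: eq_bigr => j _; rewrite -mulr_suml; congr (_ * _).
    by rewrite mxE rmorph_sum.
  rewrite -rmorph_sum /= -rmorph_sum /= mxE; congr (mpolyC _ _)%:P.
  by apply: eq_bigr => i _; rewrite mulrC.
move=> i _; rewrite -mul_mpolyC rmorphM /= /chart line_substC line_substX mxE mpolyC0 add0r.
by rewrite mpolyCM !polyCM; ring.
Qed.

(** A frame is a linear system of coordinates, so that the chart centered at the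
origin is an isomorphism of rings. *)
Lemma Psi_surj (q : {poly A}) : exists G, Psi G = q.
Proof.
pose T : 'M[C]_(1 + n.+1) := col_mx p B; pose Ti : 'M[C]_(1 + n.+1) := invmx T.
have ETT : T *m Ti = 1%:M by apply: mulmxV.
have Ep : p *m (Ti : 'M[C]_(n.+2)) = row_mx 1%:M 0 :> 'rV[C]_(1 + n.+1).
  have := congr1 (@usubmx _ _ _ _) ETT; rewrite /T mul_col_mx col_mxKu => ->.
  by rewrite scalar_mx_block block_mxEv col_mxKu.
have EB : B *m (Ti : 'M[C]_(n.+2)) = row_mx 0 1%:M :> 'M[C]_(n.+1, 1 + n.+1).
  have := congr1 (@dsubmx _ _ _ _) ETT; rewrite /T mul_col_mx col_mxKd => ->.
  by rewrite scalar_mx_block block_mxEv col_mxKd.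
have colM m (M : 'M[C]_(m, 1 + n.+1)) j : M *m col j Ti = col j (M *m Ti).
  by rewrite !colE mulmxA.
have imX : exists G, Psi G = 'X.
  exists (\sum_i col (lshift n.+1 ord0 : 'I_(1 + n.+1)) Ti i ord0 *: mpolyX C (mnm1 i)).
  rewrite Psi_linear_form !colM Ep EB big1 ?add0r => [|j _].
    by rewrite mxE row_mxEl mxE eqxx mpolyC1 mul1r.
  by rewrite mxE row_mxEl mxE mpolyC0 mul0r.
have imXj j : exists G, Psi G = (mpolyX C (mnm1 j))%:P.
  exists (\sum_i col (rshift 1 j : 'I_(1 + n.+1)) Ti i ord0 *: mpolyX C (mnm1 i)).
  rewrite Psi_linear_form !colM Ep EB.
  rewrite [X in (mpolyC _ X)%:P * _]mxE row_mxEr [X in (mpolyC _ X)%:P * _]mxE mpolyC0 mul0r addr0.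
  rewrite (bigD1 j) //= big1 ?addr0 => [|i ij].
    by rewrite mxE row_mxEr mxE eqxx mpolyC1 mul1r.
  by rewrite mxE row_mxEr mxE (negbTE ij) mpolyC0 mul0r.
have imC (c : A) : exists G, Psi G = c%:P.
  elim/mpoly_ring_ind: c => [c|j|a b [Ga Ea] [Gb Eb]|a b [Ga Ea] [Gb Eb]].
  - by exists (mpolyC _ c); rewrite /chart line_substC.
  - exact: imXj.
  - by exists (Ga + Gb); rewrite rmorphD /= Ea Eb polyCD.
  - by exists (Ga * Gb); rewrite rmorphM /= Ea Eb polyCM.
have [GX EX] := imX.
elim/poly_ind: q => [|q c [G EG]]; first by exists 0; rewrite rmorph0.
have [Gc Ec] := imC c; exists (G * GX + Gc).
by rewrite rmorphD rmorphM /= EG EX Ec.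
Qed.

Lemma hypersurface_subset P G : (exists h, Psi G = h * Psi P) ->
  hypersurface P `<=` hypersurface G.
Proof.
move=> [h Eh] X [X0 PX]; split=> //; have [H EH] := Psi_surj h.
have -> : G = H * P by apply: Psi_inj; rewrite rmorphM /= EH.
by rewrite pevalM PX mulr0.
Qed.

Lemma hypersurface_point P : Psi P \is monic -> (1 < size (Psi P))%N ->
  forall x, x != 0 -> exists2 y, (map_poly (meval (x ord0)) (Psi P)).[y] = 0 &
    hypersurface P (x *m B + y *: p).
Proof.
move=> mP sP x x0; set f := map_poly _ _.
have fm : f \is monic by apply: monic_map.
have sf : size f = size (Psi P).
  by rewrite size_map_poly_id0 // (monicP mP) rmorph1 oner_eq0.
have [y /rootP fy] : exists y, root f y.
  by apply: closed_rootP; rewrite sf neq_ltn sP orbT.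
exists y => //; split; first exact: frame_point_neq0.
by rewrite -horner_Psi.
Qed.

Lemma nonzero_row_point (c : A) : c != 0 -> exists2 x : 'rV[C]_(n.+1), x != 0 & meval (x ord0) c != 0.
Proof.
move=> c0; have [z] : exists z, meval z (c * mpolyX C (mnm1 ord0)) != 0.
  apply: mpoly_nonzero_point; rewrite mulf_neq0 // -msize_poly_eq0 msizeX //.
rewrite mevalM mevalXU mulf_eq0 negb_or => /andP[cx x0].
exists (\row_i z i); first by apply: contraNneq x0 => /rowP/(_ ord0); rewrite !mxE => ->.
by rewrite (meval_eq (v2 := z)) // => i; rewrite mxE.
Qed.

(** The Nullstellensatz for an irreducible hypersurface: otherwise a Bezout relation
would give a nonzero polynomial in [x] alone, vanishing at every nonzero [x]. *)
Lemma vanishes_on_irreducible P a : irreducible_over_fractions (Psi P) ->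
  vanishes_on a (hypersurface P) -> exists h, Psi a = h * Psi P.
Proof.
move=> Pirr aP; apply: contrapT => na.
have [u [v [c [c0 E]]]] := coprime_clear (irreducible_coprime Pirr na).
have [x x0 xc] := nonzero_row_point c0.
have [y Py PX] := hypersurface_point (proj1 Pirr) (irreducible_size Pirr) x0.
case/eqP: xc; apply: (eval_combination E Py).
by rewrite horner_Psi aP.
Qed.

Lemma divisible_vanishes_on P a h : Psi a = h * Psi P -> vanishes_on a (hypersurface P).
Proof. by move=> E X XP; case: (@hypersurface_subset P a (ex_intro _ h E) X XP). Qed.

Lemma irreducible_hypersurface P : irreducible_over_fractions (Psi P) ->
  zariski_irreducible (hypersurface P).
Proof.
move=> Pirr; split.
  have [x x0 _] := nonzero_row_point (oner_neq0 A).
  have [y _ PX] := hypersurface_point (proj1 Pirr) (irreducible_size Pirr) x0.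
  by eexists; exact: PX.
move=> a b /(vanishes_on_irreducible Pirr); rewrite rmorphM /=.
by case/(irreducible_prime Pirr) => -[h E]; [left|right]; apply: divisible_vanishes_on E.
Qed.

Lemma reduced_squarefree P h : irreducible_over_fractions (Psi P) ->
  Psi F = h * Psi P ^+ 2 -> False.
Proof.
move=> Pirr E; have [H EH] := Psi_surj h.
have EF : F = H * P ^+ 2 by apply: Psi_inj; rewrite rmorphM /= rmorphXn /= EH.
case: redF => _ _ /(_ _ _ EF) uP.
have : Psi P \is a GRing.unit by apply: rmorph_unit.
rewrite poly_unitE => /andP[/eqP s1 _].
by have := irreducible_size Pirr; rewrite s1.
Qed.

(** A larger irreducible set inside the hypersurface would lie in the zeros of the
cofactor, which would then be divisible by [P] again. *)
Lemma irreducible_factor_component P : irreducible_over_fractions (Psi P) ->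
  (exists h, Psi F = h * Psi P) -> component F (hypersurface P).
Proof.
move=> Pirr [h E]; split.
- exact: hypersurface_subset (ex_intro _ h E).
- exact: irreducible_hypersurface.
move=> Z' [Z'0 irrZ'] PZ' Z'F; have [H EH] := Psi_surj h.
have EF : F = H * P by apply: Psi_inj; rewrite rmorphM /= EH.
have /irrZ'[HZ'|PZ] : vanishes_on (H * P) Z' by move=> X /Z'F []; rewrite -EF.
  have [|h' Eh'] := vanishes_on_irreducible (a := H) Pirr.
    by move=> X /PZ'; apply: HZ'.
  case: (@reduced_squarefree P h' Pirr); rewrite E -EH Eh'; ring.
apply/seteqP; split=> // X XZ'; split; last exact: PZ.
by case: (Z'F _ XZ').
Qed.

(** A common irreducible factor of the two equations defines a component. *)
Lemma contains_no_component_coprime g : contains_no_component F g ->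
  coprimep (map_poly toK (Psi F)) (map_poly toK (Psi g)).
Proof.
move=> Fg; apply/negPn/negP => /(common_irreducible_factor monF)[pi [pirr Ff [h Eg]]].
have [P EP] := Psi_surj pi; rewrite -EP in pirr Ff Eg.
exact: Fg _ (irreducible_factor_component pirr Ff) (divisible_vanishes_on Eg).
Qed.

(** A component is irreducible, so an irreducible factor of the equation vanishes on
it; by maximality the component is the whole zero set of this factor. *)
Lemma coprime_contains_no_component g :
  coprimep (map_poly toK (Psi F)) (map_poly toK (Psi g)) -> contains_no_component F g.
Proof.
move=> cFg Z [ZF [[X0 ZX0] irrZ] maxZ] gZ.
have [|||pi [h [pirr EF piZ]]] := @irreducible_factor C n.+1
  (fun q => forall a, Psi a = q -> vanishes_on a Z) _ _ _ monF.
- move=> q r qr; have [a Ea] := Psi_surj q; have [b Eb] := Psi_surj r.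
  have /irrZ[aZ|bZ] := qr (a * b) (etrans (rmorphM _ _ _) (congr2 *%R Ea Eb)).
    by left=> a' Ea'; rewrite (_ : a' = a) //; apply: Psi_inj; rewrite Ea' Ea.
  by right=> b' Eb'; rewrite (_ : b' = b) //; apply: Psi_inj; rewrite Eb' Eb.
- move=> /(_ 1 (rmorph1 _) _ ZX0); rewrite -mpolyC1 pevalC => /eqP.
  by rewrite oner_eq0.
- by move=> a /Psi_inj -> X /ZF[].
have [P EP] := Psi_surj pi; rewrite -EP in pirr EF piZ.
have [PF irrP _] := irreducible_factor_component pirr (ex_intro _ h EF).
have ZP : Z `<=` hypersurface P.
  by move=> X XZ; split; [case: (ZF _ XZ)|apply: (piZ P)].
have EZ := maxZ _ irrP ZP PF.
have [h' Eg] : exists h, Psi g = h * Psi P.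
  by apply: (vanishes_on_irreducible pirr); rewrite EZ.
have := coprime_common_divisor cFg (ex_intro _ h EF) (ex_intro _ h' Eg).
by move: (irreducible_size pirr); case: size => [|[]].
Qed.

(** An irreducible factor of [F] and of its derivative divides the cofactor or its own
derivative; the first makes [F] non reduced, the second contradicts the degrees. *)
Lemma coprime_derivative : coprimep (map_poly toK (Psi F)) (map_poly toK (Psi F)^`()).
Proof.
apply/negPn/negP => /(common_irreducible_factor monF)[pi [pirr [h Ef] [h' Ef']]].
have pi1 := irreducible_size pirr.
have [|[e Eh]|[e Ed]] := @irreducible_prime C n.+1 pi h pi^`() pirr.
- exists (h' - h^`()); rewrite mulrBl -Ef' Ef derivM; ring.
- have [P EP] := Psi_surj pi; rewrite -EP in pirr Ef Eh.
  by apply: (@reduced_squarefree P e pirr); rewrite Ef Eh; ring.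
have pi0 : pi != 0 by rewrite monic_neq0 // (proj1 pirr).
have d0 : pi^`() != 0.
  apply/eqP => /(congr1 (fun q : {poly A} => q`_(size pi).-2)).
  rewrite coef0 coef_deriv; move: pi1 (monicP (proj1 pirr)); rewrite lead_coefE.
  case: (size pi) => [|[|s]] //= _ ->; rewrite -mpolyC1 -mpolyCMn => /eqP.
  by rewrite mpolyC_eq0 pnatr_eq0.
have := size_dvd_leq d0 Ed.
by rewrite leqNgt lt_size_deriv.
Qed.

Lemma dirderiv_contains_no_component : contains_no_component F (dirderiv p F).
Proof.
by apply: coprime_contains_no_component; rewrite -deriv_chart coprime_derivative.
Qed.

Lemma linear_form_contains_no_component (c : 'cV[C]_(n.+2)) : c != 0 -> p *m c = 0 ->
  contains_no_component F (\sum_i c i ord0 *: mpolyX C (mnm1 i)).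
Proof.
move=> c0 pc; apply: coprime_contains_no_component.
rewrite Psi_linear_form pc mxE mpolyC0 mul0r addr0 map_polyC /=.
set l := \sum_j _; suff l0 : l != 0.
  by rewrite -alg_polyC coprimepZr ?tofrac_eq0 // coprimep1.
apply: contraNneq c0 => l0.
have : (col_mx p B : 'M[C]_(1 + n.+1)) *m (c : 'cV[C]_(1 + n.+1)) = 0.
  rewrite mul_col_mx pc; suff -> : B *m c = 0 by rewrite col_mx0.
  apply/colP => j; rewrite [RHS]mxE; have := congr1 (mcoeff (mnm1 j)) l0.
  rewrite raddf_sum mcoeff0 (bigD1 j) //= big1 ?addr0 => [|i ij].
    by rewrite mcoeffCM mcoeffX eqxx mulr1.
  by rewrite mcoeffCM mcoeffX eq_mnm1 (negbTE ij) mulr0.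
by move/(congr1 (mulmx (invmx (col_mx p B : 'M[C]_(1 + n.+1))))); rewrite mulKmx // mulmx0 => ->.
Qed.

(** The Bezout relations of [F] with its derivative and with [g] survive the
specialization to a generic line through [p]. *)
Lemma generic_line_sections g : contains_no_component F g ->
  exists2 delta : A, delta != 0 & forall x, meval (x ord0) delta != 0 ->
    exists y : 'I_d -> C, [/\ injective y,
      forall j, peval F (x *m B + y j *: p) = 0 &
      forall j, peval g (x *m B + y j *: p) != 0].
Proof.
move=> /contains_no_component_coprime /coprime_specialize[d1 d10 H1].
have [d2 d20 H2] := coprime_specialize coprime_derivative.
exists (d1 * d2) => [|x]; first by rewrite mulf_neq0.
rewrite mevalM mulf_eq0 negb_or => /andP[/H1 c1 /H2 c2].
pose f := map_poly (meval (x ord0)) (Psi F).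
have Ef : f^`() = map_poly (meval (x ord0)) (Psi F)^`() := deriv_map _ _.
have {}c2 : coprimep f f^`() by rewrite Ef; exact: c2.
have {}c1 : coprimep f (map_poly (meval (x ord0)) (Psi g)) := c1.
have Hf y : f.[y] = peval F (x *m B + y *: p) := horner_Psi F x y.
have Hg y : (map_poly (meval (x ord0)) (Psi g)).[y] = peval g (x *m B + y *: p) := horner_Psi g x y.
have fm : f \is monic by apply: monic_map.
have sf : size f = d.+1 by rewrite size_map_poly_id0 ?sizF // (monicP monF) rmorph1 oner_eq0.
clearbody f.
have [r Er] := closed_field_poly_normal f.
rewrite (monicP fm) scale1r in Er.
have ur : uniq r.
  by rewrite -separable_prod_XsubC -Er unlock; exact: c2.
have sr : size r = d by move: sf; rewrite Er size_prod_XsubC => -[].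
have rf i : f.[r`_i] = 0 \/ (size r <= i)%N.
  case: (leqP (size r) i) => ri; [by right|left].
  by apply/rootP; rewrite Er root_prod_XsubC mem_nth.
exists (fun j => r`_j); split=> [i j /eqP|j|j].
- by rewrite nth_uniq ?sr // => /eqP/val_inj.
- by rewrite -Hf; case: (rf j) => //; rewrite sr leqNgt ltn_ord.
case: (rf j) => [fj|]; last by rewrite sr leqNgt ltn_ord.
by rewrite -Hg; apply: (coprimep_root c1); apply/rootP.
Qed.

End Components.

(** * Alternating forms *)
Section AlternatingForms.

Lemma det_mul_expand (R : comNzRingType) (q k : nat) (M : 'M[R]_(q, k)) (W : 'M[R]_(k, q)) :
  \det (M *m W) =
  \sum_(f : {ffun 'I_q -> 'I_k}) (\prod_i M i (f i)) * \det (rowsub f W).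
Proof.
rewrite /determinant (eq_bigr (fun s : 'S_q => \sum_(f : {ffun 'I_q -> 'I_k})
   (-1) ^+ s * ((\prod_i M i (f i)) * \prod_i W (f i) (s i)))); last first.
  move=> s _; rewrite -mulr_sumr; congr (_ * _).
  rewrite (eq_bigr (fun i => \sum_j M i j * W j (s i))) => [|i _]; last by rewrite mxE.
  by rewrite bigA_distr_bigA /=; apply: eq_bigr => f _; rewrite big_split.
rewrite exchange_big; apply: eq_bigr => f _; rewrite mulr_sumr; apply: eq_bigr => s _.
by rewrite mulrCA; congr (_ * (_ * _)); apply: eq_bigr => i _; rewrite mxE.
Qed.

(** Sorting: the permutation sends [i] to the rank of [f i] in the image. *)
Lemma sort_injection (q m : nat) (f : 'I_q -> 'I_m) : injective f ->
  exists (J : {ffun 'I_q -> 'I_m}) (s : 'S_q),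
    (forall i j : 'I_q, (i < j)%N -> (J i < J j)%N) /\ f =1 J \o s.
Proof.
move=> finj; pose r i := #|[pred j | (f j < f i)%N]|.
have rq i : (r i < q)%N.
  have : (r i <= #|predC1 i|)%N.
    apply/subset_leq_card/fintype.subsetP => k; rewrite !inE => fk.
    by apply: contraTneq fk => ->; rewrite ltnn.
  by rewrite cardC1 card_ord; move: (ltn_ord i); lia.
have rle i j : (f i <= f j)%N -> (r i <= r j)%N.
  move=> fij; apply/subset_leq_card/fintype.subsetP => k; rewrite !inE => fk.
  exact: leq_trans fk fij.
have rlt i j : (f i < f j)%N -> (r i < r j)%N.
  move=> fij; apply: proper_card; apply/properP; split.
    by apply/fintype.subsetP => k; rewrite !inE => fk; apply: ltn_trans fk fij.
  by exists i; rewrite !inE // ltnn.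
pose s0 i := Ordinal (rq i).
have s0inj : injective s0.
  move=> i j /(congr1 val) /= E; apply: finj; apply: val_inj; apply/eqP.
  by case: ltngtP => // /rlt; rewrite E ltnn.
exists [ffun i => f ((perm s0inj)^-1%g i)], (perm s0inj); split=> [i j ij|i]; last first.
  by rewrite /= ffunE permK.
rewrite !ffunE ltnNge; apply/negP => /rle.
have Es k : r ((perm s0inj)^-1%g k) = k.
  by have := permKV (perm s0inj) k; rewrite permE => /(congr1 val).
by rewrite !Es leqNgt ij.
Qed.

Definition increasing (q m : nat) (J : {ffun 'I_q -> 'I_m}) :=
  [forall i : 'I_q, [forall j : 'I_q, (i < j)%N ==> (J i < J j)%N]].

Lemma increasingP (q m : nat) (J : {ffun 'I_q -> 'I_m}) :
  reflect (forall i j : 'I_q, (i < j)%N -> (J i < J j)%N) (increasing J).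
Proof.
by apply: (iffP forallP) => H i; [move=> j; have /forallP/(_ j)/implyP := H i|
  apply/forallP => j; apply/implyP/H].
Qed.

Lemma increasing_inj (q m : nat) (J : {ffun 'I_q -> 'I_m}) : increasing J -> injective J.
Proof.
move=> /increasingP iJ i j E; apply: val_inj; apply/eqP.
by case: ltngtP => // /iJ; rewrite E ltnn.
Qed.

Lemma increasing_sorted (q m : nat) (J : {ffun 'I_q -> 'I_m}) : increasing J ->
  sorted ltn (map val [tuple J i | i < q]).
Proof.
move=> /increasingP iJ; apply/(sortedP 0%N) => i; rewrite size_map size_tuple => iq.
have iq' := ltnW iq; rewrite !(nth_map (J (Ordinal iq))) ?size_tuple //.
rewrite -!(tnth_nth _ _ (Ordinal iq)) -!(tnth_nth _ _ (Ordinal iq')) !tnth_mktuple.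
exact: iJ.
Qed.

Lemma card_increasing (q m : nat) : (#|[pred J : {ffun 'I_q -> 'I_m} | increasing J]| <= 'C(m, q))%N.
Proof.
rewrite -card_ltn_sorted_tuples.
have inj : injective (fun J : {ffun 'I_q -> 'I_m} => [tuple J i | i < q]).
  by move=> J J' E; apply/ffunP => i; have := congr1 (fun t => tnth t i) E; rewrite !tnth_mktuple.
rewrite -(card_imset _ inj); apply/subset_leq_card/fintype.subsetP => t /imsetP[J].
by rewrite !inE => iJ ->; apply: increasing_sorted.
Qed.

Lemma increasing_image (q m : nat) (I J : {ffun 'I_q -> 'I_m}) : increasing I -> increasing J ->
  (forall i, exists j, J i = I j) -> I = J.
Proof.
move=> iI iJ JI.
have sub : {subset [tuple J i | i < q] <= [tuple I i | i < q]}.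
  move=> a /mapP[i _ ->]; have [j ->] := JI i; apply/mapP; exists j => //.
  by rewrite mem_enum.
have uJ : uniq [tuple J i | i < q].
  by rewrite map_inj_uniq ?enum_uniq //; apply: increasing_inj.
have [|_ eqIJ] := uniq_min_size uJ sub; first by rewrite !size_tuple.
have E : map val [tuple J i | i < q] = map val [tuple I i | i < q].
  apply: (irr_sorted_eq ltn_trans ltnn); rewrite ?increasing_sorted //.
  by apply: eq_mem_map.
have {}E := val_inj (inj_map val_inj E).
by apply/ffunP => i; have := congr1 (fun t => tnth t i) E; rewrite !tnth_mktuple.
Qed.

End AlternatingForms.

(** * Rational forms on the affine cone *)
Section PolynomialForms.
Variables (C : numClosedFieldType) (n q : nat).
Implicit Types (P Q : {ffun multi_index n q -> hpoly C n}) (F g h : hpoly C n).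
Implicit Types (x : 'rV[C]_(n.+2)) (v : 'M[C]_(q, n.+2)) (Phi : qform C n q).

Lemma polyform_mul k P x (M : 'M[C]_(q, k)) (W : 'M[C]_(k, n.+2)) :
  polyform_at P x (M *m W) =
  \sum_(f : {ffun 'I_q -> 'I_k}) (\prod_i M i (f i)) * polyform_at P x (rowsub f W).
Proof.
rewrite /polyform_at (eq_bigr (fun I : multi_index n q => \sum_(f : {ffun 'I_q -> 'I_k})
  (\prod_i M i (f i)) * (peval (P I) x * \det (colsub (val I) (rowsub f W))))).
  by rewrite exchange_big; apply: eq_bigr => f _; rewrite mulr_sumr.
move=> I _; rewrite -mulmx_colsub det_mul_expand mulr_sumr; apply: eq_bigr => f _.
by rewrite mulrCA; congr (_ * (_ * \det _)); apply/matrixP => i j; rewrite !mxE.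
Qed.

Definition euler_free P x := forall v k, row k v = x -> polyform_at P x v = 0.

(** Expanding by multilinearity, every term that involves the Euler vector [x] is
zero. *)
Lemma polyform_add_radial P x (u : 'cV[C]_q) v : euler_free P x ->
  polyform_at P x (v + u *m x) = polyform_at P x v.
Proof.
move=> eP; pose W := col_mx v x.
have -> : v + u *m x = row_mx 1%:M u *m W by rewrite mul_row_col mul1mx.
have -> : v = row_mx 1%:M 0 *m W by rewrite mul_row_col mul1mx mul0mx addr0.
rewrite !polyform_mul; apply: eq_bigr => f _.
have [/existsP[i /existsP[k /eqP fi]]|nf] := boolP [exists i, [exists k, f i == rshift q k]].
  rewrite (eP _ i) ?mulr0 //; apply/rowP => j.
  by rewrite [LHS]mxE [LHS]mxE fi /W col_mxEd (ord1 k).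
congr (_ * _); apply: eq_bigr => i _.
case: (split_ordP (f i)) => k fi; first by rewrite fi !row_mxEl.
by case/negP: nf; apply/existsP; exists i; apply/existsP; exists k; rewrite fi.
Qed.

Lemma polyform_scale P x c v : polyform_at P x (c *: v) = c ^+ q * polyform_at P x v.
Proof.
rewrite /polyform_at mulr_sumr; apply: eq_bigr => I _.
have -> : colsub (val I) (c *: v) = c *: colsub (val I) v by apply/matrixP => i j; rewrite !mxE.
by rewrite detZ mulrCA.
Qed.

Lemma polyform_scale_point e P x c v : (forall I, homogeneous e (P I)) ->
  polyform_at P (c *: x) v = c ^+ e * polyform_at P x v.
Proof.
move=> hP; rewrite /polyform_at mulr_sumr; apply: eq_bigr => I _.
by rewrite (peval_scale _ _ (hP I)) mulrA.
Qed.

Lemma polyform_rowsub_perm k P x (f : 'I_q -> 'I_k) (s : 'S_q) (W : 'M[C]_(k, n.+2)) :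
  polyform_at P x (rowsub (f \o s) W) = (-1) ^+ s * polyform_at P x (rowsub f W).
Proof.
rewrite /polyform_at mulr_sumr; apply: eq_bigr => I _; rewrite mulrCA; congr (_ * _).
rewrite -det_perm -det_mulmx; congr (\det _); apply/matrixP => i j.
rewrite !mxE (bigD1 (s i)) //= !mxE eqxx mul1r big1 ?addr0 // => l ls.
by rewrite !mxE eq_sym (negbTE ls) mul0r.
Qed.

Lemma polyform_rowsub_noninjective k P x (f : 'I_q -> 'I_k) (W : 'M[C]_(k, n.+2)) i j :
  i != j -> f i = f j -> polyform_at P x (rowsub f W) = 0.
Proof.
move=> ij fij; rewrite /polyform_at big1 // => I _.
by rewrite (determinant_alternate ij) ?mulr0 // => l; rewrite !mxE fij.
Qed.

Lemma polyform_linear_combination N (c : 'I_N -> C) (P : 'I_N -> {ffun multi_index n q -> hpoly C n}) x v :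
  polyform_at [ffun I => \sum_i c i *: P i I] x v = \sum_i c i * polyform_at (P i) x v.
Proof.
rewrite /polyform_at (eq_bigr (fun I : multi_index n q =>
   \sum_i c i * (peval (P i I) x * \det (colsub (val I) v)))).
  by rewrite exchange_big; apply: eq_bigr => i _; rewrite mulr_sumr.
move=> I _; rewrite ffunE peval_sum mulr_suml; apply: eq_bigr => i _.
by rewrite pevalZ mulrA.
Qed.

Lemma homogeneous_degree_uniq i j g : g != 0 -> homogeneous i g -> homogeneous j g -> i = j.
Proof. exact: dhomog_uniq. Qed.

Lemma contains_no_componentM F g h :
  contains_no_component F g -> contains_no_component F h -> contains_no_component F (g * h).
Proof. by move=> Fg Fh Z FZ; case: (FZ) => _ [_ irrZ] _ /irrZ[]; [apply: Fg|apply: Fh]. Qed.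

Lemma form_on_mul F Phi P g h k : homogeneous k h -> h != 0 -> contains_no_component F h ->
  form_on F Phi P g -> form_on F Phi [ffun I => P I * h] (g * h).
Proof.
move=> hh h0 Fh [[g0 [e [hg hP]] PhiE eP] Fg]; split; last exact: contains_no_componentM.
split=> [||I|x v l lv].
- by rewrite mulf_neq0.
- exists (e + k)%N; rewrite addnAC; split; first exact: homogeneousM.
  by move=> I; rewrite ffunE; apply: homogeneousM.
- rewrite ffunE PhiE !tofracM invfM mulrACA divff ?mulr1 //.
  by rewrite tofrac_eq0.
have := eP x v l lv; rewrite /polyform_at => E.
rewrite (eq_bigr (fun I => peval h x * (peval (P I) x * \det (colsub (val I) v)))).
  by rewrite -mulr_sumr E mulr0.
by move=> I _; rewrite ffunE pevalM mulrCA mulrA.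
Qed.

Lemma polyform_mul_scalar P h x v :
  polyform_at [ffun I => P I * h] x v = polyform_at P x v * peval h x.
Proof.
by rewrite /polyform_at mulr_suml; apply: eq_bigr => I _; rewrite ffunE pevalM mulrAC.
Qed.

Lemma form_at_mul P g h x v : peval h x != 0 ->
  form_at [ffun I => P I * h] (g * h) x v = form_at P g x v.
Proof.
by move=> hx; rewrite /form_at polyform_mul_scalar pevalM invfM mulrACA divff ?mulr1.
Qed.

Lemma form_on_linear_combination F N (c : 'I_N -> C) (Phi : 'I_N -> qform C n q)
    (P : 'I_N -> {ffun multi_index n q -> hpoly C n}) g : (0 < N)%N ->
  (forall i, form_on F (Phi i) (P i) g) ->
  form_on F (\sum_i c i *: Phi i) [ffun I => \sum_i c i *: P i I] g.
Proof.
move=> N0 H; have [[g0 [e [hg _]] _ _] Fg] := H (Ordinal N0).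
split=> //; split=> //.
- exists e; split=> // I; rewrite ffunE; apply: homogeneous_sum => i _; apply: homogeneousZ.
  have [[_ [e' [hg' hP']] _ _] _] := H i.
  by have /addIn -> := homogeneous_degree_uniq g0 hg hg'.
- move=> I; rewrite sum_ffunE ffunE rmorph_sum mulr_suml; apply: eq_bigr => i _.
  have [[_ _ PhiE _] _] := H i; rewrite ffunE PhiE.
  by rewrite -mul_mpolyC /= tofracM -mulrA.
move=> x v k kv; rewrite polyform_linear_combination big1 // => i _.
by have [[_ _ _ eP] _] := H i; rewrite (eP _ _ _ kv) mulr0.
Qed.

Lemma contains_no_component_prod F N (g : 'I_N -> hpoly C n) (S : pred 'I_N) :
  (forall i, contains_no_component F (g i)) -> contains_no_component F (\prod_(i | S i) g i).
Proof.
move=> H; apply: (big_ind (contains_no_component F)) => //; last exact: contains_no_componentM.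
move=> Z [_ [[x Zx] _] _] /(_ x Zx); rewrite -mpolyC1 pevalC => /eqP.
by rewrite oner_eq0.
Qed.

Lemma common_denominator F N (Phi : 'I_N -> qform C n q)
    (P : 'I_N -> {ffun multi_index n q -> hpoly C n}) (g : 'I_N -> hpoly C n) :
  (forall i, form_on F (Phi i) (P i) (g i)) ->
  exists Q : 'I_N -> {ffun multi_index n q -> hpoly C n}, let G := \prod_i g i in
    [/\ forall i, form_on F (Phi i) (Q i) G,
        forall i x, peval G x != 0 -> peval (g i) x != 0 &
        forall i x v, peval G x != 0 -> form_at (Q i) G x v = form_at (P i) (g i) x v].
Proof.
move=> H; pose h i := \prod_(j | j != i) g j.
have gh i : \prod_j g j = g i * h i by rewrite (bigD1 i).
exists (fun i => [ffun I => P i I * h i]); split=> [i|i x|i x v].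
- rewrite (gh i); have h0 : h i != 0.
    by apply/prodf_neq0 => j _; have [[]] := H j.
  have [k hk] : exists k, homogeneous k (h i).
    rewrite /h; elim/big_rec: _ => [|j a ji [k hk]].
      by exists 0%N; rewrite -mpolyC1; apply: homogeneousC.
    have [[_ [e [hg _]] _ _] _] := H j.
    by exists (e + q + k)%N; apply: homogeneousM.
  apply: form_on_mul hk h0 _ (H i).
  by apply: contains_no_component_prod => j; have [] := H j.
- by rewrite (gh i) pevalM mulf_eq0 negb_or => /andP[].
rewrite (gh i) pevalM mulf_eq0 negb_or => /andP[_ hx].
exact: form_at_mul.
Qed.

Lemma null_form_combination F Phi Phi' a :
  null_form_on F Phi -> null_form_on F Phi' -> null_form_on F (a *: Phi + Phi').
Proof.
move=> [P [g [H NP]]] [P' [g' [H' NP']]].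
pose T (A : Type) (u w : A) (i : 'I_2) := if i == ord0 then u else w.
have HT i : form_on F (T _ Phi Phi' i) (T _ P P' i) (T _ g g' i).
  by rewrite /T; case: ifP.
have [Q [HQ gQ fQ]] := common_denominator HT.
exists [ffun I => \sum_i T _ a 1 i *: Q i I], (\prod_i T _ g g' i); split.
  have := form_on_linear_combination (T _ a 1) (ltn0Sn _) HQ.
  by rewrite !big_ord_recl !big_ord0 /T /= addr0 scale1r.
move=> x v sx gx dx; rewrite /form_at polyform_linear_combination mulr_suml big1 // => i _.
rewrite -mulrA -[_ / _]/(form_at (Q i) _ x v) fQ //.
have := gQ i x gx; rewrite /T; case: ifP => _ gix.
  by rewrite NP ?mulr0.
by rewrite NP' ?mulr0.
Qed.

End PolynomialForms.

(** * Dimension of a quotient *)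
Section QuotientDimension.
Variables (C : numClosedFieldType) (W : lmodType C) (U N : set W).
Hypothesis Nlin : forall a x y, N x -> N y -> N (a *: x + y).

Definition independent_modulo m (e : 'I_m -> W) :=
  forall c : 'rV[C]_m, N (\sum_i c ord0 i *: e i) -> c = 0.

Lemma modulo_scale a x : N x -> N (a *: x).
Proof. by move=> Nx; have := Nlin (a - 1) Nx Nx; rewrite scalerBl scale1r subrK. Qed.

(** The family spans modulo [N]: adjoining [w] to it creates a relation, in which [w]
has a nonzero coefficient. *)
Lemma quotient_dim_maximal m (e : 'I_m -> W) : (forall i, U (e i)) -> independent_modulo e ->
  (forall e' : 'I_m.+1 -> W, (forall i, U (e' i)) -> ~ independent_modulo e') ->
  quotient_dim U N m.
Proof.
move=> Ue Ie dep; exists e; split=> // w Uw.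
pose e' (i : 'I_m.+1) := if unlift ord0 i is Some j then e j else w.
have Ue' i : U (e' i) by rewrite /e'; case: unliftP => [j _|_].
have /existsNP[c /not_implyP[]] := dep e' Ue'.
rewrite big_ord_recl /e' unlift_none.
under eq_bigr do rewrite liftK.
move=> Nc c0; have cw : c ord0 ord0 != 0.
  apply/eqP => cw; apply: c0; move: Nc; rewrite cw scale0r add0r.
  have E i : c ord0 (lift ord0 i) = (\row_i c ord0 (lift ord0 i)) ord0 i by rewrite mxE.
  under eq_bigr do rewrite E.
  move=> /Ie /rowP cl; apply/rowP => i; rewrite mxE.
  by case: (unliftP ord0 i) => [j ->|->//]; have := cl j; rewrite !mxE.
exists (\row_i (- (c ord0 ord0)^-1 * c ord0 (lift ord0 i))); split=> [|c' Nc'].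
  have := modulo_scale (c ord0 ord0)^-1 Nc.
  rewrite scalerDr scalerA mulVf // scale1r scaler_sumr.
  suff -> : \sum_i (c ord0 ord0)^-1 *: (c ord0 (lift ord0 i) *: e i) =
    - \sum_i (\row_i (- (c ord0 ord0)^-1 * c ord0 (lift ord0 i))) ord0 i *: e i by [].
  by rewrite -sumrN; apply: eq_bigr => i _; rewrite mxE mulNr scaleNr opprK scalerA.
set c1 := \row_i _; apply/eqP; rewrite -subr_eq0; apply/eqP/Ie.
have Nc1 : N (w - \sum_i c1 ord0 i *: e i).
  have := modulo_scale (c ord0 ord0)^-1 Nc.
  rewrite scalerDr scalerA mulVf // scale1r scaler_sumr.
  suff -> : \sum_i (c ord0 ord0)^-1 *: (c ord0 (lift ord0 i) *: e i) =
    - \sum_i c1 ord0 i *: e i by [].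
  by rewrite -sumrN; apply: eq_bigr => i _; rewrite mxE mulNr scaleNr opprK scalerA.
have := Nlin (-1) Nc1 Nc'; rewrite scaleN1r opprB subrKA -sumrB.
congr (N _); apply: eq_bigr => i _.
by rewrite -scalerBl !mxE.
Qed.

(** An independent family of maximal length is a basis. *)
Lemma quotient_dim_bounded b :
  (forall e : 'I_b.+1 -> W, (forall i, U (e i)) -> ~ independent_modulo e) ->
  exists2 m, quotient_dim U N m & (m <= b)%N.
Proof.
move=> dep; pose P m := `[< exists2 e : 'I_m -> W, forall i, U (e i) & independent_modulo e >].
have P0 : exists m, P m.
  exists 0%N; apply/asboolP; exists (fun=> 0) => [[]//|c _].
  by apply/rowP => -[].
have Pb m : P m -> (m <= b)%N.
  move=> /asboolP[e Ue Ie]; rewrite leqNgt; apply/negP => bm.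
  apply: (dep (e \o widen_ord bm)) => [i|c Nc]; first exact: Ue.
  pose c' : 'rV_m := \row_i (if insub (val i) is Some j then c ord0 j else 0).
  have c'E j : c' ord0 (widen_ord bm j) = c ord0 j by rewrite mxE /= valK.
  suff /Ie c'0 : N (\sum_i c' ord0 i *: e i).
    by apply/rowP => j; rewrite -c'E c'0 !mxE.
  rewrite (bigID (fun i : 'I_m => (i < b.+1)%N)) /= [X in _ + X]big1 ?addr0.
    rewrite (big_ord_narrow bm).
    by under eq_bigr do rewrite c'E.
  by move=> i ib; rewrite mxE insubN // scale0r.
case: (ex_maxnP P0 Pb) => m /asboolP[e Ue Ie] maxm; exists m; last first.
  by apply: Pb; apply/asboolP; exists e.
apply: quotient_dim_maximal Ue Ie _ => e' Ue' Ie'.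
by have /maxm : P m.+1 by [apply/asboolP; exists e']; rewrite ltnn.
Qed.

End QuotientDimension.

(** * Limits and differentiability *)
Section Continuity.

Lemma near_forall (T : Type) (G : set_system T) (FG : Filter G) (I : finType) (P : I -> T -> Prop) :
  (forall i, \forall x \near G, P i x) -> \forall x \near G, forall i, P i x.
Proof. exact: (@filter_forall T I (fun i => [set x | P i x]) G FG). Qed.

Lemma cvg_matrix (K : numFieldType) (T : Type) (G : set_system T) {FG : Filter G} m n
    (f : T -> 'M[K]_(m, n)) (a : 'M[K]_(m, n)) :
  (forall i j, f x i j @[x --> G] --> a i j) -> f x @[x --> G] --> a.
Proof.
move=> H A /nbhs_ballP[e /= e0 Ae].
have : \forall x \near G, forall ij : 'I_m * 'I_n, ball (a ij.1 ij.2) e (f x ij.1 ij.2).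
  apply: filter_forall => -[i j] /=; apply: H; exact: nbhsx_ballx.
by apply: filterS => x Hx; apply: Ae; split=> // i j; apply: (Hx (i, j)).
Qed.

Lemma cvg_sum_seq (K : numFieldType) (V : normedModType K) (T : Type) (G : set_system T)
    {FG : Filter G} (I : Type) (r : seq I) (f : I -> T -> V) (a : I -> V) :
  (forall i, f i x @[x --> G] --> a i) ->
  \sum_(i <- r) f i x @[x --> G] --> \sum_(i <- r) a i.
Proof.
move=> H; elim: r => [|i r IHr].
  by rewrite big_nil; under eq_fun do rewrite big_nil; apply: cvg_cst.
rewrite big_cons; under eq_fun do rewrite big_cons.
by apply: cvgD.
Qed.

Lemma cvg_prod_seq (K : numFieldType) (T : Type) (G : set_system T)
    {FG : Filter G} (I : Type) (r : seq I) (f : I -> T -> K) (a : I -> K) :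
  (forall i, f i x @[x --> G] --> a i) ->
  \prod_(i <- r) f i x @[x --> G] --> \prod_(i <- r) a i.
Proof.
move=> H; elim: r => [|i r IHr].
  by rewrite big_nil; under eq_fun do rewrite big_nil; apply: cvg_cst.
rewrite big_cons; under eq_fun do rewrite big_cons.
by apply: cvgM.
Qed.

Lemma cvg_exp (K : numFieldType) (T : Type) (G : set_system T)
    {FG : Filter G} (f : T -> K) (a : K) k :
  f x @[x --> G] --> a -> f x ^+ k @[x --> G] --> a ^+ k.
Proof.
move=> H; elim: k => [|k IHk].
  by rewrite expr0; under eq_fun do rewrite expr0; apply: cvg_cst.
by rewrite exprS; under eq_fun do rewrite exprS; apply: cvgM.
Qed.

(** A first order expansion whose coefficients depend continuously on the point: the
variation of the coefficients contributes a term of second order. *)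
Lemma differentiable_expansion (K : numFieldType) (V W : normedModType K) (f : V -> W) (t : V)
    (I : finType) (l : I -> {linear V -> K}) (u : I -> V -> W) :
  (forall k, continuous (l k : V -> K)) -> (forall k, {for t, continuous (u k)}) ->
  (\forall s \near t, f s = f t + \sum_k l k (s - t) *: u k s) ->
  differentiable f t.
Proof.
move=> lc uc fE; pose df0 (v : V) : W := \sum_k l k v *: u k t.
have df_lin : linear df0.
  move=> c v w; rewrite /df0 scaler_sumr -big_split /=; apply: eq_bigr => k _.
  by rewrite linearP scalerDl scalerA.
pose dfM := GRing.isLinear.Build _ _ _ _ _ df_lin.
pose df : {linear V -> W} := HB.pack df0 dfM.
have df_cont : continuous df.
  move=> v; apply: cvg_sum_seq => k; apply: cvgZr_tmp; exact: lc.
have fdf : f \o shift t = cst (f t) + df +o_ (0 : V) id.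
  apply/eqaddoP => _/posnumP[e].
  have Hk k : exists2 c, c > 0 & forall v, `|l k v| <= c * `|v| := linear_lipschitz (lc k).
  have Huk k : \forall h \near (0 : V), `|l k h *: (u k (h + t) - u k t)| <= e%:num / #|I|.+1%:R * `|h|.
    have [c c0 lk] := Hk k.
    have e'0 : 0 < e%:num / #|I|.+1%:R / c by rewrite !divr_gt0 // ltr0n.
    have : \forall s \near t, `|u k t - u k s| < e%:num / #|I|.+1%:R / c.
      by move/cvgrPdist_lt: (uc k); apply.
    rewrite (near_shift 0 t) /= subr0; apply: filterS => h /= hu.
    rewrite normrZ distrC; apply: le_trans (ler_pM _ _ (lk h) (ltW hu)) _ => //.
    by rewrite mulrC mulrA divfK ?gt_eqF.
  have := fE; rewrite (near_shift 0 t) /= subr0.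
  have HA : \forall h \near (0 : V), forall k, `|l k h *: (u k (h + t) - u k t)| <= e%:num / #|I|.+1%:R * `|h|.
    exact: filter_forall.
  move: HA; apply: filterS2 => h Hh /=; rewrite addrK => fh.
  have -> : (f \o shift t - (cst (f t) + df)) h = \sum_k l k h *: (u k (h + t) - u k t).
    rewrite -[LHS]/(f (h + t) - (f t + df0 h)) fh opprD addrACA subrr add0r -sumrB.
    by apply: eq_bigr => k _; rewrite scalerBr.
  apply: le_trans (ler_norm_sum _ _ _) _.
  apply: (@le_trans _ _ (\sum_(k : I) e%:num / #|I|.+1%:R * `|h|)).
    by apply: ler_sum.
  have -> : \sum_(k : I) e%:num / #|I|.+1%:R * `|h| = #|I|%:R * (e%:num / #|I|.+1%:R * `|h|).
    by rewrite sumr_const mulr_natl.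
  rewrite mulrA; apply: ler_wpM2r => //.
  by rewrite mulrCA ler_piMr // ler_pdivrMr ?ltr0n // mul1r ler_nat.
apply/diff_locallyP; rewrite (diff_unique df_cont fdf); split=> //.
Qed.

Lemma mx_coord_linear (K : numFieldType) m n (i : 'I_m) (j : 'I_n) :
  exists l : {linear 'M[K]_(m, n) -> K}, (forall M, l M = M i j) /\ continuous (l : _ -> K).
Proof.
have @f : {linear 'M[K]_(m, n) -> K}.
  by exists (fun N : 'M[K]_(_, _) => N i j); do 2![eexists]; do ?[constructor];
     rewrite ?mxE// => ? *; rewrite ?mxE//; move=> ?; rewrite !mxE.
by exists f; split=> //; apply: coord_continuous.
Qed.

Variables (C : numClosedFieldType) (n : nat).

Lemma peval_continuous (G : hpoly C n) : continuous (peval G : 'rV[C]_(n.+2) -> C).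
Proof.
elim/mpoly_ring_ind: G => [c|i|a b IHa IHb|a b IHa IHb] x.
- have -> : peval (mpolyC n.+2 c) = cst c by apply/funext => y; rewrite pevalC.
  exact: cst_continuous.
- have -> : peval (mpolyX C (mnm1 i)) = fun y : 'rV[C]_(n.+2) => y ord0 i.
    by apply/funext => y; rewrite pevalX.
  exact: coord_continuous.
- have -> : peval (a + b) = fun y => peval a y + peval b y.
    by apply/funext => y; rewrite pevalD.
  exact: cvgD (IHa x) (IHb x).
- have -> : peval (a * b) = fun y => peval a y * peval b y.
    by apply/funext => y; rewrite pevalM.
  exact: cvgM (IHa x) (IHb x).
Qed.

Lemma cvg_peval (T : Type) (G : set_system T) {FG : Filter G} (F : hpoly C n) (f : T -> 'rV[C]_(n.+2)) a :
  f x @[x --> G] --> a -> peval F (f x) @[x --> G] --> peval F a.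
Proof. by move=> fa; apply: continuous_cvg => //; apply: peval_continuous. Qed.

(** Hadamard's lemma, proved along the ring operations. *)
Lemma peval_difference (G : hpoly C n) (b : 'rV[C]_(n.+2)) :
  exists Q : 'I_n.+2 -> 'rV[C]_(n.+2) -> C,
    [/\ forall a, peval G a - peval G b = \sum_i (a ord0 i - b ord0 i) * Q i a,
        forall i, continuous (Q i) & forall i, Q i b = peval (mderiv i G) b].
Proof.
elim/mpoly_ring_ind: G => [c|j|F G [Q [QE Qc Qb]] [R [RE Rc Rb]]|F G [Q [QE Qc Qb]] [R [RE Rc Rb]]].
- exists (fun _ _ => 0); split=> [a|i a|i]; last by rewrite mderivC -mpolyC0 pevalC.
    by rewrite !pevalC subrr big1 // => i _; rewrite mulr0.
  exact: cst_continuous.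
- exists (fun i _ => (j == i)%:R); split=> [a|i a|i].
  + rewrite !pevalX (bigD1 j) //= eqxx mulr1 big1 ?addr0 // => i ij.
    by rewrite eq_sym (negbTE ij) mulr0.
  + exact: cst_continuous.
  + rewrite mderivX mnm1E; have [->|ij] := eqVneq j i; last by rewrite scale0r -mpolyC0 pevalC.
    have -> : mnm_sub (mnm1 i) (mnm1 i) = mnm0 by apply/mnmP => k; rewrite !mnmE subnn.
    by rewrite mpolyX0 scale1r -mpolyC1 pevalC.
- exists (fun i a => Q i a + R i a); split=> [a|i a|i].
  + rewrite !pevalD opprD addrACA QE RE -big_split /=; apply: eq_bigr => i _.
    by rewrite mulrDr.
  + exact: cvgD (Qc i a) (Rc i a).
  + by rewrite mderivD pevalD Qb Rb.
- exists (fun i a => Q i a * peval G a + peval F b * R i a); split=> [a|i a|i].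
  + rewrite !pevalM (_ : _ - _ = (peval F a - peval F b) * peval G a + peval F b * (peval G a - peval G b)); last by ring.
    rewrite QE RE mulr_suml mulr_sumr -big_split /=; apply: eq_bigr => i _; ring.
  + exact: cvgD (cvgM (Qc i a) (@peval_continuous G a))
      (cvgM (@cst_continuous _ _ (peval F b) a) (Rc i a)).
  + by rewrite mderivM pevalD !pevalM Qb Rb.
Qed.

End Continuity.

Arguments cvg_peval {C n T G FG} F [f a] _.

(** * Simple roots and their perturbation *)
Section Roots.
Variable C : numClosedFieldType.
Implicit Types (f : {poly C}).

(** Up to the leading coefficient, [f.[y]] is the product of the distances from [y] to
the [k] roots. *)
Lemma root_near f k y delta : size f = k.+1 -> 0 < delta ->
  `|f.[y] / lead_coef f| < delta ^+ k -> exists2 z, f.[z] = 0 & `|z - y| < delta.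
Proof.
move=> sf d0 fy; apply: contrapT => H.
have f0 : f != 0 by rewrite -size_poly_eq0 sf.
have [r Er] := closed_field_poly_normal f.
have sr : size r = k.
  by move: sf; rewrite Er size_scale ?lead_coef_eq0 // size_prod_XsubC => -[].
have rf z : z \in r -> f.[z] = 0.
  by move=> zr; apply/rootP; rewrite Er rootZ ?lead_coef_eq0 // root_prod_XsubC.
move: fy; rewrite {1}Er hornerZ mulrAC divff ?lead_coef_eq0 // mul1r.
rewrite horner_prod normr_prod -sr -[delta ^+ _]/(GRing.exp delta (size r)).
have -> : delta ^+ size r = \prod_(z <- r) delta by rewrite big_const_seq count_predT iter_mulr_1.
rewrite real_ltNge ?rpred_prod // => [|z _|z _]; rewrite ?normr_real ?gtr0_real //.
rewrite !big_seq ler_prod // => z zr; rewrite (ltW d0) /= hornerXsubC distrC.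
rewrite real_leNgt ?normr_real ?gtr0_real //.
by apply/negP => zy; apply: H; exists z; [exact: rf|].
Qed.

Section DistinctRoots.
Variables (f : {poly C}) (d : nat) (y : 'I_d -> C).
Hypotheses (sf : size f = d.+1) (yinj : injective y) (fy : forall j, f.[y j] = 0).

Let fE : f = lead_coef f *: \prod_(z <- [tuple y j | j < d]) ('X - z%:P).
Proof.
apply: all_roots_prod_XsubC; first by rewrite size_tuple sf.
  by apply/allP => z /mapP[j _ ->]; apply/rootP.
by rewrite uniq_rootsE map_inj_uniq ?enum_uniq.
Qed.

Let f0 : lead_coef f != 0. Proof. by rewrite lead_coef_eq0 -size_poly_eq0 sf. Qed.

Lemma distinct_roots_all z : f.[z] = 0 -> exists j, z = y j.
Proof.
move/rootP; rewrite fE rootZ // root_prod_XsubC => /mapP[j _ ->].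
by exists j.
Qed.

Lemma distinct_roots_simple j : f^`().[y j] != 0.
Proof.
have sep : separable_poly f.
  rewrite fE unlock derivZ coprimepZl // coprimepZr //.
  have := separable_prod_XsubC [tuple y j | j < d]; rewrite unlock => ->.
  by rewrite map_inj_uniq ?enum_uniq.
by move: sep; rewrite unlock => /coprimep_root; apply; apply/rootP.
Qed.

End DistinctRoots.

Lemma separating_radius (d : nat) (y : 'I_d -> C) : injective y ->
  exists2 delta, 0 < delta & forall i j, i != j -> delta * 2 <= `|y i - y j|.
Proof.
move=> yinj.
have H (ij : 'I_d * 'I_d) : \forall e \near (0 : C), ij.1 != ij.2 -> `|e| * 2 <= `|y ij.1 - y ij.2|.
  case: ij => i j /=; apply/nbhs_ballP.
  have [_|ij] := eqVneq i j; first by exists 1 => /=.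
  have r0 : 0 < `|y i - y j| / 2.
    by rewrite divr_gt0 // normr_gt0 subr_eq0; apply: contraNneq ij => /yinj ->.
  exists (`|y i - y j| / 2) => // e.
  rewrite /ball /= sub0r normrN => /ltW He _.
  by rewrite -ler_pdivlMr.
have : \forall e \near (0 : C), forall ij : 'I_d * 'I_d, ij.1 != ij.2 -> `|e| * 2 <= `|y ij.1 - y ij.2|.
  exact: (@filter_forall C ('I_d * 'I_d)%type (fun ij e => ij.1 != ij.2 -> `|e| * 2 <= `|y ij.1 - y ij.2|) _ _ H).
move=> /nbhs_ballP[r /= r0 Hr]; exists (r / 2); first by rewrite divr_gt0.
move=> i j ij; have -> : r / 2 = `|r / 2| by rewrite ger0_norm // ltW // divr_gt0.
apply: (Hr (r / 2) _ (i, j) ij); rewrite /ball /= sub0r normrN ger0_norm ?ltW ?divr_gt0 //.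
by rewrite ltr_pdivrMr // ltr_pMr // ltr1n.
Qed.

End Roots.

Section MatrixLimits.
Variables (K : numFieldType) (T : Type) (G : set_system T).
Context {FG : Filter G}.

Lemma cvg_coord m n (f : T -> 'M[K]_(m, n)) (a : 'M[K]_(m, n)) i j :
  f x @[x --> G] --> a -> f x i j @[x --> G] --> a i j.
Proof.
exact: (@continuous_cvg T _ _ G FG f (fun M : 'M[K]_(m, n) => M i j) a (@coord_continuous K m n i j a)).
Qed.

Lemma cvg_mulmx m n k (f : T -> 'M[K]_(m, n)) (g : T -> 'M[K]_(n, k)) (a : 'M[K]_(m, n)) (b : 'M[K]_(n, k)) :
  f x @[x --> G] --> a -> g x @[x --> G] --> b -> f x *m g x @[x --> G] --> a *m b.
Proof.
move=> fa gb; apply: cvg_matrix => i j; rewrite mxE; under eq_fun do rewrite mxE.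
by apply: cvg_sum_seq => l; apply: cvgM; apply: cvg_coord.
Qed.

Lemma cvg_det n (f : T -> 'M[K]_n) (a : 'M[K]_n) : f x @[x --> G] --> a -> \det (f x) @[x --> G] --> \det a.
Proof.
move=> fa; apply: cvg_sum_seq => s; apply: cvgM; first exact: cvg_cst.
by apply: cvg_prod_seq => i; apply: cvg_coord.
Qed.

Lemma cvg_adj n (f : T -> 'M[K]_n) (a : 'M[K]_n) : f x @[x --> G] --> a -> \adj (f x) @[x --> G] --> \adj a.
Proof.
move=> fa; apply: cvg_matrix => i j; rewrite mxE; under eq_fun do rewrite mxE.
apply: cvgM; first exact: cvg_cst.
apply: cvg_det; apply: cvg_matrix => k l; rewrite !mxE; under eq_fun do rewrite !mxE.
exact: cvg_coord.
Qed.

End MatrixLimits.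

(** * Points of intersection with a moving line *)
Section LineSections.
Variables (C : numClosedFieldType) (n d : nat) (F : hpoly C n).
Hypothesis homF : homogeneous d F.
Local Notation vec := 'rV[C]_(n.+2).
Local Notation pair := 'M[C]_(2, n.+2).
Implicit Types (t s tau : pair).

Local Notation r0 t := (row (ord0 : 'I_2) t).
Local Notation r1 t := (row (ord_max : 'I_2) t).

Definition line_point t (z : C) : vec := r0 t + z *: r1 t.

Definition restriction t : {poly C} := on_line (r0 t ord0) (r1 t ord0) F.

Lemma horner_restriction t z : (restriction t).[z] = peval F (line_point t z).
Proof. exact: peval_on_line. Qed.

Lemma restriction_size t : peval F (r1 t) != 0 ->
  size (restriction t) = d.+1 /\ lead_coef (restriction t) = peval F (r1 t).
Proof.
move=> Ft; have [s1 s2] := on_line_homogeneous (r0 t) (r1 t) homF.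
have s3 : size (restriction t) = d.+1.
  apply/eqP; rewrite eqn_leq s1 ltnNge; apply: contra Ft => s3.
  by rewrite -s2 nth_default.
by split=> //; rewrite lead_coefE s3 s2.
Qed.

Lemma mul_pair (c : 'rV[C]_2) t : c *m t = c ord0 ord0 *: r0 t + c ord0 ord_max *: r1 t.
Proof.
have E : lift ord0 ord0 = ord_max :> 'I_2 by apply: val_inj.
by rewrite mulmx_sum_row big_ord_recl big_ord1 E.
Qed.

Lemma line_pointE t z : line_point t z = (\row_i (if i == ord0 then 1 else z)) *m t.
Proof. by rewrite mul_pair !mxE /= scale1r. Qed.

Lemma line_point_sub t z : (line_point t z <= t)%MS.
Proof. by rewrite line_pointE submxMl. Qed.

Lemma rank2_inverse t : \rank t = 2 -> exists B : 'M[C]_(n.+2, 2), t *m B = 1%:M.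
Proof. by move=> rt; apply/row_freeP; rewrite /row_free rt. Qed.

Lemma det_rank2 t (B : 'M[C]_(n.+2, 2)) : \det (t *m B) != 0 -> \rank t = 2.
Proof.
move=> dt; apply/eqP; rewrite eqn_leq rank_leq_row /=.
have := mxrankM_maxl t B; rewrite mxrank_unit //.
by rewrite unitmxE unitfE.
Qed.

Lemma combination_eq0 t (c : 'rV[C]_2) : \rank t = 2 -> c *m t = 0 -> c = 0.
Proof.
move=> /rank2_inverse[B tB] /(congr1 (mulmx^~ B)).
by rewrite -mulmxA tB mulmx1 mul0mx.
Qed.

Lemma line_point_neq0 t z : \rank t = 2 -> line_point t z != 0.
Proof.
move=> rt; rewrite line_pointE; apply/eqP => /(combination_eq0 rt) /rowP /(_ ord0).
by rewrite !mxE eqxx => /eqP; rewrite oner_eq0.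
Qed.

Lemma line_point_inj t z w c : \rank t = 2 -> line_point t z = c *: line_point t w -> z = w.
Proof.
move=> rt; rewrite !line_pointE scalemxAl => /eqP; rewrite -subr_eq0 -mulmxBl => /eqP.
move=> /(combination_eq0 rt) /rowP E.
have := E ord0; have := E ord_max; rewrite !mxE /= mulr1 => /eqP.
rewrite subr_eq0 => /eqP -> /eqP; rewrite subr_eq0 => /eqP <-.
by rewrite mul1r.
Qed.

(** The point at infinity [row ord_max t] of the line is off the hypersurface. *)
Lemma line_pointP t (x : vec) : peval F (r1 t) != 0 -> x != 0 -> peval F x = 0 ->
  (x <= t)%MS -> exists2 c, c != 0 & exists z, x = c *: line_point t z.
Proof.
move=> Ft x0 Fx /submxP[c Ex]; rewrite mul_pair in Ex.
have c0 : c ord0 ord0 != 0.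
  apply/eqP => c0; move: Fx x0; rewrite Ex c0 scale0r add0r (peval_scale _ _ homF).
  move/eqP; rewrite mulf_eq0 (negbTE Ft) orbF expf_eq0 => /andP[_ /eqP ->].
  by rewrite scale0r eqxx.
exists (c ord0 ord0) => //; exists (c ord0 ord_max / c ord0 ord0).
by rewrite Ex /line_point scalerDr scalerA mulrCA divff ?mulr1.
Qed.

Section AroundALine.
Variables (t0 : pair) (y : 'I_d -> C).
Hypotheses (rt0 : \rank t0 = 2) (yinj : injective y) (Ft0 : peval F (r1 t0) != 0).
Hypothesis Fy : forall j, peval F (line_point t0 (y j)) = 0.

Let cvg_r t (i : 'I_2) : row i s @[s --> t] --> row i t.
Proof.
apply: (@cvg_matrix _ _ _ (nbhs_filter t)) => k l; rewrite mxE; under eq_fun do rewrite mxE.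
exact: coord_continuous.
Qed.

Let cvg_lp t (w : pair -> C) c : w s @[s --> t] --> c -> line_point s (w s) @[s --> t] --> line_point t c.
Proof. by move=> wc; exact: cvgD (@cvg_r t ord0) (cvgZ wc (@cvg_r t ord_max)). Qed.

Let quotient_near t z eps k : 0 < eps -> peval F (r1 t) != 0 -> peval F (line_point t z) = 0 ->
  \forall s \near t, `|peval F (line_point s z) / peval F (r1 s)| < eps ^+ k.
Proof.
move=> e0 Ft Fz; have ek : 0 < eps ^+ k by rewrite exprn_gt0.
have : peval F (line_point s z) / peval F (r1 s) @[s --> t] --> peval F (line_point t z) / peval F (r1 t).
  have H1 : line_point s z @[s --> t] --> line_point t z by exact: (@cvg_lp t (fun=> z) z (@cvg_cst _ z _ _ (nbhs_filter t))).
  exact: cvgM (cvg_peval F H1) (cvgV Ft (cvg_peval F (@cvg_r t ord_max))).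
move=> /cvgrPdist_lt/(_ _ ek); apply: filterS => s.
by rewrite Fz mul0r sub0r normrN.
Qed.

Let nonvanishing_near t : peval F (r1 t) != 0 -> \forall s \near t, peval F (r1 s) != 0.
Proof.
move=> Ft; have Fc : peval F (r1 s) @[s --> t] --> peval F (r1 t) by exact: cvg_peval (@cvg_r t ord_max).
exact: cvgr_neq0 Fc Ft.
Qed.

(** The implicit function theorem for simple roots. Continuity comes from the
perturbation of simple roots; differentiability from Hadamard's lemma, which turns
the equation of [Y j] into an expansion of [line_point s (Y j s)] with continuous
coefficients. *)
Lemma sections_exist : exists Y : 'I_d -> pair -> C,
  [/\ forall j, Y j t0 = y j, forall j, {for t0, continuous (Y j)} &
      intersection_points F t0 (fun j t => line_point t (Y j t))].
Proof.
have [delta del0 sep] := separating_radius yinj.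
pose root_in j t z := (restriction t).[z] = 0 /\ `|z - y j| < delta.
pose Y j t := xget 0 [set z | root_in j t z].
have [B tB] := rank2_inverse rt0.
pose good t := [/\ peval F (r1 t) != 0, \rank t = 2 & forall j, exists z, root_in j t z].
have good_near : \forall t \near t0, good t.
  have H1 := nonvanishing_near Ft0.
  have H2 : \forall t \near t0, \det (t *m B) != 0.
    have dc : \det (s *m B) @[s --> t0] --> \det (t0 *m B).
      have c1 : s @[s --> t0] --> t0 by exact: cvg_id.
      have c2 : B @[s --> t0] --> B by exact: (@cvg_cst _ B _ _ (nbhs_filter t0)).
      exact: cvg_det (cvg_mulmx c1 c2).
    have d0 : \det (t0 *m B) != 0 by rewrite tB det1 oner_eq0.
    exact: cvgr_neq0 dc d0.
  have H3 : \forall t \near t0, forall j, `|peval F (line_point t (y j)) / peval F (r1 t)| < delta ^+ d.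
    exact: (near_forall (nbhs_filter t0) (fun j => @quotient_near t0 (y j) delta d del0 Ft0 (Fy j))).
  apply: filterS3 H1 H2 H3 => t Ft dt Ht; split=> // [|j]; first exact: det_rank2 dt.
  have [st lt] := restriction_size Ft.
  have [|z fz zy] := @root_near C (restriction t) d (y j) delta st del0.
    by rewrite horner_restriction lt.
  by exists z.
have YP t j : good t -> root_in j t (Y j t).
  by move=> [_ _ /(_ j) Hz]; apply: (xgetPex 0 Hz).
have Yinj t : good t -> injective (Y^~ t).
  move=> gt i j E; apply/eqP; apply: contraT => ij.
  have [_ Yi] := YP t i gt; have [_ Yj] := YP t j gt.
  have H : delta * 2 <= `|Y i t - y i| + `|Y j t - y j|.
    by apply: le_trans (sep _ _ ij) _; rewrite E [`|_ - y i|]distrC ler_distD.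
  have := le_lt_trans H (ltrD Yi Yj).
  by rewrite mulr2n mulrDr mulr1 ltxx.
have Yall t z : good t -> (restriction t).[z] = 0 -> exists j, z = Y j t.
  move=> gt; have [Ft _ _] := gt.
  apply: (distinct_roots_all (proj1 (restriction_size Ft)) (Yinj t gt)) => j.
  by case: (YP t j gt).
have Yuniq t j z : good t -> root_in j t z -> z = Y j t.
  move=> gt [fz zy]; have [k Ek] := Yall t z gt fz; rewrite Ek.
  have [_ Yk] := YP t k gt; rewrite -Ek in Yk.
  suff -> : k = j by [].
  apply/eqP; apply: contraT => kj.
  have H : delta * 2 <= `|z - y k| + `|z - y j|.
    by apply: le_trans (sep _ _ kj) _; rewrite [`|_ - y k|]distrC ler_distD.
  have := le_lt_trans H (ltrD Yk zy).
  by rewrite mulr2n mulrDr mulr1 ltxx.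
have Y0 j : Y j t0 = y j.
  apply/esym/Yuniq; first exact: nbhs_singleton good_near.
  by split; [rewrite horner_restriction|rewrite subrr normr0].
have good_near2 := @filterI _ _ (nbhs_filter t0) _ _ good_near (near_join good_near).
have Ycont t j : good t -> (\forall s \near t, good s) -> {for t, continuous (Y j)}.
  move=> gt gtn; have [Ft _ _] := gt; have [Yr Yd] := YP t j gt.
  apply/(@cvgrPdist_lt _ _ _ _ (nbhs_filter t)) => eps e0; pose e2 := delta - `|Y j t - y j|.
  have e20 : 0 < e2 by rewrite subr_gt0.
  have e12 : 0 < eps + e2 by rewrite addr_gt0.
  (* Smaller than both [eps] and [e2]. *)
  pose e' := eps * e2 / (eps + e2).
  have e'0 : 0 < e' by rewrite divr_gt0 // mulr_gt0.
  have e'1 : e' < eps by rewrite ltr_pdivrMr // ltr_pM2l // ltrDr.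
  have e'2 : e' < e2 by rewrite ltr_pdivrMr // mulrC ltr_pM2l // ltrDl.
  have Fz : peval F (line_point t (Y j t)) = 0 by rewrite -horner_restriction.
  have := @quotient_near t (Y j t) e' d e'0 Ft Fz.
  move: gtn; apply: (@filterS2 _ _ (nbhs_filter t)) => s gs Hs.
  have [Fs _ _] := gs; have [ss ls] := restriction_size Fs.
  have [|z fz zy] := @root_near C (restriction s) d (Y j t) e' ss e'0.
    by rewrite horner_restriction ls.
  have -> : Y j s = z.
    apply/esym/Yuniq => //; split=> //.
    rewrite -(subrK (Y j t) z) -addrA; apply: le_lt_trans (ler_normD _ _) _.
    by rewrite -(subrK `|Y j t - y j| delta) ltrD2r (lt_trans zy).
  by rewrite distrC (lt_trans zy).
have Ydiff t j : good t -> (\forall s \near t, good s) ->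
    differentiable (fun s => line_point s (Y j s)) t.
  move=> gt gtn; have [Ft _ _] := gt; have Yc := Ycont t j gt gtn.
  pose xi s := line_point s (Y j s).
  have xic : xi s @[s --> t] --> xi t by apply: cvg_lp.
  have [Q [QE Qc Qb]] := peval_difference F (xi t).
  have Qx i : Q i (xi s) @[s --> t] --> Q i (xi t).
    exact: (@continuous_cvg _ _ _ _ (nbhs_filter t) xi (Q i) (xi t) (Qc i (xi t)) xic).
  pose D s := \sum_i (r1 t) ord0 i * Q i (xi s).
  have Dc : D s @[s --> t] --> D t.
    apply: (@cvg_sum_seq _ _ _ _ (nbhs_filter t)) => i.
    exact: cvgM (@cvg_cst _ ((r1 t) ord0 i) _ _ (nbhs_filter t)) (Qx i).
  have Dt : D t != 0.
    have -> : D t = (restriction t)^`().[Y j t].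
      by rewrite horner_deriv_on_line; apply: eq_bigr => i _; rewrite Qb mulrC.
    apply: (distinct_roots_simple (proj1 (restriction_size Ft)) (Yinj t gt)) => k.
    by case: (YP t k gt).
  have Dn : \forall s \near t, D s != 0 by exact: cvgr_neq0 Dc Dt.
  have [l Hl] := choice (fun ij : 'I_2 * 'I_n.+2 => @mx_coord_linear C 2 n.+2 ij.1 ij.2).
  (* The variation of the coordinate [i], projected along the line to the kernel of the
     difference quotients [Q]. *)
  pose w i s : vec := delta_mx ord0 i - (Q i (xi s) / D s) *: r1 t.
  have wc i : {for t, continuous (w i)}.
    have c1 := @cvg_cst _ (delta_mx ord0 i : vec) _ _ (nbhs_filter t).
    have c2 := @cvg_cst _ (r1 t : vec) _ _ (nbhs_filter t).
    exact: cvgB c1 (cvgZ (cvgM (Qx i) (cvgV Dt Dc)) c2).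
  pose u (ij : 'I_2 * 'I_n.+2) s : vec := (if ij.1 == ord0 then 1 else Y j s) *: w ij.2 s.
  apply: (@differentiable_expansion _ _ _ xi t _ l u) => [ij|[a i]|].
  - by case: (Hl ij).
  - case Ea : (a == ord0).
      have -> : u (a, i) = w i by apply/funext => s; rewrite /u /= Ea scale1r.
      exact: wc.
    have -> : u (a, i) = fun s => Y j s *: w i s by apply/funext => s; rewrite /u /= Ea.
    exact: cvgZ Yc (wc i).
  move: Dn gtn; apply: (@filterS2 _ _ (nbhs_filter t)) => s Ds gs.
  have [Ys _] := YP s j gs; have [Yt _] := YP t j gt.
  rewrite horner_restriction -/(xi s) in Ys; rewrite horner_restriction -/(xi t) in Yt.
  pose A i := (line_point (s - t) (Y j s)) ord0 i.
  have xiE : xi s - xi t = line_point (s - t) (Y j s) + (Y j s - Y j t) *: r1 t.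
    rewrite /xi /line_point !linearB /=.
    by apply/rowP => i; rewrite !mxE; ring.
  have SA : \sum_i A i * Q i (xi s) = - ((Y j s - Y j t) * D s).
    apply/eqP; rewrite -addr_eq0 /D mulr_sumr -big_split /=.
    have E0 := QE (xi s); rewrite Ys Yt subrr in E0; rewrite [X in _ == X]E0; apply/eqP.
    apply: eq_bigr => i _; have -> : xi s ord0 i - xi t ord0 i = A i + (Y j s - Y j t) * (r1 t) ord0 i.
      by rewrite /A /xi /line_point !mxE; ring.
    by ring.
  have -> : \sum_k l k (s - t) *: u k s = \sum_i A i *: w i s.
    transitivity (\sum_(k : 'I_2 * 'I_n.+2) l (k.1, k.2) (s - t) *: u (k.1, k.2) s).
      by apply: eq_bigr => -[].
    rewrite -(pair_bigA _ (fun a i => l (a, i) (s - t) *: u (a, i) s)) /=.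
    rewrite exchange_big /=; apply: eq_bigr => i _.
    rewrite big_ord_recl big_ord1 /u /= !(proj1 (Hl _)) /= scale1r scalerA -scalerDl.
    congr (_ *: _); rewrite /A !mxE.
    have -> : lift ord0 ord0 = ord_max :> 'I_2 by apply: val_inj.
    by ring.
  have -> : \sum_i A i *: w i s = line_point (s - t) (Y j s) + (Y j s - Y j t) *: r1 t.
    rewrite (eq_bigr (fun i => A i *: delta_mx ord0 i - (A i * Q i (xi s) / D s) *: r1 t)); last first.
      by move=> i _; rewrite scalerBr scalerA mulrA.
    rewrite sumrB -scaler_suml -mulr_suml SA mulNr mulfK // scaleNr opprK.
    by congr (_ + _); rewrite [RHS]row_sum_delta.
  by rewrite -xiE addrC subrK.
exists Y; split=> // [j|].
  exact: Ycont (nbhs_singleton good_near) good_near.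
apply: filterS good_near2 => t [gt gtn]; have [Ft rt _] := gt; split=> [j|j|j k jk|x x0].
- exact: Ydiff.
- exact: line_point_neq0.
- apply/negP => /submxP[c Ec]; rewrite [c]mx11_scalar mul_scalar_mx in Ec.
  by case/eqP: jk; apply: (Yinj t gt); apply: line_point_inj Ec.
split=> [[Fx /(line_pointP Ft x0 Fx)[c c0 [z Ex]]]|[j xj]].
  have [|j zj] := Yall t z gt.
    rewrite horner_restriction; move: Fx; rewrite Ex (peval_scale _ _ homF) => /eqP.
    by rewrite mulf_eq0 expf_eq0 (negbTE c0) andbF => /eqP.
  by exists j; rewrite Ex zj scalemx_sub.
have [Yr _] := YP t j gt; rewrite horner_restriction in Yr.
split; last exact: submx_trans xj (line_point_sub _ _).
by have /submxP[c ->] := xj; rewrite [c]mx11_scalar mul_scalar_mx (peval_scale _ _ homF) Yr mulr0.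
Qed.

End AroundALine.
End LineSections.

(** * Tangent vectors of the sections *)
Section TangentVectors.
Variables (C : numClosedFieldType) (n : nat) (F : hpoly C n).
Local Notation vec := 'rV[C]_(n.+2).
Local Notation pair := 'M[C]_(2, n.+2).
Variables (xi : pair -> vec) (t0 : pair).
Hypotheses (rt0 : \rank t0 = 2) (dxi : differentiable xi t0).
Hypothesis (xi_near : \forall t \near t0, (xi t <= t)%MS /\ peval F (xi t) = 0).

Let g (tau : pair) (h : C) : pair := h *: tau + t0.

Let g_cvg tau : g tau h @[h --> 0^'] --> t0.
Proof.
have idc : h @[h --> (0 : C)^'] --> (0 : C) by apply: cvg_within.
have c1 := @cvg_cst _ tau _ _ (dnbhs_filter (0 : C)).
have c2 := @cvg_cst _ t0 _ _ (dnbhs_filter (0 : C)).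
have := cvgD (cvgZ idc c1) c2; rewrite scale0r add0r; exact.
Qed.

Let g_near tau : \forall h \near (0 : C)^', (xi (g tau h) <= g tau h)%MS /\ peval F (xi (g tau h)) = 0.
Proof. exact: (@g_cvg tau _ xi_near). Qed.

Let xig_cvg tau : xi (g tau h) @[h --> 0^'] --> xi t0.
Proof.
exact: (@continuous_cvg _ _ _ _ (dnbhs_filter (0 : C)) (g tau) xi t0 (differentiable_continuous dxi) (@g_cvg tau)).
Qed.

Let quotient_cvg tau : h^-1 *: (xi (g tau h) - xi t0) @[h --> 0^'] --> ('d xi t0 tau : vec).
Proof. by rewrite -(deriveE tau dxi); apply: (diff_derivable (v := tau) dxi). Qed.

(** A section is a combination [c t *m t] of the rows of the line, with differentiable
coefficients; the first term below is the derivative of the coefficients. *)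
Lemma section_tangent : exists2 s : 'rV[C]_2, xi t0 = s *m t0 &
  forall tau, exists sigma : 'rV[C]_2, 'd xi t0 tau = sigma *m t0 + s *m tau.
Proof.
have [B tB] := rank2_inverse rt0.
have [xt0 _] := nbhs_singleton xi_near.
pose s := xi t0 *m B.
have st0 : s *m t0 = xi t0.
  by have /submxP[c Ec] := xt0; rewrite /s Ec -[c *m t0 *m B]mulmxA tB mulmx1.
exists s => // tau; set v : vec := 'd xi t0 tau.
(* The projection that kills the rows of [t0]. *)
pose K := 1%:M - B *m t0.
have t0K : t0 *m K = 0 by rewrite mulmxBr mulmx1 mulmxA tB mul1mx subrr.
pose M h := g tau h *m B.
have Bc := @cvg_cst _ B _ _ (dnbhs_filter (0 : C)).
have Mc : M h @[h --> 0^'] --> (1%:M : 'M[C]_2).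
  by rewrite -tB; exact: cvg_mulmx (@g_cvg tau) Bc.
have dc : \det (M h) @[h --> 0^'] --> (1 : C).
  by rewrite -(det1 C 2); exact: cvg_det Mc.
have adj1 : \adj (1%:M : 'M[C]_2) = 1%:M by rewrite -[LHS]mul1mx mul_mx_adj det1.
have ac : \adj (M h) @[h --> 0^'] --> (1%:M : 'M[C]_2).
  by rewrite -adj1; exact: cvg_adj Mc.
pose c h := (\det (M h))^-1 *: (xi (g tau h) *m B *m \adj (M h)).
have cc : c h @[h --> 0^'] --> s.
  have := cvgZ (cvgV (oner_neq0 C) dc) (cvg_mulmx (cvg_mulmx (@xig_cvg tau) Bc) ac).
  by rewrite invr1 scale1r mulmx1; exact.
have cE : \forall h \near (0 : C)^', xi (g tau h) = c h *m g tau h.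
  have dn : \forall h \near (0 : C)^', \det (M h) != 0 by exact: cvgr_neq0 dc (oner_neq0 C).
  move: dn (g_near tau); apply: (@filterS2 _ _ (dnbhs_filter (0 : C))) => h dh [/submxP[e Ee] _].
  rewrite {1}Ee; congr (_ *m _); rewrite /c Ee -(mulmxA e) -/(M h) -mulmxA mul_mx_adj.
  by rewrite mul_mx_scalar scalerA mulVf // scale1r.
clearbody c.
have lim1 : (h^-1 *: (xi (g tau h) - xi t0)) *m K @[h --> 0^'] --> v *m K.
  exact: cvg_mulmx (@quotient_cvg tau) (@cvg_cst _ K _ _ (dnbhs_filter (0 : C))).
have lim2 : c h *m tau *m K @[h --> 0^'] --> s *m tau *m K.
  exact: cvg_mulmx (cvg_mulmx cc (@cvg_cst _ tau _ _ (dnbhs_filter (0 : C)))) (@cvg_cst _ K _ _ (dnbhs_filter (0 : C))).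
have lim3 : (h^-1 *: (xi (g tau h) - xi t0)) *m K @[h --> 0^'] --> s *m tau *m K.
  apply: cvg_trans lim2; apply: near_eq_cvg.
  have h0 : \forall h \near (0 : C)^', h != 0 by exact: nbhs_dnbhs_neq.
  move: h0 cE; apply: (@filterS2 _ _ (dnbhs_filter (0 : C))) => h h0 Eh.
  rewrite Eh -st0 /g -[RHS]scalemxAl mulmxBl -[s *m t0 *m K]mulmxA t0K mulmx0 subr0.
  rewrite -[in RHS]mulmxA mulmxDl t0K addr0 -[in RHS]scalemxAl -[in RHS]scalemxAr.
  by rewrite scalerA mulVf // scale1r mulmxA.
have vK : v *m K = s *m tau *m K by apply: (cvg_unique _ lim1 lim3); exact: norm_hausdorff.
exists (v *m B - s *m tau *m B).
rewrite -[LHS](subrK (v *m B *m t0)) -[v in v - _]mulmx1 -mulmxA -mulmxBr -/K vK.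
by rewrite /K mulmxBr mulmx1 mulmxBl !mulmxA addrC addrA addrAC.
Qed.

Lemma section_dpoly tau : dpoly F (xi t0) ('d xi t0 tau) = 0.
Proof.
have [Q [QE Qc Qb]] := peval_difference F (xi t0).
pose T h := \sum_i (h^-1 *: (xi (g tau h) - xi t0)) ord0 i * Q i (xi (g tau h)).
have limT : T h @[h --> 0^'] --> dpoly F (xi t0) ('d xi t0 tau).
  have -> : dpoly F (xi t0) ('d xi t0 tau) = \sum_i ('d xi t0 tau : vec) ord0 i * Q i (xi t0).
    by apply: eq_bigr => i _; rewrite Qb mulrC.
  apply: (@cvg_sum_seq _ _ _ _ (dnbhs_filter (0 : C))) => i.
  have c1 := @cvg_coord _ _ _ (dnbhs_filter (0 : C)) _ _ _ _ ord0 i (@quotient_cvg tau).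
  have c2 := @continuous_cvg _ _ _ _ (dnbhs_filter (0 : C)) _ (Q i) (xi t0) (Qc i (xi t0)) (@xig_cvg tau).
  exact: cvgM c1 c2.
have T0 : T h @[h --> 0^'] --> (0 : C).
  apply: cvg_trans (@cvg_cst _ (0 : C) _ _ (dnbhs_filter (0 : C))); apply: near_eq_cvg.
  have [_ F0] := nbhs_singleton xi_near.
  move: (g_near tau); apply: (@filterS _ _ (dnbhs_filter (0 : C))) => h [_ Fh].
  have E := QE (xi (g tau h)); rewrite F0 Fh subrr in E.
  suff -> : T h = h^-1 * \sum_i (xi (g tau h) ord0 i - xi t0 ord0 i) * Q i (xi (g tau h)).
    by rewrite -E mulr0.
  by rewrite mulr_sumr; apply: eq_bigr => i _; rewrite !mxE mulrA.
by apply: (cvg_unique _ limT T0); exact: norm_hausdorff.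
Qed.

End TangentVectors.

(** * Determinants attached to a line *)
Section Brackets.
Variable K : fieldType.

Lemma det_expand_lower (a q m : nat) (T : 'M[K]_(a, a + q)) (v : 'M[K]_(q, m)) (W : 'M[K]_(m, a + q)) :
  \det (col_mx T (v *m W)) =
  \sum_(f : {ffun 'I_q -> 'I_m}) (\prod_i v i (f i)) * \det (col_mx T (rowsub f W)).
Proof.
have EL (s : 'S_(a + q)) (M : 'M[K]_(q, a + q)) : \prod_i col_mx T M i (s i) =
    (\prod_i T i (s (lshift q i))) * \prod_i M i (s (rshift a i)).
  by rewrite big_split_ord; congr (_ * _); apply: eq_bigr => i _; rewrite (col_mxEu, col_mxEd).
rewrite /determinant (eq_bigr (fun s : 'S_(a + q) => \sum_(f : {ffun 'I_q -> 'I_m})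
   (\prod_i v i (f i)) * ((-1) ^+ s * (\prod_i col_mx T (rowsub f W) i (s i))))); last first.
  move=> s _; rewrite EL (eq_bigr (fun i => \sum_j v i j * W j (s (rshift a i)))) => [|i _]; last by rewrite mxE.
  rewrite bigA_distr_bigA /= !mulr_sumr; apply: eq_bigr => f _; rewrite EL big_split /=.
  have -> : \prod_i rowsub f W i (s (rshift a i)) = \prod_i W (f i) (s (rshift a i)).
    by apply: eq_bigr => i _; rewrite mxE.
  by rewrite [RHS]mulrCA; congr (_ * _); rewrite [RHS]mulrCA.
by rewrite exchange_big; apply: eq_bigr => f _; rewrite mulr_sumr.
Qed.

Lemma size_det_rows (N : nat) (A : 'M[{poly K}]_N) (k : 'I_N -> nat) :
  (forall i j, size (A i j) <= (k i).+1)%N -> (size (\det A) <= (\sum_i k i).+1)%N.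
Proof.
move=> Ak; apply: (big_ind (fun p : {poly K} => size p <= (\sum_i k i).+1)%N).
- by rewrite size_poly0.
- by move=> p q p1 q1; apply: leq_trans (size_polyD _ _) _; rewrite geq_max p1.
move=> s _; rewrite -signr_odd; case: (odd _); rewrite ?expr0 ?expr1 ?mul1r ?mulN1r ?size_polyN.
  by case: (prod_size_coef (index_enum 'I_N) (fun i => Ak i (s i))).
by case: (prod_size_coef (index_enum 'I_N) (fun i => Ak i (s i))).
Qed.

Variable n : nat.
Implicit Types (T : 'M[K]_(2, n.+2)) (v w : 'M[K]_(n, n.+2)) (x z p : 'rV[K]_(n.+2)).

(** For [n] vectors [v], the volume form on the quotient by the plane of [T]. *)
Definition bracket T v : K := \det (col_mx T v : 'M[K]_(2 + n)).

Definition two_rows x z : 'M[K]_(2, n.+2) := col_mx x z.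

Lemma two_rows_first x z l : two_rows x z (lshift 1 ord0 : 'I_(1 + 1)) l = x ord0 l.
Proof. exact: col_mxEu. Qed.

Lemma two_rows_second x z l : two_rows x z (rshift 1 ord0 : 'I_(1 + 1)) l = z ord0 l.
Proof. exact: col_mxEd. Qed.

Lemma row0_two_rows x z : row (ord0 : 'I_2) (two_rows x z) = x.
Proof. by apply/rowP => l; rewrite mxE -[RHS](two_rows_first x z); congr (two_rows _ _ _ l); apply: val_inj. Qed.

Lemma row1_two_rows x z : row (ord_max : 'I_2) (two_rows x z) = z.
Proof. by apply/rowP => l; rewrite mxE -[RHS](two_rows_second x z); congr (two_rows _ _ _ l); apply: val_inj. Qed.

Lemma bracket_add_line T v (L : 'M[K]_(n, 2)) : bracket T (v + L *m T) = bracket T v.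
Proof.
rewrite /bracket.
have -> : col_mx T (v + L *m T) = (block_mx 1%:M 0 L 1%:M : 'M[K]_(2 + n)) *m col_mx T v.
  by rewrite mul_block_col !mul1mx mul0mx addr0 addrC.
by rewrite det_mulmx det_lblock !det1 !mul1r.
Qed.

Lemma bracket_mul_line (S : 'M[K]_2) T v : bracket (S *m T) v = \det S * bracket T v.
Proof.
rewrite /bracket.
have -> : col_mx (S *m T) v = (block_mx S 0 0 1%:M : 'M[K]_(2 + n)) *m col_mx T v.
  by rewrite mul_block_col !mul1mx !mul0mx addr0 add0r.
by rewrite det_mulmx det_ublock det1 mulr1.
Qed.

Lemma bracket_mul_lower T (S : 'M[K]_n) v : bracket T (S *m v) = \det S * bracket T v.
Proof.
rewrite /bracket.
have -> : col_mx T (S *m v) = (block_mx 1%:M 0 0 S : 'M[K]_(2 + n)) *m col_mx T v.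
  by rewrite mul_block_col mul1mx !mul0mx addr0 add0r.
by rewrite det_mulmx det_ublock det1 mul1r.
Qed.

Lemma bracket_scale T v (c : K) : bracket T (c *: v) = c ^+ n * bracket T v.
Proof. by rewrite -mul_scalar_mx bracket_mul_lower det_scalar. Qed.

Lemma bracket_rows_noninjective T v k l : k != l -> row k v = row l v -> bracket T v = 0.
Proof.
move=> kl rkl; have ij : (rshift 2 k : 'I_(2 + n)) != rshift 2 l by rewrite (inj_eq (@rshift_inj _ _)).
apply: (determinant_alternate ij) => j; rewrite !col_mxEd.
by move/rowP: rkl => /(_ j); rewrite !mxE.
Qed.

Lemma bracket_second_row p x v :
  bracket (two_rows p x) v = \sum_j x ord0 j * bracket (two_rows p (delta_mx ord0 j)) v.
Proof.
pose i : 'I_(2 + n) := lshift n (rshift 1 ord0 : 'I_(1 + 1)).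
have E z : bracket (two_rows p z) v = \sum_j z ord0 j * cofactor (col_mx (two_rows p x) v : 'M[K]_(2 + n)) i j.
  rewrite /bracket (expand_det_row _ i); apply: eq_bigr => j _.
  rewrite {1}/i col_mxEu two_rows_second; congr (_ * _); rewrite /cofactor; congr (_ * \det _).
  apply/matrixP => a b; do 2!rewrite [LHS]mxE [RHS]mxE; case: (split_ordP (lift i a)) => [c E|c E]; last first.
    by rewrite E !col_mxEd.
  rewrite E !col_mxEu; case: (@split_ordP 1 1 c) => [e Ec|e Ec].
    by rewrite Ec (ord1 e) !two_rows_first.
  by move: (neq_lift i a); rewrite E Ec (ord1 e) eqxx.
rewrite E; apply: eq_bigr => j _; congr (_ * _); rewrite E (bigD1 j) //= big1 => [|k kj].
  by rewrite mxE !eqxx mul1r addr0.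
by rewrite mxE eqxx (negPf kj) mul0r.
Qed.

Lemma bracket_alternate x p v k : row k v = x -> bracket (two_rows p x) v = 0.
Proof.
move=> kv; pose i : 'I_(2 + n) := lshift n (rshift 1 ord0); pose j : 'I_(2 + n) := rshift 2 k.
have ij : i != j by [].
apply: (determinant_alternate ij) => l.
by rewrite /i /j col_mxEu col_mxEd two_rows_second -kv mxE.
Qed.

(** A family lying in the kernel of a linear form, completed by one vector:
the determinant depends on this vector through the linear form only. *)
Lemma bracket_linear_form (L : 'cV[K]_(n.+2)) (x w z : 'rV[K]_(n.+2)) v : x *m L = 0 -> v *m L = 0 ->
  (w *m L) ord0 ord0 * bracket (two_rows z x) v = (z *m L) ord0 ord0 * bracket (two_rows w x) v.
Proof.
move=> xL vL.
have [->|L0] := eqVneq L 0; first by rewrite !mulmx0 mxE !mul0r.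
have [j Lj] : exists j, L j ord0 != 0.
  by apply/existsP; apply: contraNT L0 => /existsPn H; apply/eqP/colP => j; rewrite mxE; apply/eqP/negPn/H.
pose M r : 'M[K]_(2 + n) := col_mx (two_rows r x) v.
pose i0 : 'I_(2 + n) := lshift n (lshift 1 (ord0 : 'I_1) : 'I_2).
have key r : bracket (two_rows r x) v * L j ord0 = cofactor (M 0) i0 j * (r *m L) ord0 ord0.
  have ML : M r *m (L : 'cV[K]_(2 + n)) = (r *m L) ord0 ord0 *: delta_mx i0 ord0.
    apply/colP => i; rewrite [RHS]mxE [delta_mx _ _ _ _]mxE andbT mxE /M.
    case: (split_ordP i) => [a ->|a ->]; last first.
      under eq_bigr do rewrite col_mxEd.
      by rewrite /= mulr0; have := congr1 (fun A : 'cV[K]_n => A a ord0) vL; rewrite !mxE.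
    under eq_bigr do rewrite col_mxEu.
    rewrite (inj_eq (@lshift_inj _ _)); case: (@split_ordP 1 1 a) => b ->; rewrite (ord1 b).
      under eq_bigr do rewrite two_rows_first.
      by rewrite eqxx mulr1 mxE.
    under eq_bigr do rewrite two_rows_second.
    by rewrite /= mulr0; have := congr1 (fun A : 'M[K]_1 => A ord0 ord0) xL; rewrite !mxE.
  have := congr1 (fun A => (\adj (M r) *m A) j ord0) ML.
  rewrite /= mulmxA mul_adj_mx mul_scalar_mx mxE => ->.
  rewrite -scalemxAr mxE mulrC -colE mxE mxE; congr (_ * _); rewrite /cofactor; congr (_ * \det _).
  apply/matrixP => a b; do 2!rewrite [LHS]mxE [RHS]mxE; rewrite /M; case: (split_ordP (lift i0 a)) => [c E|c E]; last first.
    by rewrite E !col_mxEd.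
  rewrite E !col_mxEu; case: (@split_ordP 1 1 c) => [e Ec|e Ec].
    by move: (neq_lift i0 a); rewrite E Ec (ord1 e) eqxx.
  by rewrite Ec (ord1 e) !two_rows_second.
apply: (mulIf Lj); rewrite -[LHS]mulrA key -[RHS]mulrA key; ring.
Qed.

End Brackets.

(** * Residues on the projective line *)
Section Residues.
Variable K : fieldType.

(** The sum of the residues of [h / f]. It is the coefficient of degree [d - 1] in
Lagrange's interpolation formula for [h] at the roots of [f]. *)
Lemma sum_residues (f h : {poly K}) d (y : 'I_d -> K) : size f = d.+1 -> injective y ->
  (forall j, f.[y j] = 0) -> (size h < d)%N -> \sum_j h.[y j] / f^`().[y j] = 0.
Proof.
move=> sf yinj fy sh.
have fE : f = lead_coef f *: \prod_(j < d) ('X - (y j)%:P).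
  have := @all_roots_prod_XsubC _ f [tuple y j | j < d].
  rewrite size_tuple sf big_tuple; under eq_bigr do rewrite tnth_mktuple.
  apply=> //; first by apply/allP => z /mapP[j _ ->]; apply/rootP.
  by rewrite uniq_rootsE map_inj_uniq ?enum_uniq.
have lf : lead_coef f != 0 by rewrite lead_coef_eq0 -size_poly_eq0 sf.
pose q j := \prod_(k < d | k != j) ('X - (y k)%:P).
have fq j : f = lead_coef f *: (('X - (y j)%:P) * q j) by rewrite {1}fE (bigD1 j).
have qm j : q j \is monic by apply: monic_prod => k _; apply: monicXsubC.
have sq j : size (q j) = d.
  have := sf; rewrite {1}(fq j) size_scale // size_monicM ?monicXsubC ?monic_neq0 //.
  by rewrite size_XsubC add2n => -[].
have f'q j : f^`().[y j] = lead_coef f * (q j).[y j].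
  by rewrite {1}(fq j) derivZ derivM derivXsubC !hornerE subrr mul0r addr0.
have qy j k : k != j -> (q j).[y k] = 0.
  by move=> kj; rewrite /q (bigD1 k) //= !hornerE subrr mul0r.
have qj j : (q j).[y j] != 0.
  rewrite /q horner_prod; apply/prodf_neq0 => k kj; rewrite hornerXsubC subr_eq0.
  by apply: contraNneq kj => /yinj ->.
pose L := \sum_j (h.[y j] / (q j).[y j]) *: q j.
have hL : h = L.
  apply/eqP; rewrite -subr_eq0; apply/eqP/(poly_too_many_roots yinj) => [j|].
    rewrite hornerD hornerN /L horner_sum (bigD1 j) //= big1 => [|k kj].
      by rewrite hornerZ divfK // addr0 subrr.
    have jk : j != k by rewrite eq_sym.
    by rewrite hornerZ (qy k j jk) mulr0.
  apply: leq_trans (size_polyD _ _) _; rewrite size_polyN geq_max (ltnW sh) /=.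
  apply: (big_ind (fun p : {poly K} => size p <= d)%N) => [|p r p1 r1|j _].
  - by rewrite size_poly0.
  - by apply: leq_trans (size_polyD _ _) _; rewrite geq_max p1.
  - by apply: leq_trans (size_scale_leq _ _) _; rewrite sq.
have d0 : (0 < d)%N by apply: leq_ltn_trans sh.
have : h`_d.-1 = 0 by rewrite nth_default // -ltnS prednK.
rewrite {1}hL coef_sum => E.
under eq_bigr do rewrite f'q invfM mulrCA.
rewrite -mulr_sumr -[X in _ * X]/(\sum_j _) (eq_bigr (fun j => ((h.[y j] / (q j).[y j]) *: q j)`_d.-1)).
  by rewrite E mulr0.
move=> j _; rewrite coefZ; have := monicP (qm j); rewrite lead_coefE sq => ->.
by rewrite mulr1.
Qed.

End Residues.

(** * The forms R det(p, X, dX, ..., dX) / dF(p) *)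
Section WedgeForms.
Variables (C : numClosedFieldType) (n d : nat) (F : hpoly C n) (p : 'rV[C]_(n.+2)).
Local Notation vec := 'rV[C]_(n.+2).
Implicit Types (R : hpoly C n) (x : vec) (v : 'M[C]_(n, n.+2)).

Definition wedge_coefficient (I : 'I_n -> 'I_n.+2) : hpoly C n :=
  \sum_j bracket (two_rows p (delta_mx ord0 j)) (rowsub I 1%:M) *: mpolyX C (mnm1 j).

(** The coefficients of [R] times the determinant of [p], [X] and [n] copies of [dX]. *)
Definition wedge_numerator R : {ffun multi_index n n -> hpoly C n} :=
  [ffun I : multi_index n n => R * wedge_coefficient (val I) : hpoly C n].

Definition wedge_form R : qform C n n :=
  [ffun I : multi_index n n => tofrac (wedge_numerator R I) / tofrac (dirderiv p F) : ratfun C n].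

Lemma peval_wedge_coefficient I x :
  peval (wedge_coefficient I) x = bracket (two_rows p x) (rowsub I 1%:M).
Proof.
rewrite bracket_second_row /wedge_coefficient peval_sum; apply: eq_bigr => j _.
by rewrite pevalZ pevalX mulrC.
Qed.

Lemma wedge_polyform R x v :
  polyform_at (wedge_numerator R) x v = peval R x * bracket (two_rows p x) v.
Proof.
(* Both sides are multilinear and alternating in [v]. *)
suff key (f : 'I_n -> 'I_n.+2) : polyform_at (wedge_numerator R) x (rowsub f 1%:M) =
    peval R x * bracket (two_rows p x) (rowsub f 1%:M).
  rewrite -[v]mulmx1 polyform_mul /bracket det_expand_lower mulr_sumr.
  by apply: eq_bigr => f _; rewrite key mulrCA.
have [/injectiveP finj|/injectivePn[i [j ij fij]]] := boolP (injectiveb f); last first.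
  rewrite (polyform_rowsub_noninjective _ _ _ ij fij) (bracket_rows_noninjective _ ij) ?mulr0 //.
  by rewrite !row_rowsub fij.
have [J [s [incJ fJ]]] := sort_injection finj.
have E : rowsub f (1%:M : 'M[C]_(n.+2)) = rowsub (J \o s) 1%:M.
  by apply/matrixP => i j; rewrite !mxE fJ.
rewrite E polyform_rowsub_perm.
have -> : rowsub (J \o s) (1%:M : 'M[C]_(n.+2)) = perm_mx s *m rowsub J 1%:M.
  by rewrite -row_permE; apply/matrixP => i j; rewrite !mxE.
rewrite bracket_mul_lower det_perm mulrCA; congr (_ * _).
have incJb : increasing J by apply/increasingP.
rewrite /polyform_at (bigD1 (exist _ J incJb)) //= [X in _ + X]big1 => [|I IJ].
  rewrite addr0 ffunE pevalM peval_wedge_coefficient.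
  have -> : colsub J (rowsub J (1%:M : 'M[C]_(n.+2))) = 1%:M.
    by apply/matrixP => i j; rewrite !mxE (inj_eq (increasing_inj incJb)).
  by rewrite det1 mulr1.
have [i /forallP Ni] : exists i, [forall j, J i != val I j].
  apply/existsP; apply: contraNT IJ => /existsPn H; apply/eqP/val_inj => /=.
  apply: (increasing_image (valP I) incJb) => i.
  by have := H i; rewrite negb_forall => /existsP[j /negPn/eqP ->]; exists j.
rewrite (expand_det_row _ i) big1 ?mulr0 // => j _.
by rewrite !mxE (negPf (Ni j)) mul0r.
Qed.

Hypothesis redF : reduced_equation d F.

Lemma wedge_form_on R r : d = (r + n).+2 -> homogeneous r R ->
  contains_no_component F (dirderiv p F) -> dirderiv p F != 0 ->
  form_on F (wedge_form R) (wedge_numerator R) (dirderiv p F).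
Proof.
have [_ homF _] := redF.
move=> dE homR ncD D0; split=> //; split=> //.
- exists r.+1; split.
    by have := homogeneous_dirderiv p homF; rewrite dE.
  move=> I; rewrite ffunE -addn1; apply: homogeneousM => //.
  by apply: homogeneous_sum => j _; apply/homogeneousZ/homogeneousX.
- by move=> I; rewrite ffunE.
by move=> x v k kv; rewrite wedge_polyform (bracket_alternate _ kv) mulr0.
Qed.

End WedgeForms.

(** * Vanishing of their traces *)
Section WedgeFormsAreAbelian.
Variables (C : numClosedFieldType) (n d r : nat) (F R : hpoly C n) (p : 'rV[C]_(n.+2)).
Hypotheses (homF : homogeneous d F) (homR : homogeneous r R) (dE : d = (r + n).+2).
Local Notation vec := 'rV[C]_(n.+2).
Local Notation pair := 'M[C]_(2, n.+2).

Lemma det_two (K : fieldType) (A : 'M[K]_2) :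
  \det A = A ord0 ord0 * A ord_max ord_max - A ord0 ord_max * A ord_max ord0.
Proof.
have E : lift ord0 ord0 = ord_max :> 'I_2 by apply: val_inj.
have E' : lift ord_max ord0 = ord0 :> 'I_2 by apply: val_inj.
rewrite (expand_det_row _ ord0) big_ord_recl big_ord1 E /cofactor !det_mx11 !mxE E E' /=.
by rewrite addn0 addn1 expr0 expr1 mul1r mulN1r mulrN.
Qed.

(** The restriction of the form to the hypersurface does not depend on [p], by
[bracket_linear_form] applied to the differential of [F]. With [p] replaced by the
point at infinity of the line, the terms become the residues [h / f'] at the roots
of [f], where [h] has degree at most [d - 2] and the scalings [c j] cancel. *)
Lemma line_trace (t : pair) (y c : 'I_d -> C) (V : 'I_d -> 'M[C]_(n, n.+2))
    (A B : 'M[C]_(n, n.+2)) (L : 'I_d -> 'M[C]_(n, 2)) :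
  peval F (row ord_max t) != 0 -> injective y -> (forall j, c j != 0) ->
  (forall j, peval F (line_point t (y j)) = 0) ->
  (forall j, V j = c j *: (A + y j *: B) + L j *m t) ->
  (forall j k, dpoly F (c j *: line_point t (y j)) (row k (V j)) = 0) ->
  (forall j, dpoly F (c j *: line_point t (y j)) p != 0) ->
  \sum_j peval R (c j *: line_point t (y j)) * bracket (two_rows p (c j *: line_point t (y j))) (V j)
      / dpoly F (c j *: line_point t (y j)) p = 0.
Proof.
move=> Ft yinj c0 Fy VE FV Fp; set w := row ord_max t in Ft.
pose f := restriction F t.
have [sf _] : size f = d.+1 /\ _ := restriction_size homF Ft.
have fy j : f.[y j] = 0 by rewrite horner_restriction.
have f'0 := distinct_roots_simple sf yinj fy.
have f'E j : f^`().[y j] = dpoly F (line_point t (y j)) w by apply: horner_deriv_on_line.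
pose G : 'M[{poly C}]_(n, n.+2) := map_mx polyC A + 'X *: map_mx polyC B.
pose h1 : {poly C} := \det (col_mx (map_mx polyC t) G : 'M[{poly C}]_(2 + n)).
have h1y z : h1.[z] = bracket t (A + z *: B).
  rewrite /h1 -/(horner_eval z _) -det_map_mx /bracket; congr (\det _).
  rewrite (map_col_mx (horner_eval z)); congr col_mx; apply/matrixP => a b; rewrite !mxE /horner_eval.
    by rewrite hornerC.
  by rewrite hornerD hornerM !hornerC hornerX.
have sh1 : (size h1 <= n.+1)%N.
  have key : forall (i j : 'I_(2 + n)), (size ((col_mx (map_mx polyC t) G : 'M[{poly C}]_(2 + n)) i j) <= (if fintype.split i is inl _ then 0 else 1).+1)%N.
    move=> i j; case: (split_ordP i) => a ->; rewrite (col_mxEu, col_mxEd) !mxE ?(unsplitK (inl a)) ?(unsplitK (inr a)).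
      by rewrite size_polyC; case: (_ == _).
    apply: leq_trans (size_polyD _ _) _; rewrite geq_max; apply/andP; split.
      by apply: leq_trans (size_polyC_leq1 _) _.
    by apply: leq_trans (size_polyMleq _ _) _; rewrite size_polyX /=; apply: leq_trans (size_polyC_leq1 _) _.
  have := size_det_rows key; rewrite big_split_ord /= big1 => [|i _]; last by rewrite (unsplitK (inl _)).
  rewrite add0n (eq_bigr (fun=> 1%N)) => [|i _]; last by rewrite (unsplitK (inr _)).
  by rewrite sum1_card card_ord.
pose Rp := on_line (row ord0 t ord0) (w ord0) R.
have sRp : (size Rp <= r.+1)%N by have [] := on_line_homogeneous (row ord0 t) w homR.
have Rpy z : Rp.[z] = peval R (line_point t z) by apply: peval_on_line.
have sh : (size (- (Rp * h1)) < d)%N.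
  rewrite size_polyN; apply: leq_ltn_trans (size_polyMleq _ _) _.
  have aux a b : (a <= r.+1 -> b <= n.+1 -> (a + b).-1 < d)%N by rewrite dE; lia.
  exact: aux.
rewrite -[RHS](sum_residues sf yinj fy sh); apply: eq_bigr => j _.
rewrite hornerN hornerM Rpy h1y f'E.
set x := line_point t (y j); have Fx : peval F x = 0 := Fy j.
have Fw : dpoly F x w != 0 by rewrite -f'E.
pose Lc : 'cV[C]_(n.+2) := \col_i peval (mderiv i F) (c j *: x).
have LcE u : u *m Lc = (dpoly F (c j *: x) u)%:M.
  by apply/rowP => k; rewrite (ord1 k) !mxE mulr1n; apply: eq_bigr => i _; rewrite mxE mulrC.
have xL : (c j *: x) *m Lc = 0.
  by rewrite LcE (euler_on_hypersurface homF) ?raddf0 // (peval_scale _ _ homF) Fx mulr0.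
have vL : V j *m Lc = 0.
  by apply/row_matrixP => k; rewrite row_mul LcE FV raddf0 row0.
have := bracket_linear_form p w xL vL; rewrite !LcE !mxE !mulr1n => E.
(* The change of the auxiliary point. *)
have E1 : bracket (two_rows p (c j *: x)) (V j) / dpoly F (c j *: x) p =
    bracket (two_rows w (c j *: x)) (V j) / dpoly F (c j *: x) w.
  apply/eqP; rewrite eqr_div ?Fp //; first by rewrite mulrC -E mulrC.
  by rewrite (dpoly_scale _ _ _ homF) mulf_neq0 ?expf_neq0.
rewrite -mulrA E1.
pose S : 'M[C]_2 := \matrix_(a, b) (if a == ord0 then (b == ord_max)%:R else c j * (if b == ord0 then 1 else y j)).
have tS : two_rows w (c j *: x) = S *m t.
  apply/row_matrixP => a; rewrite row_mul mul_pair !mxE /=.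
  have [->|a0] := eqVneq a ord0.
    by rewrite row0_two_rows scale0r add0r scale1r.
  have -> : a = ord_max by apply: val_inj; case: a a0 => [[|[|]]].
  by rewrite row1_two_rows mulr1 -scalerA -scalerDr.
have detS : \det S = - c j by rewrite det_two !mxE /= mul0r mul1r mulr1 add0r.
rewrite tS bracket_mul_line detS VE bracket_add_line bracket_scale.
rewrite (peval_scale _ _ homR) (dpoly_scale _ _ _ homF) dE /=.
rewrite exprS exprD invfM; have := c0 j; move: (c j) Fw => a Fw a0.
have ar : a ^+ r != 0 by rewrite expf_neq0.
have an : a ^+ n != 0 by rewrite expf_neq0.
move: (a ^+ r) (a ^+ n) ar an => b e b0 e0.
by field; rewrite ?a0 ?Fw ?b0 ?e0.
Qed.

(** Otherwise the infinitely many points of the line would be among the [d] points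
[xi j]. *)
Lemma line_point_off (t0 : pair) (xi : 'I_d -> vec) : \rank t0 = 2%N ->
  (forall x : vec, x != 0 -> peval F x = 0 -> (x <= t0)%MS -> exists j, (x <= xi j)%MS) ->
  exists z, peval F (line_point t0 z) != 0.
Proof.
move=> rt0 H; apply: contrapT => N.
have F0 z : peval F (line_point t0 z) = 0 by apply/eqP/negPn/negP => Fz; apply: N; exists z.
have /choice[s sP] (k : 'I_d.+1) : exists j, (line_point t0 (k : nat)%:R <= xi j)%MS.
  by apply: H; rewrite ?line_point_neq0 ?line_point_sub.
have /injectivePn[k [l kl skl]] : ~~ injectiveb s.
  apply/negP => /injectiveP sinj; have := leq_card s sinj; rewrite !card_ord ltnn; done.
have /sub_rVP[a Ea] := sP k; have /sub_rVP[b Eb] := sP l; rewrite skl in Ea.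
have b0 : b != 0.
  by apply/eqP => b0; move/eqP: Eb; rewrite b0 scale0r (negPf (line_point_neq0 _ rt0)).
have : line_point t0 (k : nat)%:R = (a / b) *: line_point t0 (l : nat)%:R.
  by rewrite Eb scalerA divfK.
move/(line_point_inj rt0)/eqP; rewrite eqr_nat => /eqP /val_inj E.
by rewrite E eqxx in kl.
Qed.

Lemma wedge_abelian (t0 : pair) (xi : 'I_d -> pair -> vec) (tau : 'I_n -> pair) :
  \rank t0 = 2%N -> intersection_points F t0 xi ->
  (forall j, peval (dirderiv p F) (xi j t0) != 0) ->
  trace_at (wedge_numerator p R) (dirderiv p F) xi t0 tau = 0.
Proof.
move=> rt0 ip Dne.
have [dxi xi0 xiD xiP] := nbhs_singleton ip.
have near j : \forall t \near t0, (xi j t <= t)%MS /\ peval F (xi j t) = 0.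
  move: ip; apply: (@filterS _ _ (nbhs_filter t0)) => t [_ x0 _ /(_ (xi j t) (x0 j)) [_ H]].
  by have [] := H (ex_intro _ j (submx_refl _)).
have [z0 Fz] : exists z, peval F (line_point t0 z) != 0.
  by apply: (line_point_off rt0 (xi := fun j => xi j t0)) => x x0 Fx xt; apply/xiP.
(* Another basis of the line, with its point at infinity off the hypersurface. *)
pose S : 'M[C]_2 := \matrix_(a, b) (if a == ord0 then (b == ord_max)%:R else (if b == ord0 then 1 else z0)).
have detS : \det S = -1 by rewrite det_two !mxE /= mul0r mul1r add0r.
have Su : S \in unitmx by rewrite unitmxE detS unitrN1.
pose t := S *m t0.
have t0E : t0 = invmx S *m t by rewrite /t mulmxA mulVmx // mul1mx.
have tmax : row ord_max t = line_point t0 z0 by rewrite /t row_mul mul_pair !mxE /= scale1r.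
have t0min : row ord0 t = row ord_max t0 by rewrite /t row_mul mul_pair !mxE /= scale0r add0r scale1r.
have Ft : peval F (row ord_max t) != 0 by rewrite tmax.
have rt : \rank t = 2%N by rewrite /t mxrankMfree ?mxrank_unit // /row_free rt0.
have xt j : (xi j t0 <= t)%MS.
  have [xt0 _] := nbhs_singleton (near j).
  by apply: submx_trans xt0 _; rewrite {1}t0E submxMl.
have /choice[c cP] j : exists c, c != 0 /\ exists z, xi j t0 = c *: line_point t z.
  have [_ Fx] := nbhs_singleton (near j).
  by have [c c0 E] := line_pointP homF Ft (xi0 j) Fx (xt j); exists c.
have c0 j := (cP j).1; have /choice[y yP] j := (cP j).2.
have Fy j : peval F (line_point t (y j)) = 0.
  have [_ Fx] := nbhs_singleton (near j).
  by move/eqP: Fx; rewrite yP (peval_scale _ _ homF) mulf_eq0 expf_eq0 (negPf (c0 j)) andbF => /eqP.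
have yinj : injective y.
  move=> j k yjk; apply/eqP; apply: contraT => /xiD; rewrite !yP yjk.
  by rewrite (eqmx_scale _ (c0 j)) (eqmx_scale _ (c0 k)) submx_refl.
pose A := \matrix_k row ord_max (tau k).
pose B := \matrix_k (row ord0 (tau k) + z0 *: row ord_max (tau k)).
pose V j := \matrix_(k < n) 'd (xi j) t0 (tau k).
have /choice[L LP] j : exists L : 'M[C]_(n, 2), V j = c j *: (A + y j *: B) + L *m t.
  have [s sE sP] := section_tangent rt0 (dxi j) (near j).
  have sS : s = (c j *: \row_i (if i == ord0 then 1 else y j)) *m S.
    apply/eqP; rewrite -subr_eq0; apply/eqP/(combination_eq0 rt0).
    by rewrite mulmxBl -sE -mulmxA -/t -scalemxAl -line_pointE yP subrr.
  have /choice[sigma sigmaP] k := sP (tau k).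
  exists ((\matrix_k sigma k) *m invmx S).
  apply/row_matrixP => k; rewrite rowK sigmaP addrC [RHS]linearD /=; congr (_ + _); last first.
    by rewrite !row_mul rowK -mulmxA -t0E.
  rewrite linearZ linearD linearZ /= !rowK sS -!scalemxAl; congr (_ *: _).
  by rewrite -mulmxA mul_pair !row_mul !mul_pair !mxE /= scale0r add0r !scale1r.
have := @line_trace t y c V A B L Ft yinj c0 Fy LP.
rewrite /trace_at => E; rewrite -[RHS]E.
- apply: eq_bigr => j _; rewrite /form_at wedge_polyform peval_dirderiv.
  by rewrite -yP.
- by move=> j k; rewrite -yP rowK; apply: section_dpoly (dxi j) (near j) _.
- by move=> j; rewrite -yP -peval_dirderiv.
Qed.

End WedgeFormsAreAbelian.

(** * Generic points and tangent spaces *)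
Lemma fraction_cross_multiply (A : idomainType) (a b c d : A) : b != 0 -> d != 0 ->
  tofrac a / tofrac b = tofrac c / tofrac d -> a * d = c * b.
Proof.
move=> b0 d0 /eqP; rewrite eqr_div ?tofrac_eq0 // -!tofracM tofrac_eq => /eqP; exact.
Qed.

Section GenericPoints.
Variables (C : numClosedFieldType) (n d : nat) (F : hpoly C n).
Local Notation vec := 'rV[C]_(n.+2).

Lemma normalized_frame : reduced_equation d F -> (0 < d)%N ->
  exists (p : vec) (B : 'M[C]_(n.+1, n.+2)),
    peval F p = 1 /\ (col_mx p B : 'M[C]_(1 + n.+1)) \in unitmx.
Proof.
move=> [F0 homF _] d0; have [z Fz] := mpoly_nonzero_point F0.
pose x : vec := \row_i z i.
have Fx : peval F x != 0 by rewrite /peval (meval_eq (v2 := z)) // => i; rewrite mxE.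
pose p := d.-root (peval F x)^-1 *: x.
have Fp : peval F p = 1 by rewrite (peval_scale _ _ homF) rootCK // mulVf.
have p0 : p != 0.
  apply: contra_eq_neq Fp => ->; rewrite -(scale0r p) (peval_scale _ _ homF) expr0n.
  by rewrite eqn0Ngt d0 mul0r eq_sym oner_eq0.
have fp : row_free (p : 'M[C]_(1, 1 + n.+1)).
  by rewrite /row_free rank_rV p0.
by have [B Bu] := frame_completion fp; exists p, B.
Qed.

Lemma proportional_representations q (Phi : qform C n q) P g P' g' x v :
  form_on F Phi P g -> form_on F Phi P' g' ->
  polyform_at P x v * peval g' x = polyform_at P' x v * peval g x.
Proof.
move=> [[g0 _ E _] _] [[g'0 _ E' _] _]; rewrite /polyform_at !mulr_suml; apply: eq_bigr => I _.
have key : P I * g' = P' I * g.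
  have EI : tofrac (P I) / tofrac g = tofrac (P' I) / tofrac g' by rewrite -E -E'.
  exact: fraction_cross_multiply g0 g'0 EI.
by rewrite mulrAC -pevalM key pevalM mulrAC.
Qed.

Lemma smooth_of_dpoly (x v : vec) : x != 0 -> peval F x = 0 -> dpoly F x v != 0 -> smooth_point F x.
Proof.
move=> x0 Fx dx; split=> //; apply: contra_neqP dx => N.
rewrite /dpoly big1 // => i _; have [->|H] := eqVneq (peval (mderiv i F) x) 0; first by rewrite mul0r.
by case: N; exists i.
Qed.

Lemma frame_line_free p (B : 'M[C]_(n.+1, n.+2)) x (y : C) :
  (col_mx p B : 'M[C]_(1 + n.+1)) \in unitmx -> x != 0 ->
  row_free (two_rows p (x *m B + y *: p)).
Proof.
move=> Bu x0; apply: inj_row_free => v.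
rewrite mul_pair row0_two_rows row1_two_rows.
set a := v ord0 ord0; set b := v ord0 ord_max => E.
have E' : (b *: x) *m B + (a + b * y) *: p = 0.
  by rewrite -E -scalemxAl scalerDr scalerDl scalerA addrCA.
have b0 : b = 0.
  apply/eqP; apply: contraT => b0; have bx : b *: x != 0 by rewrite scaler_eq0 negb_or b0.
  by have := frame_point_neq0 Bu (a + b * y) bx; rewrite E' eqxx.
have p0 : p != 0.
  apply/eqP => p0; have := Bu; rewrite unitmxE unitfE (expand_det_row _ (lshift n.+1 ord0)) big1 ?eqxx // => j _.
  by rewrite col_mxEu p0 mxE mul0r.
have a0 : a = 0.
  move/eqP: E; rewrite b0 scale0r addr0 scaler_eq0 (negPf p0) orbF => /eqP; exact.
apply/rowP => i; rewrite mxE.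
have [->|i0] := eqVneq i ord0; first exact: a0.
by have -> : i = ord_max by apply: val_inj; case: i i0 => [[|[|]]].
Qed.

(** Vectors completing [p] and [x] to a frame, projected to the tangent space along
[p]; this does not change the determinant. *)
Lemma tangent_completion p x : dpoly F x p != 0 -> row_free (two_rows p x) ->
  exists2 v : 'M[C]_(n, n.+2), forall k, dpoly F x (row k v) = 0 & bracket (two_rows p x) v != 0.
Proof.
move=> Fp fT; have [W Wu] := @frame_completion C 2 n (two_rows p x) fT.
pose L : 'M[C]_(n, 2) := \matrix_(k, i) (if i == ord0 then - dpoly F x (row k W) / dpoly F x p else 0).
have LE k : row k (L *m two_rows p x) = - (dpoly F x (row k W) / dpoly F x p) *: p.
  by rewrite row_mul mul_pair row0_two_rows !mxE /= scale0r addr0 mulNr.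
exists (W + L *m two_rows p x) => [k|].
  by rewrite linearD /= LE dpolyD dpolyZ mulNr divfK // subrr.
by rewrite bracket_add_line -unitfE -unitmxE.
Qed.

End GenericPoints.

Lemma monomials_of_degree k r : exists mu : 'I_('C(r + k, r)) -> multinom k.+1,
  [/\ injective mu, forall i, mdeg (mu i) = r & forall m, mdeg m = r -> exists i, mu i = m].
Proof.
pose s := [seq s2m (tval t) | t : r.-tuple 'I_k.+1 <- enum (basis k.+1 r)].
have ss : size s = 'C(r + k, r) by apply: size_basis.
have mem m : (mdeg m == r) = (m \in s) by apply: basis_cover.
pose m0 : multinom k.+1 := mnm0.
exists (fun i => nth m0 s i); split.
- move=> i j /eqP; rewrite nth_uniq ?ss ?ltn_ord ?uniq_basis // => /eqP; exact: val_inj.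
- by move=> i; apply/eqP; rewrite mem mem_nth ?ss.
move=> m /eqP; rewrite mem => ms; have im := ms; rewrite -index_mem ss in im.
by exists (Ordinal im); rewrite nth_index.
Qed.

(** * Linear independence of the wedge forms *)
Section Independence.
Variables (C : numClosedFieldType) (n d : nat) (F : hpoly C n) (p : 'rV[C]_(n.+2))
  (B : 'M[C]_(n.+1, n.+2)).
Hypotheses (redF : reduced_equation d F) (Fp : peval F p = 1)
  (frame : (col_mx p B : 'M[C]_(1 + n.+1)) \in unitmx).

(** A polynomial of degree less than [d] that vanishes on a dense open part of
the hypersurface has too many zeros on a general line through [p]. *)
Lemma low_degree_vanishing r R g : homogeneous r R -> (r < d)%N -> contains_no_component F g ->
  (forall x y, x != 0 -> peval F (x *m B + y *: p) = 0 -> peval g (x *m B + y *: p) != 0 ->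
     peval R (x *m B + y *: p) = 0) -> R = 0.
Proof.
move=> homR rd ng HR; have [delta delta0 Hd] := generic_line_sections redF Fp frame ng.
apply/eqP; apply: contraT => R0.
have [k Rk] : exists k, (chart 0 B p R)`_k != 0.
  apply: contrapT => N; move/eqP: R0; apply; apply: (Psi_inj frame); rewrite rmorph0.
  by apply/polyP => k; rewrite coef0; apply/eqP/negPn/negP => H; apply: N; exists k.
have [x x0] := nonzero_row_point (mulf_neq0 delta0 Rk).
rewrite mevalM mulf_eq0 negb_or => /andP[/Hd[y [yinj Fy gy]] Rx].
have Rz : map_poly (meval (x ord0)) (chart 0 B p R) = 0.
  apply: (poly_too_many_roots yinj) => [j|]; first by rewrite horner_Psi HR.
  rewrite map_chart add0r; have [sR _] := on_line_homogeneous (x *m B) p homR.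
  exact: leq_trans sR rd.
by move: Rx; rewrite -coef_map Rz coef0 eqxx.
Qed.

Lemma wedge_independent r : d = (r + n).+2 ->
  exists e : 'I_('C(r + n.+1, r)) -> qform C n n,
    (forall i, abelian_form_on F d (e i)) /\ independent_modulo (@null_form_on C n n F) e.
Proof.
have [F0 homF _] := redF.
move=> dE; have [mu [muinj mud _]] := monomials_of_degree n.+1 r.
(* A basis of the space of homogeneous polynomials of degree [d - n - 2]. *)
pose R i : hpoly C n := mpolyX C (mu i).
have homR i : homogeneous r (R i) by rewrite /homogeneous dhomogX; apply/eqP/mud.
have nD := dirderiv_contains_no_component redF Fp frame.
have D0 : dirderiv p F != 0.
  apply/eqP => D0; have := low_degree_vanishing (homogeneousC n (1 : C)) _ nD; rewrite dE => /(_ isT) H.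
  have : mpolyC n.+2 (1 : C) = 0 by apply: H => x y _ _; rewrite D0 /peval meval0 eqxx.
  by move/eqP; rewrite mpolyC_eq0 oner_eq0.
have fon i := wedge_form_on redF dE (homR i) nD D0.
exists (fun i => wedge_form F p (R i)); split=> [i|c [P [g [fP NP]]]].
  exists (wedge_numerator p (R i)), (dirderiv p F); split; first exact: fon.
  by move=> t0 xi rt ip Dne tau; apply: (wedge_abelian homF (homR i) dE).
have N0 : (0 < 'C(r + n.+1, r))%N by rewrite bin_gt0 leq_addr.
have fS := form_on_linear_combination (fun i => c ord0 i) N0 fon.
pose S := \sum_i c ord0 i *: R i.
have homS : homogeneous r S by apply: homogeneous_sum => i _; apply: homogeneousZ.
have S0 : S = 0.
  have rd : (r < d)%N by rewrite dE; lia.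
  have [_ ng] := fP.
  apply: (low_degree_vanishing homS rd (contains_no_componentM ng nD)) => x y x0.
  set X := x *m B + y *: p => FX; rewrite pevalM mulf_eq0 negb_or => /andP[gX DX].
  rewrite peval_dirderiv in DX.
  have X0 : X != 0 by apply: frame_point_neq0.
  have [v tv bv] := tangent_completion DX (frame_line_free y frame x0).
  have := NP X v (smooth_of_dpoly X0 FX DX) gX tv.
  move=> /eqP; rewrite mulf_eq0 invr_eq0 (negPf gX) orbF => /eqP PX.
  have := proportional_representations X v fP fS; rewrite PX mul0r => /esym/eqP.
  rewrite mulf_eq0 (negPf gX) orbF polyform_linear_combination => /eqP E.
  apply/eqP; rewrite -(mulIr_eq0 _ (mulIf bv)) -[X in _ == X]E /S peval_sum mulr_suml; apply/eqP.
  by apply: eq_bigr => i _; rewrite pevalZ wedge_polyform mulrA.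
apply/rowP => i; rewrite mxE.
have := congr1 (mcoeff (mu i)) S0; rewrite mcoeff0 /S linear_sum /= (bigD1 i) //= big1 ?addr0.
  by rewrite mcoeffZ mcoeffX eqxx mulr1.
by move=> j ji; rewrite mcoeffZ mcoeffX (inj_eq muinj) (negPf ji) mulr0.
Qed.

End Independence.

(** * Pencils of moving lines *)
Section MovingLine.
Variables (C : numClosedFieldType) (n q : nat) (F : hpoly C n).
Local Notation vec := 'rV[C]_(n.+2).
Local Notation pair := 'M[C]_(2, n.+2).
Variables (x0 p : vec) (B : 'M[C]_(n, n.+2)).

(** The fields [dF(p) b - dF(b) p], tangent to the level sets of [F] and polynomial in
[x]: projections of the rows [b] of [B] along [p]. *)
Definition tangent_fields (x : vec) : 'M[C]_(n, n.+2) :=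
  \matrix_k (dpoly F x p *: row k B - dpoly F x (row k B) *: p).

(** The line through [x0] and [p], both displaced in the direction [b]; the ratio [s]
of the speeds of the two points is a free parameter. *)
Definition moving_line (s eps : C) (b : vec) : pair := two_rows (x0 + eps *: b) (p + (s * eps) *: b).

(** The opposite of the speed, along the line, of the point of intersection when the
line moves in the direction [w]. *)
Definition slope (s eps Y : C) (b x w : vec) : C :=
  (1 + s * Y) * dpoly F x w / (dpoly F x p + s * eps * dpoly F x b).

(** Coordinates, in [tangent_fields] and up to the Euler vector, of the derivatives of
a section when the line moves in the directions [row (J k) B]. *)
Definition motion_matrix (J : 'I_q -> 'I_n) (beta : 'rV[C]_n) (s eps Y : C) (x : vec) : 'M[C]_(q, n) :=
  \matrix_(k, i) ((1 + s * Y) * (J k == i)%:R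
    - s * eps * slope s eps Y (beta *m B) x (row (J k) B) * beta ord0 i).

Lemma moving_line_point s eps b Y :
  line_point (moving_line s eps b) Y = x0 + (eps * (1 + s * Y)) *: b + Y *: p.
Proof.
rewrite /line_point row0_two_rows row1_two_rows; apply/rowP => l; rewrite !mxE; ring.
Qed.

(** The coefficient of [p] in the derivative of the section is determined by tangency;
the rest is a combination of the Euler vector and of the tangent fields. *)
Lemma moving_section (P : {ffun multi_index n q -> hpoly C n}) (J : 'I_q -> 'I_n) (beta : 'rV[C]_n)
    (s eps Y : C) (sigma : 'I_q -> 'rV[C]_2) (V : 'M[C]_(q, n.+2)) :
  let t := moving_line s eps (beta *m B) in let x := line_point t Y in
  dpoly F x x = 0 -> euler_free P x ->
  dpoly F x p + s * eps * dpoly F x (beta *m B) != 0 ->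
  (forall k, row k V = sigma k *m t +
     (\row_i (if i == ord0 then 1 else Y)) *m two_rows (row (J k) B) (s *: row (J k) B)) ->
  (forall k, dpoly F x (row k V) = 0) ->
  dpoly F x p ^+ q * polyform_at P x V =
    \sum_(f : {ffun 'I_q -> 'I_n}) (\prod_k motion_matrix J beta s eps Y x k (f k)) *
      polyform_at P x (rowsub f (tangent_fields x)).
Proof.
move=> t x xx eP K0 VE FV; set D := dpoly F x p; set b := beta *m B.
rewrite -polyform_scale -polyform_mul.
pose u : 'cV[C]_q := \col_k (D * sigma k ord0 ord0).
rewrite -[RHS](polyform_add_radial u _ eP); congr (polyform_at P x _).
apply/row_matrixP => k; rewrite linearZ linearD /= !row_mul.
set w := row (J k) B; set la := slope s eps Y b x w.
have laK : la * (D + s * eps * dpoly F x b) = (1 + s * Y) * dpoly F x w by rewrite divfK.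
have rM : row k (motion_matrix J beta s eps Y x) =
    (1 + s * Y) *: row (J k) 1%:M - (s * eps * la) *: beta.
  by apply/rowP => i; rewrite !mxE.
have bW : beta *m tangent_fields x = D *: b - dpoly F x b *: p.
  rewrite /b dpoly_mul; apply/rowP => l; rewrite !mxE mulr_sumr mulr_suml -sumrB.
  by apply: eq_bigr => i _; rewrite !mxE -/D; ring.
have jW : row (J k) 1%:M *m tangent_fields x = D *: w - dpoly F x w *: p.
  by rewrite -row_mul mul1mx rowK.
rewrite rM mulmxBl -!scalemxAl bW jW.
have ux : row k u *m x = (D * sigma k ord0 ord0) *: x.
  by apply/rowP => l; rewrite !mxE big_ord1 !mxE.
rewrite ux.
set a := sigma k ord0 ord0; set c := sigma k ord0 ord_max.
have xE : x = (x0 + eps *: b) + Y *: (p + (s * eps) *: b).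
  by rewrite /x /line_point row0_two_rows row1_two_rows.
have VkE : row k V = a *: x + (c - a * Y) *: (p + (s * eps) *: b) + (1 + s * Y) *: w.
  rewrite VE !mul_pair !row0_two_rows !row1_two_rows xE -/a -/c -/w -/b !mxE /=.
  move: (x0 + eps *: b) (p + (s * eps) *: b) => r0 r1; clearbody w a c.
  by apply/rowP => l; rewrite !mxE; ring.
clearbody x.
have cE : c - a * Y = - la.
  have := FV k; rewrite VkE !(dpolyD, dpolyZ) xx mulr0 add0r -laK -mulrDl => /eqP.
  by rewrite mulf_eq0 (negPf K0) orbF addr_eq0 => /eqP.
rewrite VkE cE; apply/rowP => l; rewrite !mxE.
have E : (1 + s * Y) * (D * w ord0 l - dpoly F x w * p ord0 l) =
    (1 + s * Y) * D * w ord0 l - la * (D + s * eps * dpoly F x b) * p ord0 l.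
  by rewrite laK; ring.
move: E; rewrite !mxE => ->.
move: (p ord0 l) (x ord0 l) (B _ l) (dpoly F x b) => *; ring.
Qed.

End MovingLine.

(** * Leading terms of the trace *)
Section LowOrder.
Variables (C : numClosedFieldType) (n : nat).

Lemma cvg_horner (T : Type) (G : set_system T) {FG : Filter G} (u : {poly C}) (f : T -> C) (a : C) :
  f x @[x --> G] --> a -> u.[f x] @[x --> G] --> u.[a].
Proof.
move=> fa; rewrite horner_coef; under eq_fun do rewrite horner_coef.
apply: cvg_sum_seq => i; apply: cvgM; first exact: cvg_cst.
exact: cvg_exp.
Qed.

(** A polynomial vanishing to order [h] at the origin, restricted to a line through
the origin: its leading coefficient is its homogeneous part of degree [h]. *)
Lemma low_order_expansion (m : mpoly n C) h (beta : 'rV[C]_n) :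
  (forall mu, (mdeg mu < h)%N -> mcoeff mu m = 0) ->
  exists u : {poly C}, (forall e, meval ((e *: beta) ord0) m = e ^+ h * u.[e]) /\
    u.[0] = meval (beta ord0) (pihomog mdeg h m).
Proof.
move=> low; pose v (mu : multinom n) : C := meval (beta ord0) (mpolyX C mu).
exists (\sum_(mu <- msupp m) (mcoeff mu m * v mu) *: 'X^(mdeg mu - h)); split=> [e|].
  rewrite {1}[m]mpolyE raddf_sum horner_sum mulr_sumr; apply: eq_big_seq => mu mum.
  have hmu : (h <= mdeg mu)%N.
    by rewrite leqNgt; apply: contraTN mum => /low E; rewrite mcoeff_msupp E eqxx.
  rewrite /= mevalZ hornerZ hornerXn mulrCA -mulrA; congr (_ * _).
  rewrite -exprD subnKC // mulrC /v !mevalX mdegE -prodrXr -big_split /=.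
  by apply: eq_bigr => i _; rewrite mxE exprMn.
rewrite pihomogE raddf_sum horner_sum [RHS]big_mkcond /=.
apply: eq_big_seq => mu mum.
have hmu : (h <= mdeg mu)%N.
  by rewrite leqNgt; apply: contraTN mum => /low E; rewrite mcoeff_msupp E eqxx.
rewrite hornerZ hornerXn; case: eqP => E; first by rewrite E subnn expr0 mulr1 mevalZ.
rewrite expr0n subn_eq0 leqNgt ltn_neqAle hmu andbT.
by case: eqP E => [->|_]; rewrite ?mulr0.
Qed.

Lemma homogeneous_part_coefficient (m : mpoly n C) mu : mcoeff mu (pihomog mdeg (mdeg mu) m) = mcoeff mu m.
Proof.
rewrite pihomogE {3}[m]mpolyE !linear_sum /= [LHS]big_mkcond /=; apply: eq_bigr => nu _.
case: eqP => // E; rewrite mcoeffZ mcoeffX; case: (nu =P mu) => [H|]; last by rewrite mulr0.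
by case: E; rewrite H.
Qed.

End LowOrder.

Section LeadingTerms.
Variables (C : numClosedFieldType) (n d q : nat) (F : hpoly C n).
Local Notation vec := 'rV[C]_(n.+2).
Local Notation pair := 'M[C]_(2, n.+2).
Variables (x0 p : vec) (B : 'M[C]_(n, n.+2)) (y : 'I_d -> C).
Variables (P : {ffun multi_index n q -> hpoly C n}) (g : hpoly C n).
Hypotheses (homF : homogeneous d F) (Fp : peval F p != 0) (rk : \rank (two_rows x0 p) = 2%N)
  (yinj : injective y) (Fy : forall j, peval F (x0 + y j *: p) = 0)
  (gy : forall j, peval g (x0 + y j *: p) != 0) (eulP : forall x, euler_free P x).
Hypothesis trace0 : forall t xi, \rank t = 2%N -> intersection_points F t xi ->
  (forall j : 'I_d, peval g (xi j t) != 0) ->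
  forall tau : 'I_q -> pair, trace_at P g xi t tau = 0.
Variable r : {ffun 'I_q -> 'I_n} -> {poly mpoly n C}.
Hypothesis (rsize : forall f, (size (r f) <= d)%N).
Hypothesis (rP : forall f b Y, peval F (x0 + b *m B + Y *: p) = 0 ->
  (map_poly (meval (b ord0)) (r f)).[Y] =
  polyform_at P (x0 + b *m B + Y *: p) (rowsub f (tangent_fields F p B (x0 + b *m B + Y *: p)))).

Let weight j : C := (peval g (x0 + y j *: p) * dpoly F (x0 + y j *: p) p ^+ q)^-1.

Lemma transverse_derivative j : dpoly F (x0 + y j *: p) p != 0.
Proof.
have Ft : peval F (row ord_max (two_rows x0 p)) != 0 by rewrite row1_two_rows.
have [sf _] := restriction_size homF Ft.
have fy k : (restriction F (two_rows x0 p)).[y k] = 0.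
  by rewrite horner_restriction /line_point row0_two_rows row1_two_rows.
have := distinct_roots_simple sf yinj fy j.
by rewrite /restriction horner_deriv_on_line row0_two_rows row1_two_rows.
Qed.

Let Dy := transverse_derivative.

(** The trace at [moving_line x0 p s e b], on the directions [row (J k) B], is divided
by [e ^+ h] and [e] tends to zero. In the limit [motion_matrix] is
[(1 + s * y j)] times the selection of the indices [J], whence the exponent [q], and
the points of intersection have coordinates [e * (1 + s * y j) *: beta] along [B] to
first order, whence the exponent [h]. *)
Lemma leading_terms h : (forall f mu i, (mdeg mu < h)%N -> mcoeff mu (r f)`_i = 0) ->
  forall J (s : C) (beta : 'rV[C]_n), \sum_j weight j * (1 + s * y j) ^+ (q + h) *
    \sum_(i < d) meval (beta ord0) (pihomog mdeg h (r J)`_i) * y j ^+ i = 0.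
Proof.
move=> low J s beta; pose b := beta *m B.
have /choice[u uP] (fi : {ffun 'I_q -> 'I_n} * 'I_d) := low_order_expansion beta (fun mu => low fi.1 mu fi.2).
pose t0 := two_rows x0 p; have rk0 : \rank t0 = 2%N := rk.
have Ft0 : peval F (row ord_max t0) != 0 by rewrite row1_two_rows.
have lp0 z : line_point t0 z = x0 + z *: p by rewrite /line_point row0_two_rows row1_two_rows.
have Fy0 j : peval F (line_point t0 (y j)) = 0 by rewrite lp0.
have [Y [Yy Yc ip]] := sections_exist homF rk0 yinj Ft0 Fy0.
pose te (e : C) := moving_line x0 p s e b.
have idc : e @[e --> (0 : C)^'] --> (0 : C) by apply: cvg_within.
have cst (T : topologicalType) (a : T) : (fun=> a) @ (0 : C)^' --> a by exact: (@cvg_cst _ a _ _ (dnbhs_filter (0 : C))).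
have te_cvg : te e @[e --> (0 : C)^'] --> t0.
  have E e : te e = t0 + e *: two_rows b (s *: b).
    apply/row_matrixP => i; rewrite linearD linearZ /=.
    have [->|i0] := eqVneq (i : 'I_2) ord0; first by rewrite !row0_two_rows.
    have -> : i = ord_max :> 'I_2 by apply: val_inj; case: i i0 => [[|[|]]].
    by rewrite !row1_two_rows scalerA [e * s]mulrC.
  have := cvgD (cst _ t0) (cvgZ idc (cst _ (two_rows b (s *: b)))).
  rewrite scale0r addr0 => H; under eq_fun do rewrite E; exact: H.
have Y_cvg j : Y j (te e) @[e --> (0 : C)^'] --> y j.
  rewrite -(Yy j); exact: (@continuous_cvg _ _ _ _ (dnbhs_filter (0 : C)) te (Y j) t0 (Yc j) te_cvg).
pose z e j := e * (1 + s * Y j (te e)).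
have sY_cvg j : 1 + s * Y j (te e) @[e --> (0 : C)^'] --> 1 + s * y j.
  exact: cvgD (cst _ (1 : C)) (cvgM (cst _ s) (Y_cvg j)).
have z_cvg j : z e j @[e --> (0 : C)^'] --> (0 : C).
  have := cvgM idc (sY_cvg j); rewrite mul0r; exact.
pose X e j := line_point (te e) (Y j (te e)).
have XE e j : X e j = x0 + (z e j *: beta) *m B + Y j (te e) *: p.
  by rewrite /X moving_line_point -scalemxAl.
have X_cvg j : X e j @[e --> (0 : C)^'] --> x0 + y j *: p.
  have := cvgD (cvgD (cst _ x0) (cvgZ (z_cvg j) (cst _ b))) (cvgZ (Y_cvg j) (cst _ p)).
  rewrite scale0r addr0 => H; under eq_fun do rewrite XE -scalemxAl; exact: H.
have d_cvg j w : dpoly F (X e j) w @[e --> (0 : C)^'] --> dpoly F (x0 + y j *: p) w.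
  rewrite -peval_dirderiv; under eq_fun do rewrite -peval_dirderiv; exact: cvg_peval (X_cvg j).
have g_cvg j : peval g (X e j) @[e --> (0 : C)^'] --> peval g (x0 + y j *: p) by exact: cvg_peval (X_cvg j).
pose K e j := dpoly F (X e j) p + s * e * dpoly F (X e j) b.
have K_cvg j : K e j @[e --> (0 : C)^'] --> dpoly F (x0 + y j *: p) p.
  have := cvgD (d_cvg j p) (cvgM (cvgM (cst _ s) idc) (d_cvg j b)).
  rewrite mulr0 mul0r addr0; exact.
pose M e j := motion_matrix F p B J beta s e (Y j (te e)) (X e j).
have M_cvg j k i : M e j k i @[e --> (0 : C)^'] --> (1 + s * y j) * (J k == i)%:R.
  have la : slope F p s e (Y j (te e)) b (X e j) (row (J k) B) @[e --> (0 : C)^'] -->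
      (1 + s * y j) * dpoly F (x0 + y j *: p) (row (J k) B) / dpoly F (x0 + y j *: p) p.
    exact: cvgM (cvgM (sY_cvg j) (d_cvg j (row (J k) B))) (cvgV (Dy j) (K_cvg j)).
  have := cvgB (cvgM (sY_cvg j) (cst _ ((J k == i)%:R : C)))
     (cvgM (cvgM (cvgM (cst _ s) idc) la) (cst _ (beta ord0 i))).
  rewrite mulr0 !mul0r subr0 => H; under eq_fun do rewrite mxE; exact: H.
(* The trace divided by [e ^+ h], written without division so as to have a limit. *)
pose H e := \sum_j (peval g (X e j) * dpoly F (X e j) p ^+ q)^-1 *
  \sum_(f : {ffun 'I_q -> 'I_n}) (\prod_k M e j k (f k)) *
    ((1 + s * Y j (te e)) ^+ h * \sum_(i < d) (u (f, i)).[z e j] * Y j (te e) ^+ i).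
pose L := \sum_j weight j * \sum_(f : {ffun 'I_q -> 'I_n}) (\prod_k ((1 + s * y j) * (J k == f k)%:R)) *
    ((1 + s * y j) ^+ h * \sum_(i < d) (u (f, i)).[0] * y j ^+ i).
have H_cvg : H e @[e --> (0 : C)^'] --> L.
  apply: (@cvg_sum_seq _ _ _ _ (dnbhs_filter (0 : C))) => j; apply: cvgM.
    apply: cvgV; first by rewrite mulf_neq0 ?expf_neq0.
    by apply: cvgM => //; apply: (@cvg_exp _ _ _ (dnbhs_filter (0 : C))).
  apply: (@cvg_sum_seq _ _ _ _ (dnbhs_filter (0 : C))) => f; apply: cvgM.
    by apply: (@cvg_prod_seq _ _ _ (dnbhs_filter (0 : C))) => k; exact: M_cvg.
  apply: cvgM; first by apply: (@cvg_exp _ _ _ (dnbhs_filter (0 : C))).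
  apply: (@cvg_sum_seq _ _ _ _ (dnbhs_filter (0 : C))) => i; apply: cvgM.
    by apply: (@cvg_horner _ _ _ (dnbhs_filter (0 : C))).
  by apply: (@cvg_exp _ _ _ (dnbhs_filter (0 : C))).
have H0 : \forall e \near (0 : C)^', H e = 0.
  pose xi j t := line_point t (Y j t).
  have ipe : \forall e \near (0 : C)^', intersection_points F (te e) xi := te_cvg _ (near_join ip).
  have re : \forall e \near (0 : C)^', \rank (te e) = 2%N.
    have [B' tB] := rank2_inverse rk0.
    have dc : \det (te e *m B') @[e --> (0 : C)^'] --> (1 : C).
      by rewrite -(det1 C 2) -tB; apply: cvg_det; apply: cvg_mulmx te_cvg (cst _ B').
    have dn : \forall e \near (0 : C)^', \det (te e *m B') != 0 by exact: cvgr_neq0 dc (oner_neq0 C).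
    move: dn; apply: (@filterS _ _ (dnbhs_filter (0 : C))) => e.
    exact: det_rank2.
  have gne : \forall e \near (0 : C)^', forall j, peval g (X e j) != 0.
    by apply: (@near_forall _ _ (dnbhs_filter (0 : C)) _ (fun j e => peval g (X e j) != 0)) => j; exact: cvgr_neq0 (g_cvg j) (gy j).
  have Dne : \forall e \near (0 : C)^', forall j, dpoly F (X e j) p != 0.
    by apply: (@near_forall _ _ (dnbhs_filter (0 : C)) _ (fun j e => dpoly F (X e j) p != 0)) => j; exact: cvgr_neq0 (d_cvg j p) (Dy j).
  have Kne : \forall e \near (0 : C)^', forall j, K e j != 0.
    by apply: (@near_forall _ _ (dnbhs_filter (0 : C)) _ (fun j e => K e j != 0)) => j; exact: cvgr_neq0 (K_cvg j) (Dy j).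
  have ene : \forall e \near (0 : C)^', e != 0 by exact: nbhs_dnbhs_neq.
  (* From here on, a displacement [e] for which all of this holds. *)
  apply: (@filter_app _ _ (dnbhs_filter (0 : C)) _ _ _ ene); apply: (@filter_app _ _ (dnbhs_filter (0 : C)) _ _ _ Kne).
  apply: (@filter_app _ _ (dnbhs_filter (0 : C)) _ _ _ Dne); apply: (@filter_app _ _ (dnbhs_filter (0 : C)) _ _ _ gne).
  apply: (@filter_app _ _ (dnbhs_filter (0 : C)) _ _ _ re); apply: (@filter_app _ _ (dnbhs_filter (0 : C)) _ _ _ ipe).
  apply: (@filterE _ _ (dnbhs_filter (0 : C))) => e {}ipe {}re {}gne {}Dne {}Kne {}ene.
  pose tau k := two_rows (row (J k) B) (s *: row (J k) B).
  have T := trace0 re ipe gne tau.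
  have [dxi xi0 _ xiP] := nbhs_singleton ipe.
  have near j : \forall t \near te e, (xi j t <= t)%MS /\ peval F (xi j t) = 0.
    move: ipe; apply: (@filterS _ _ (nbhs_filter (te e))) => t [_ x0' _ /(_ (xi j t) (x0' j)) [_ Q]].
    by have [] := Q (ex_intro _ j (submx_refl _)).
  have FX j : peval F (X e j) = 0 by have [] := nbhs_singleton (near j).
  pose V j := \matrix_(k < q) 'd (xi j) (te e) (tau k).
  have VE j : dpoly F (X e j) p ^+ q * polyform_at P (X e j) (V j) =
      \sum_(f : {ffun 'I_q -> 'I_n}) (\prod_k M e j k (f k)) *
        polyform_at P (X e j) (rowsub f (tangent_fields F p B (X e j))).
    have [s' s'E s'P] := section_tangent re (dxi j) (near j).
    have {}s'E : s' = \row_i (if i == ord0 then 1 else Y j (te e)).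
      apply/eqP; rewrite -subr_eq0; apply/eqP/(combination_eq0 re).
      by rewrite mulmxBl -s'E -line_pointE subrr.
    have /choice[sigma sigmaP] k := s'P (tau k).
    apply: (moving_section (sigma := sigma)) => //.
    - exact: euler_on_hypersurface homF (FX j).
    - exact: Kne.
    - by move=> k; rewrite rowK sigmaP s'E.
    - by move=> k; rewrite rowK; apply: section_dpoly (dxi j) (near j) _.
  have rE j (f : {ffun 'I_q -> 'I_n}) : polyform_at P (X e j) (rowsub f (tangent_fields F p B (X e j))) =
      e ^+ h * ((1 + s * Y j (te e)) ^+ h * \sum_(i < d) (u (f, i)).[z e j] * Y j (te e) ^+ i).
    have FX' := FX j; rewrite XE in FX'.
    rewrite XE -rP // (@horner_coef_wide _ d); last by apply: leq_trans (size_poly _ _) (rsize f).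
    rewrite mulrA -exprMn mulr_sumr; apply: eq_bigr => i _.
    by rewrite coef_map /= (uP (f, i)).1 mulrA.
  apply: (mulfI (expf_neq0 h ene)); rewrite mulr0 -[RHS]T /H mulr_sumr; apply: eq_bigr => j _.
  have -> : form_at P g (xi j (te e)) (V j) =
      (peval g (X e j) * dpoly F (X e j) p ^+ q)^-1 * (dpoly F (X e j) p ^+ q * polyform_at P (X e j) (V j)).
    have g1 := gne j; have D1 := expf_neq0 q (Dne j).
    rewrite /form_at -/(X e j); move: (polyform_at _ _ _) (peval g _) (_ ^+ q) g1 D1 => a b1 c b10 c0.
    by field; rewrite b10 c0.
  rewrite VE mulrCA; congr (_ * _); rewrite mulr_sumr; apply: eq_bigr => f _.
  by rewrite rE mulrCA.
have L0 : L = 0.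
  have T0 : H e @[e --> (0 : C)^'] --> (0 : C).
    apply: cvg_trans (cst _ (0 : C)); apply: near_eq_cvg.
    by move: H0; apply: (@filterS _ _ (dnbhs_filter (0 : C))) => e ->.
  by apply: (cvg_unique _ H_cvg T0); exact: norm_hausdorff.
rewrite -[RHS]L0; apply: eq_bigr => j _.
rewrite -mulrA; congr (_ * _); rewrite [RHS](bigD1 J) //= [X in _ = _ + X]big1 => [|f fJ].
  rewrite addr0 exprD -mulrA; congr (_ * _).
    under eq_bigr do rewrite eqxx mulr1.
    by rewrite prodr_const card_ord.
  by congr (_ * _); apply: eq_bigr => i _; rewrite (uP (J, i)).2.
have [k Nk] : exists k, J k != f k.
  by apply/existsP; apply: contraNT fJ => /existsPn E; apply/eqP/ffunP => k; apply/esym/eqP/negPn/E.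
by rewrite (bigD1 k) //= (negPf Nk) mulr0 !mul0r.
Qed.

End LeadingTerms.

(** * Moments and interpolation *)
Section Moments.
Variables (C : numFieldType) (d : nat) (y a : 'I_d -> C).

Lemma power_sums_vanish k : (forall s, \sum_j a j * (1 + s * y j) ^+ k = 0) ->
  forall m, (m <= k)%N -> \sum_j a j * y j ^+ m = 0.
Proof.
move=> Hs m mk; pose Q : {poly C} := \sum_j a j *: (1 + y j *: 'X) ^+ k.
have Q0 : Q = 0.
  apply: poly_eval0 => s; rewrite horner_sum -[RHS](Hs s); apply: eq_bigr => j _.
  by rewrite !hornerE (mulrC (y j)).
have := congr1 (fun p : {poly C} => p`_m) Q0; rewrite /= coef0 /Q coef_sum.
have E j : (a j *: (1 + y j *: 'X) ^+ k)`_m = (a j * y j ^+ m) * ('C(k, m))%:R.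
  rewrite coefZ exprDn coef_sum (bigD1 (Ordinal (leq_ltn_trans mk (ltnSn k)))) //= big1 => [|i im].
    by rewrite addr0 expr1n mul1r coefMn exprZn coefZ coefXn eqxx mulr1 mulr_natr mulrnAr.
  rewrite expr1n mul1r coefMn exprZn coefZ coefXn.
  have -> : (m == i) = false by apply: contraNF im => /eqP mi; apply/eqP/val_inj.
  by rewrite mulr0 mul0rn.
rewrite (eq_bigr _ (fun j _ => E j)) -mulr_suml => /eqP; rewrite mulf_eq0 pnatr_eq0 -leqn0 leqNgt bin_gt0 mk orbF => /eqP.
exact.
Qed.

(** At most [k + 1] of the weights are nonzero, so a polynomial of degree at most [k]
singles out any one of them. *)
Lemma vanishing_moments k : injective y ->
  (forall m, (m <= k)%N -> \sum_j a j * y j ^+ m = 0) ->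
  (forall j : 'I_d, (j < d - k.+1)%N -> a j = 0) -> forall j, a j = 0.
Proof.
move=> yinj Hm low j0; have [/low //|j0k] := ltnP j0 (d - k.+1).
pose S (i : 'I_d) := (d - k.+1 <= i)%N && (i != j0).
pose phi : {poly C} := \prod_(i | S i) ('X - (y i)%:P).
have sphi : (size phi <= k.+1)%N.
  rewrite /phi -big_filter size_prod_XsubC ltnS -sum1_size big_filter sum1_card.
  have c1 : (#|[pred i : 'I_d | (d - k.+1 <= i)%N]| <= k.+1)%N.
    rewrite -sum1_card (eq_bigl (fun i : 'I_d => true && (d - k.+1 <= i)%N)) // -(big_geq_mkord _ _ xpredT (fun=> 1%N)).
    by rewrite sum_nat_const_nat muln1; lia.
  rewrite -ltnS; apply: leq_trans c1; apply: proper_card; apply/fintype.properP; split.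
    by apply/fintype.subsetP => i; rewrite !unfold_in /= => /andP[].
  by exists j0; rewrite !unfold_in /= /S ?eqxx ?andbF.
have : \sum_j a j * phi.[y j] = 0.
  under eq_bigr do rewrite (horner_coef_wide _ sphi) mulr_sumr.
  rewrite exchange_big big1 // => m _.
  under eq_bigr do rewrite mulrCA.
  by rewrite -mulr_sumr Hm ?mulr0 // -ltnS.
rewrite (bigD1 j0) //= big1 => [|j jj0].
  rewrite addr0 => /eqP; rewrite mulf_eq0 => /orP[/eqP //|].
  rewrite horner_prod => /prodf_eq0 [i /andP[_ ij0]].
  by rewrite hornerXsubC subr_eq0 (inj_eq yinj) eq_sym (negPf ij0).
have [jl|jk] := ltnP j (d - k.+1); first by rewrite low ?mul0r.
have Sj : S j by rewrite /S jk.
by rewrite /phi (bigD1 j Sj) /= hornerM hornerXsubC subrr mul0r mulr0.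
Qed.

End Moments.

(** * Remainders modulo the equation *)
Section RemaindersVanish.
Variables (C : numClosedFieldType) (n d q : nat) (F : hpoly C n).
Local Notation vec := 'rV[C]_(n.+2).
Local Notation pair := 'M[C]_(2, n.+2).
Variables (x0 p : vec) (B : 'M[C]_(n, n.+2)) (y : 'I_d -> C).
Variables (P : {ffun multi_index n q -> hpoly C n}) (g : hpoly C n).
Hypotheses (homF : homogeneous d F) (Fp : peval F p != 0) (rk : \rank (two_rows x0 p) = 2%N)
  (yinj : injective y) (Fy : forall j, peval F (x0 + y j *: p) = 0)
  (gy : forall j, peval g (x0 + y j *: p) != 0) (eulP : forall x, euler_free P x).
Hypothesis trace0 : forall t xi, \rank t = 2%N -> intersection_points F t xi ->
  (forall j : 'I_d, peval g (xi j t) != 0) ->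
  forall tau : 'I_q -> pair, trace_at P g xi t tau = 0.

Definition taylor_coefficient (rho : {poly mpoly n C}) mu : {poly C} := map_poly (mcoeff mu) rho.

(** A representative [rho], of degree less than [d] in the last coordinate, of the value
of the form on the tangent fields with indices [f], as a function on the
hypersurface. *)
Definition remainder_of (f : 'I_q -> 'I_n) (rho : {poly mpoly n C}) : Prop :=
  (size rho <= d)%N /\ forall (b : 'rV[C]_n) Y, peval F (x0 + b *m B + Y *: p) = 0 ->
  (map_poly (meval (b ord0)) rho).[Y] =
  polyform_at P (x0 + b *m B + Y *: p) (rowsub f (tangent_fields F p B (x0 + b *m B + Y *: p))).

(** The linear conditions imposed on the remainders. The number of points at which a
coefficient is required to vanish, [d - q - 1] at order zero, decreases with its order,
as the number of moment conditions given by the trace increases. *)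
Definition normalized (rho : {poly mpoly n C}) : Prop :=
  forall mu (j : 'I_d), (j + mdeg mu < d - q.+1)%N -> (taylor_coefficient rho mu).[y j] = 0.

(** By alternation, increasing indices suffice. *)
Lemma remainder_of_any : (forall J : {ffun 'I_q -> 'I_n}, increasing J ->
    exists2 rho, remainder_of J rho & normalized rho) ->
  forall f : {ffun 'I_q -> 'I_n}, exists2 rho, remainder_of f rho & normalized rho.
Proof.
move=> H f; have [/injectiveP finj|/injectivePn[i [j ij fij]]] := boolP (injectiveb f); last first.
  exists 0; first split=> [|b Y _]; first by rewrite size_poly0.
    by rewrite rmorph0 horner0 (polyform_rowsub_noninjective _ _ _ ij fij).
  by move=> mu k _; rewrite /taylor_coefficient map_poly0 horner0.
have [J [s [/increasingP incJ fJ]]] := sort_injection finj.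
have [rho [srho rhoP] nrho] := H J incJ.
exists ((-1) ^+ s *: rho); first split=> [|b Y FY].
- by apply: leq_trans (size_scale_leq _ _) srho.
- rewrite (_ : rowsub f _ = rowsub (J \o s) (tangent_fields F p B (x0 + b *m B + Y *: p))); last first.
    by apply/matrixP => a c; rewrite !mxE fJ.
  by rewrite polyform_rowsub_perm -rhoP // map_polyZ hornerZ rmorph_sign.
move=> mu k kmu; have := nrho mu k kmu; rewrite /taylor_coefficient => E.
have -> : map_poly (mcoeff mu) ((-1) ^+ s *: rho) = (-1) ^+ s *: map_poly (mcoeff mu) rho.
  apply/polyP => i; rewrite coefZ !coef_map /= coefZ.
  by case: (odd_perm s); rewrite ?expr0 ?expr1 ?mul1r ?mulN1r ?mcoeffN.
by rewrite hornerZ E mulr0.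
Qed.

(** Induction on the order of vanishing along the line through [x0] and [p]: at order [h]
the leading coefficients, weighted at the [d] points of intersection, have vanishing
moments of orders up to [q + h], and are therefore determined by their values at the
first [d - q - h - 1] points. *)
Lemma remainders_vanish (r : {ffun 'I_q -> 'I_n} -> {poly mpoly n C}) :
  (forall f : {ffun 'I_q -> 'I_n}, remainder_of f (r f)) -> (forall f, normalized (r f)) -> forall f, r f = 0.
Proof.
move=> rR rN; pose w j : C := (peval g (x0 + y j *: p) * dpoly F (x0 + y j *: p) p ^+ q)^-1.
have w0 j : w j != 0.
  by rewrite invr_eq0 mulf_neq0 ?expf_neq0 // (transverse_derivative homF Fp yinj Fy).
have tE (rho : {poly mpoly n C}) mu z : (size rho <= d)%N -> (taylor_coefficient rho mu).[z] = \sum_(i < d) mcoeff mu rho`_i * z ^+ i.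
  move=> sr; rewrite (@horner_coef_wide _ d); last by apply: leq_trans (size_poly _ _) sr.
  by apply: eq_bigr => i _; rewrite coef_map.
suff low h : forall f mu i, (mdeg mu < h)%N -> mcoeff mu (r f)`_i = 0.
  move=> f; apply/polyP => i; rewrite coef0; apply/mpolyP => mu; rewrite mcoeff0.
  exact: (low (mdeg mu).+1).
elim: h => [//|h IH] f mu i; rewrite ltnS leq_eqVlt => /orP[/eqP muh|]; last exact: IH.
have [srf _] := rR f.
have Hs s : \sum_j (w j * (taylor_coefficient (r f) mu).[y j]) * (1 + s * y j) ^+ (q + h) = 0.
  pose Z : mpoly n C := \sum_j (w j * (1 + s * y j) ^+ (q + h)) *:
    \sum_(i < d) y j ^+ i *: pihomog mdeg h (r f)`_i.
  have Z0 : Z = 0.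
    apply: mpoly_eval0 => x; pose beta : 'rV[C]_n := \row_i x i.
    have bx m : meval x m = meval (beta ord0) m by apply: meval_eq => l; rewrite mxE.
    rewrite bx -[RHS](leading_terms homF Fp rk yinj Fy gy eulP trace0 (fun f => (rR f).1) (fun f => (rR f).2) IH f s beta).
    rewrite raddf_sum; apply: eq_bigr => j _; rewrite /= mevalZ raddf_sum; congr (_ * _).
    by apply: eq_bigr => l _; rewrite /= mevalZ mulrC.
  rewrite -[RHS](mcoeff0 _ mu) -Z0 raddf_sum; apply: eq_bigr => j _.
  rewrite /= mcoeffZ mulrAC; congr (_ * _); rewrite tE // raddf_sum; apply: eq_bigr => l _.
  by rewrite /= mcoeffZ mulrC -muh homogeneous_part_coefficient.
have tz j : (taylor_coefficient (r f) mu).[y j] = 0.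
  have := vanishing_moments yinj (power_sums_vanish Hs) _ j => H.
  apply: (mulfI (w0 j)); rewrite mulr0; apply: H => k kd.
  by rewrite rN ?mulr0 // muh; lia.
have t0 : taylor_coefficient (r f) mu = 0.
  by apply: (poly_too_many_roots yinj tz); apply: leq_trans (size_poly _ _) srf.
by have := congr1 (fun u : {poly C} => u`_i) t0; rewrite /= coef0 coef_map.
Qed.

End RemaindersVanish.

(** * Counting the conditions *)
Section RemainderExistence.
Variables (C : numClosedFieldType) (n d q : nat) (F : hpoly C n).
Variables (x0 p : 'rV[C]_(n.+2)) (B : 'M[C]_(n, n.+2)).
Hypotheses (homF : homogeneous d F) (Fp : peval F p = 1).
Implicit Types (P : {ffun multi_index n q -> hpoly C n}).

Definition tangent_field_polynomials : 'M[hpoly C n]_(n, n.+2) :=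
  \matrix_(k, l) (mpolyC _ (B k l) * dirderiv p F - mpolyC _ (p ord0 l) * dirderiv (row k B) F).

Lemma eval_tangent_fields (x : 'rV[C]_(n.+2)) : map_mx (meval (x ord0)) tangent_field_polynomials = tangent_fields F p B x.
Proof.
apply/matrixP => k l; rewrite !mxE -[LHS]/(peval _ x).
have pevalB (G H : hpoly C n) : peval (G - H) x = peval G x - peval H x by apply: rmorphB.
by rewrite pevalB !pevalM !pevalC !peval_dirderiv [B k l * _]mulrC [p ord0 l * _]mulrC.
Qed.

(** Division by the equation, which is monic in the chart. *)
Lemma remainder_exists P (f : 'I_q -> 'I_n) : exists rho, remainder_of d F x0 p B P f rho.
Proof.
pose N : hpoly C n := \sum_I P I * \det (colsub (val I) (rowsub f tangent_field_polynomials)).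
have NE x : peval N x = polyform_at P x (rowsub f (tangent_fields F p B x)).
  rewrite peval_sum; apply: eq_bigr => I _; rewrite pevalM; congr (_ * _).
  rewrite /peval -det_map_mx -eval_tangent_fields; congr (\det _).
  by apply/matrixP => i j; rewrite !mxE.
have [mF sF] := chart_homogeneous x0 B homF Fp.
have E := Pdiv.RingMonic.rdivp_eq mF (chart x0 B p N).
exists (Pdiv.CommonRing.rmodp (chart x0 B p N) (chart x0 B p F)); split.
  by have := Pdiv.Ring.ltn_rmodpN0 (chart x0 B p N) (monic_neq0 mF); rewrite sF ltnS.
move=> b Y FX; rewrite -NE -horner_chart [in RHS]E rmorphD rmorphM hornerD hornerM /=.
by rewrite horner_chart FX mulr0 add0r.
Qed.

Lemma remainder_linear_combination m (c : 'I_m -> C) (P : 'I_m -> {ffun multi_index n q -> hpoly C n})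
    (f : 'I_q -> 'I_n) (rho : 'I_m -> {poly mpoly n C}) :
  (forall i, remainder_of d F x0 p B (P i) f (rho i)) ->
  remainder_of d F x0 p B [ffun I => \sum_i c i *: P i I] f (\sum_i mpolyC n (c i) *: rho i).
Proof.
move=> H; split.
  apply: (big_ind (fun r : {poly mpoly n C} => size r <= d)%N) => [|u v su sv|i _].
  - by rewrite size_poly0.
  - by apply: leq_trans (size_polyD _ _) _; rewrite geq_max su.
  - by apply: leq_trans (size_scale_leq _ _) (H i).1.
move=> b Y FX; rewrite polyform_linear_combination raddf_sum horner_sum; apply: eq_bigr => i _.
by rewrite /= map_polyZ hornerZ /= mevalC (H i).2.
Qed.

Lemma taylor_linear_combination m (c : 'I_m -> C) (rho : 'I_m -> {poly mpoly n C}) mu :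
  taylor_coefficient (\sum_i mpolyC n (c i) *: rho i) mu = \sum_i c i *: taylor_coefficient (rho i) mu.
Proof.
apply/polyP => k; rewrite coef_map coef_sum raddf_sum coef_sum; apply: eq_bigr => i _.
by rewrite /= !coefZ mcoeffCM coef_map.
Qed.

End RemainderExistence.

(** A homogeneous linear system with more unknowns than equations. *)
Lemma common_zero (K : fieldType) (I : finType) N (phi : 'I_N.+1 -> I -> K) : (#|I| <= N)%N ->
  exists2 c : 'rV[K]_N.+1, c != 0 & forall t, \sum_i c ord0 i * phi i t = 0.
Proof.
move=> IN; pose A : 'M[K]_(N.+1, #|I|) := \matrix_(i, k) phi i (enum_val k).
have k0 : kermx A != 0.
  rewrite -mxrank_eq0 mxrank_ker subn_eq0 -ltnNge ltnS.
  exact: leq_trans (rank_leq_col A) IN.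
exists (nz_row (kermx A)); first by rewrite nz_row_eq0.
move=> t; have := congr1 (fun M : 'rV[K]__ => M ord0 (enum_rank t)) (sub_kermxP (nz_row_sub (kermx A))).
rewrite !mxE => E; rewrite -[RHS]E; apply: eq_bigr => i _.
by rewrite [in RHS]mxE enum_rankK.
Qed.

(** The number of pairs: monomials in [n] variables times powers of one more, of
total degree less than [d - q - 1]; homogenized by one more variable, these are all the
monomials of degree [d - q - 2] in [n + 2] variables. *)
Lemma conditions_count n d q : exists nu : 'I_('C(d + n - q - 1, n + 1)) -> nat * multinom n,
  forall j mu, (j + mdeg mu < d - q.+1)%N -> exists i, nu i = (j, mu).
Proof.
have [dq|dq] := leqP (d - q.+1) 0.
  by exists (fun=> (0%N, mnm0)) => j mu; rewrite ltnNge (leq_trans dq).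
pose r := (d - q.+2)%N.
have -> : 'C(d + n - q - 1, n + 1) = 'C(r + n.+1, r).
  have -> : (d + n - q - 1 = r + n.+1)%N by rewrite /r; lia.
  have -> : (n + 1 = r + n.+1 - r)%N by lia.
  by rewrite bin_sub ?leq_addr.
have [m [_ _ mall]] := monomials_of_degree n.+1 r.
exists (fun i => (m i ord0, Multinom [tuple m i (lift ord0 (lift ord0 k)) | k < n])) => j mu jmu.
(* The exponent at index 1 is that of the homogenizing variable. *)
pose M := Multinom [tuple (if unlift ord0 i is Some i' then
   if unlift ord0 i' is Some k then mu k else (r - j - mdeg mu)%N else j) | i < n.+2].
have M0 : M ord0 = j by rewrite mnmE unlift_none.
have M1 : M (lift ord0 ord0) = (r - j - mdeg mu)%N by rewrite mnmE liftK unlift_none.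
have M2 k : M (lift ord0 (lift ord0 k)) = mu k by rewrite mnmE !liftK.
have dM : mdeg M = r.
  rewrite mdegE !big_ord_recl M0 M1 (eq_bigr mu) => [|k _]; last exact: M2.
  by rewrite -mdegE /r; lia.
have [i Ei] := mall M dM; exists i; rewrite Ei M0; congr (_, _).
by apply/mnmP => k; rewrite mnmE M2.
Qed.

(** * The upper bound *)
Section NullForms.
Variables (C : numClosedFieldType) (n d q : nat) (F : hpoly C n).
Local Notation vec := 'rV[C]_(n.+2).
Variables (x0 p : vec) (B : 'M[C]_(n, n.+2)) (B1 : 'M[C]_(n.+1, n.+2)).
Hypotheses (redF : reduced_equation d F) (Fp : peval F p = 1)
  (frame1 : (col_mx p B1 : 'M[C]_(1 + n.+1)) \in unitmx)
  (frame : (col_mx (two_rows x0 p) B : 'M[C]_(2 + n)) \in unitmx).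

Lemma adapted_frame (A : 'M[C]_(q, n.+2)) :
  exists (L : 'M[C]_(q, 2)) (beta : 'M[C]_(q, n)), A = L *m two_rows x0 p + beta *m B.
Proof.
pose a : 'M[C]_(q, 2 + n) := A *m invmx (col_mx (two_rows x0 p) B : 'M[C]_(2 + n)).
exists (lsubmx a), (rsubmx a).
by rewrite -mul_row_col hsubmxK /a mulmxKV.
Qed.

(** Where [dF(p)] is not zero, the tangent fields span the tangent space modulo the
Euler vector. *)
Lemma fields_span_tangent P x b Y (v : 'M[C]_(q, n.+2)) : x = x0 + b *m B + Y *: p ->
  euler_free P x -> dpoly F x x = 0 -> dpoly F x p != 0 ->
  (forall k, dpoly F x (row k v) = 0) ->
  (forall f : {ffun 'I_q -> 'I_n}, polyform_at P x (rowsub f (tangent_fields F p B x)) = 0) ->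
  polyform_at P x v = 0.
Proof.
move=> xE eP xx Dp tv Pf; have [L [beta vE]] := adapted_frame v.
apply: (mulfI (expf_neq0 q Dp)); rewrite mulr0 -polyform_scale.
pose gamma : 'M[C]_(q, n) := \matrix_(k, i) (beta k i - L k ord0 * b ord0 i).
pose u : 'cV[C]_q := \col_k (dpoly F x p * L k ord0).
have -> : dpoly F x p *: v = gamma *m tangent_fields F p B x + u *m x.
  apply/row_matrixP => k; rewrite linearZ linearD /= !row_mul.
  have gW : row k gamma *m tangent_fields F p B x =
      dpoly F x p *: (row k gamma *m B) - dpoly F x (row k gamma *m B) *: p.
    rewrite dpoly_mul; apply/rowP => l; rewrite !mxE mulr_sumr mulr_suml -sumrB.
    by apply: eq_bigr => i _; rewrite !mxE; ring.
  have gE : row k gamma = row k beta - L k ord0 *: b by apply/rowP => i; rewrite !mxE.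
  have ux : row k u *m x = (dpoly F x p * L k ord0) *: x.
    by apply/rowP => l; rewrite !mxE big_ord1 !mxE.
  have vk : row k v = L k ord0 *: x + (L k ord_max - L k ord0 * Y) *: p + row k gamma *m B.
    rewrite vE linearD /= !row_mul mul_pair row0_two_rows row1_two_rows ![row k L ord0 _]mxE gE mulmxBl -scalemxAl xE.
    by move: (b *m B) (row k beta *m B) => bB w; apply/rowP => l; rewrite !mxE; ring.
  have gd : dpoly F x (row k gamma *m B) = - ((L k ord_max - L k ord0 * Y) * dpoly F x p).
    have := tv k; rewrite vk 2!dpolyD 2!dpolyZ xx mulr0 add0r => /eqP.
    by rewrite addrC addr_eq0 => /eqP.
  rewrite ux gW gd vk; move: (row k gamma *m B) => w.
  by apply/rowP => l; rewrite !mxE; ring.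
rewrite (polyform_add_radial u _ eP) polyform_mul big1 // => f _.
by rewrite Pf mulr0.
Qed.

(** The numerator and denominator are multiplied by [dF(p)] and by the linear form of
the coordinate along [x0], so that only points of the chart with a transverse
direction [p] have to be considered. *)
Lemma vanishing_fields_null Phi P g j : form_on F Phi P g ->
  peval F (x0 + j *: p) = 0 -> dpoly F (x0 + j *: p) p != 0 ->
  (forall (f : {ffun 'I_q -> 'I_n}) b Y, peval F (x0 + b *m B + Y *: p) = 0 ->
     polyform_at P (x0 + b *m B + Y *: p) (rowsub f (tangent_fields F p B (x0 + b *m B + Y *: p))) = 0) ->
  null_form_on F Phi.
Proof.
have [F0 homF _] := redF.
move=> fP Fj Dj Pf.
pose M : 'M[C]_(2 + n) := col_mx (two_rows x0 p) B.
pose c : 'cV[C]_(n.+2) := col (lshift n (ord0 : 'I_2)) (invmx M).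
have Mc : M *m c = col (lshift n (ord0 : 'I_2)) 1%:M by rewrite /c !colE mulmxA mulmxV.
have Tc : two_rows x0 p *m c = delta_mx ord0 ord0.
  apply/colP => i; have := congr1 (fun A : 'cV[C]_(2 + n) => A (lshift n i) ord0) Mc.
  by rewrite /= mul_col_mx col_mxEu => ->; rewrite !mxE eq_lshift andbT.
have Bc : B *m c = 0.
  apply/colP => i; have := congr1 (fun A : 'cV[C]_(2 + n) => A (rshift 2 i) ord0) Mc.
  by rewrite /= mul_col_mx col_mxEd => ->; rewrite !mxE eq_rlshift.
have x0c : x0 *m c = 1%:M.
  have := congr1 (row ord0) Tc; rewrite row_mul row0_two_rows => ->.
  by apply/rowP => i; rewrite (ord1 i) !mxE.
have pc : p *m c = 0.
  have := congr1 (row ord_max) Tc; rewrite row_mul row1_two_rows => ->.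
  by apply/rowP => i; rewrite (ord1 i) !mxE.
pose ell : hpoly C n := \sum_i c i ord0 *: mpolyX C (mnm1 i).
have ellE x : peval ell x = (x *m c) ord0 ord0.
  by rewrite peval_sum mxE; apply: eq_bigr => i _; rewrite pevalZ pevalX mulrC.
have homl : homogeneous 1 ell by apply: homogeneous_sum => i _; apply/homogeneousZ/homogeneousX.
pose h := dirderiv p F * ell.
have homh : homogeneous (d.-1 + 1) h by apply: homogeneousM => //; apply: homogeneous_dirderiv.
have h0 : h != 0.
  rewrite mulf_neq0 //; apply/eqP => E.
    by move/eqP: Dj; apply; rewrite -peval_dirderiv E /peval meval0.
  by have := ellE x0; rewrite E x0c /peval meval0 mxE => /esym/eqP; rewrite oner_eq0.
have c0 : c != 0.
  apply/eqP => cz; have := congr1 (fun A : 'M[C]_1 => A ord0 ord0) x0c.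
  by rewrite cz mulmx0 !mxE => /esym/eqP; rewrite oner_eq0.
have nh : contains_no_component F h.
  apply: contains_no_componentM; first exact: dirderiv_contains_no_component redF Fp frame1.
  have := @linear_form_contains_no_component _ _ _ _ _ _ redF Fp frame1 c c0 pc; exact.
exists [ffun I => P I * h], (g * h); split; first exact: form_on_mul homh h0 nh fP.
move=> x v [[x1 Fx] _] gx tv.
move: gx; rewrite pevalM mulf_eq0 negb_or pevalM mulf_eq0 negb_or peval_dirderiv => /and3P[gx Dx lx].
rewrite /form_at polyform_mul_scalar.
suff -> : polyform_at P x v = 0 by rewrite !mul0r.
have [[g0 [e [_ homP]] _ eP] _] := fP.
have xframe : exists (L : 'rV[C]_2) (b : 'rV[C]_n), x = L *m two_rows x0 p + b *m B.
  pose a : 'rV[C]_(2 + n) := x *m invmx M.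
  by exists (lsubmx a), (rsubmx a); rewrite -mul_row_col hsubmxK /a mulmxKV.
have [L [b xE]] := xframe.
pose l := L ord0 ord0.
have lE : peval ell x = l.
  rewrite ellE xE mulmxDl -!mulmxA Bc mulmx0 addr0 Tc !mxE big_ord_recl big_ord1 !mxE /=.
  by rewrite mulr1 mulr0 addr0.
have l0 : l != 0 by rewrite -lE.
pose b' := l^-1 *: b; pose Y := l^-1 * L ord0 ord_max.
pose x' := x0 + b' *m B + Y *: p.
have xx' : x = l *: x'.
  rewrite /x' !scalerDr -scalemxAl !scalerA mulfV // scale1r mulrA mulfV // mul1r.
  by rewrite xE mul_pair row0_two_rows row1_two_rows addrAC.
have Fx' : peval F x' = 0.
  by move/eqP: Fx; rewrite xx' (peval_scale _ _ homF) mulf_eq0 expf_eq0 (negPf l0) andbF => /eqP.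
have dx w : dpoly F x w = l ^+ d.-1 * dpoly F x' w by rewrite xx' (dpoly_scale _ _ _ homF).
rewrite xx' (polyform_scale_point _ _ _ homP).
rewrite (@fields_span_tangent P x' b' Y) ?mulr0 //.
- by move=> w k; apply: eP.
- exact: euler_on_hypersurface homF Fx'.
- by apply: contraNneq Dx; rewrite dx => ->; rewrite mulr0.
- by move=> k; have /eqP := tv k; rewrite dx mulf_eq0 expf_eq0 (negPf l0) andbF => /eqP.
- by move=> f; apply: Pf.
Qed.

End NullForms.

Section UpperBound.
Variables (C : numClosedFieldType) (n d q : nat) (F : hpoly C n).
Hypotheses (redF : reduced_equation d F) (d0 : (0 < d)%N).

Lemma abelian_common_denominator m (e : 'I_m.+1 -> qform C n q) : (forall i, abelian_form_on F d (e i)) ->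
  exists (P : 'I_m.+1 -> {ffun multi_index n q -> hpoly C n}) g,
    (forall i, form_on F (e i) (P i) g) /\
    forall i t xi, \rank t = 2%N -> intersection_points F t xi ->
      (forall j : 'I_d, peval g (xi j t) != 0) -> forall tau, trace_at (P i) g xi t tau = 0.
Proof.
move=> ab; have /choice[Pg PgP] i : exists Pg : {ffun multi_index n q -> hpoly C n} * hpoly C n,
    form_on F (e i) Pg.1 Pg.2 /\ forall t0 xi, \rank t0 = 2%N -> intersection_points F t0 xi ->
      (forall j : 'I_d, peval Pg.2 (xi j t0) != 0) -> forall tau, trace_at Pg.1 Pg.2 xi t0 tau = 0.
  by have [P [g H]] := ab i; exists (P, g).
have [Q [fQ gQ eQ]] := common_denominator (fun i => (PgP i).1).
exists Q, (\prod_i (Pg i).2); split=> // i t xi rt ip gx tau.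
rewrite -[RHS]((PgP i).2 t xi rt ip (fun j => gQ i _ (gx j)) tau).
by apply: eq_bigr => j _; rewrite eQ.
Qed.

(** There are more forms in the family than conditions in [normalized] for increasing
indices, so some combination satisfies them all; its remainders are zero. *)
Lemma abelian_forms_dependent
    (e : 'I_('C(n, q) * 'C(d + n - q - 1, n + 1)).+1 -> qform C n q) :
  (forall i, abelian_form_on F d (e i)) -> ~ independent_modulo (@null_form_on C n q F) e.
Proof.
have [F0 homF _] := redF.
move=> /abelian_common_denominator[P [g [fP tP]]] ind.
have [p [B1 [Fp frame1]]] := normalized_frame redF d0.
have [delta delta0 Hd] := generic_line_sections redF Fp frame1 (fP ord0).2.
have [x1 x10 /Hd[y [yinj]]] := nonzero_row_point delta0.
set x0 := x1 *m B1 => Fy gy.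
have Fpn : peval F p != 0 by rewrite Fp oner_eq0.
have rfp : row_free (two_rows p x0).
  by have := frame_line_free 0 frame1 x10; rewrite scale0r addr0.
have rk : \rank (two_rows x0 p) = 2%N.
  have rkp : \rank (two_rows p x0) = 2%N by apply/eqP; exact: rfp.
  transitivity (\rank (x0 + p)%MS); first by rewrite (addsmxE x0 p).
  by rewrite addsmxC (addsmxE p x0).
have [B frame] := @frame_completion C 2 n (two_rows x0 p) (introT eqP rk).
have /choice[rho rhoP] (iJ : 'I_('C(n, q) * 'C(d + n - q - 1, n + 1)).+1 * {ffun 'I_q -> 'I_n}) :=
  remainder_exists x0 B homF Fp (P iJ.1) iJ.2.
have [nu nuP] := conditions_count n d q.
pose yn k : C := nth 0 [seq y j | j <- enum 'I_d] k.
have ynE (j : 'I_d) : yn j = y j by rewrite /yn (nth_map j) ?size_enum_ord // nth_ord_enum.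
pose I : finType := ({J : {ffun 'I_q -> 'I_n} | increasing J} * 'I_('C(d + n - q - 1, n + 1)))%type.
have cI : (#|I| <= 'C(n, q) * 'C(d + n - q - 1, n + 1))%N.
  by rewrite card_prod card_ord leq_mul2r card_sig card_increasing orbT.
pose phi i (t : I) := (taylor_coefficient (rho (i, val t.1)) (nu t.2).2).[yn (nu t.2).1].
have [c c0 cP] := common_zero phi cI.
move/eqP: c0; apply; apply: ind.
pose Pc : {ffun multi_index n q -> hpoly C n} := [ffun I => \sum_i c ord0 i *: P i I].
have fc : form_on F (\sum_i c ord0 i *: e i) Pc g := form_on_linear_combination (fun i => c ord0 i) (ltn0Sn _) fP.
have eulc x : euler_free Pc x by have [[_ _ _ H] _] := fc; move=> v k; apply: H.
have trc t xi : \rank t = 2%N -> intersection_points F t xi ->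
    (forall j : 'I_d, peval g (xi j t) != 0) -> forall tau, trace_at Pc g xi t tau = 0.
  move=> rt ip gx tau; rewrite /trace_at /form_at.
  under eq_bigr do rewrite polyform_linear_combination mulr_suml.
  rewrite exchange_big big1 // => i _.
  under eq_bigr do rewrite -mulrA.
  by rewrite -mulr_sumr [X in _ * X](tP i t xi rt ip gx tau) mulr0.
have /choice[r rP] : forall f : {ffun 'I_q -> 'I_n}, exists rf,
    remainder_of d F x0 p B Pc f rf /\ normalized q y rf.
  move=> f; suff [rf H1 H2] : exists2 rf, remainder_of d F x0 p B Pc f rf & normalized q y rf by exists rf.
  apply: remainder_of_any => J incJ; exists (\sum_i mpolyC n (c ord0 i) *: rho (i, J)).
    by apply: remainder_linear_combination => i; apply: (rhoP (i, J)).
  move=> mu j jmu; have [k nuk] := nuP j mu jmu.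
  rewrite taylor_linear_combination horner_sum -[RHS](cP (exist _ J incJ, k)).
  by apply: eq_bigr => i _; rewrite /phi nuk /= hornerZ ynE.
have r0 := remainders_vanish homF Fpn rk yinj Fy gy eulc trc (fun f => (rP f).1) (fun f => (rP f).2).
pose j0 := Ordinal d0.
apply: (vanishing_fields_null redF Fp frame1 frame fc (Fy j0)).
  exact: transverse_derivative homF Fpn yinj Fy j0.
move=> f b Y FX; have [[_ H] _] := rP f.
by rewrite -H // r0 rmorph0 horner0.
Qed.

End UpperBound.

(** * Dimensions of the spaces of abelian forms *)
Section Dimensions.
Variables (C : numClosedFieldType) (n d : nat) (F : hpoly C n).
Hypotheses (redF : reduced_equation d F) (d0 : (0 < d)%N).

Lemma abelian_dimension_bounded q :
  exists m, omega_dim q d F m /\ (m <= 'C(n, q) * 'C(d + n - q - 1, n + 1))%N.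
Proof.
have [m qm mb] := quotient_dim_bounded (fun a x y => @null_form_combination C n q F x y a)
  (abelian_forms_dependent redF d0 (q := q)).
by exists m.
Qed.

(** For [d <= n + 1] the binomial coefficient is zero and the family is empty. *)
Lemma abelian_independent_family : exists e : 'I_('C(d - 1, n + 1)) -> qform C n n,
  (forall i, abelian_form_on F d (e i)) /\ independent_modulo (@null_form_on C n n F) e.
Proof.
have [dn|dn] := leqP d n.+1.
  have E : 'C(d - 1, n + 1) = 0%N by rewrite bin_small // addn1 ltnS; lia.
  rewrite E; exists (fun=> 0); split=> [[]//|c _].
  by apply/rowP => -[].
pose r := (d - n.+2)%N; have dE : d = (r + n).+2 by rewrite /r; lia.
have [p [B [Fp frame]]] := normalized_frame redF d0.
have := wedge_independent redF Fp frame dE.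
suff -> : 'C(d - 1, n + 1) = 'C(r + n.+1, r) by [].
have -> : (d - 1 = r + n.+1)%N by rewrite dE; lia.
have -> : (n + 1 = r + n.+1 - r)%N by lia.
by rewrite bin_sub ?leq_addr.
Qed.

Lemma top_abelian_dimension : omega_dim n d F 'C(d - 1, n + 1).
Proof.
have [e [eab eind]] := abelian_independent_family.
have dep : forall e' : 'I_('C(d - 1, n + 1)).+1 -> qform C n n,
    (forall i, abelian_form_on F d (e' i)) -> ~ independent_modulo (@null_form_on C n n F) e'.
  have := abelian_forms_dependent redF d0 (q := n).
  by rewrite binn mul1n addnK.
exact: quotient_dim_maximal (fun a x y => @null_form_combination C n n F x y a) _ e eab eind dep.
Qed.

End Dimensions.

Theorem mainTheorem6 (R : realType) (n d : nat) (F : hpoly R[i] n) :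
  (1 <= n)%N -> (1 <= d)%N -> reduced_equation d F ->
  (forall q : nat, (q <= n)%N ->
     exists m : nat, omega_dim q d F m /\
       (m <= 'C(n, q) * 'C(d + n - q - 1, n + 1))%N) /\
  omega_dim n d F 'C(d - 1, n + 1).
Proof.
move=> n1 d1 redF; split=> [q qn|]; first exact: abelian_dimension_bounded.
exact: top_abelian_dimension.
Qed.
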